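(* Let $\Omega=\bigcup_{i=1}^n(\alpha_i,\beta_i)$ with $-\infty<\alpha_1<\beta_1<\alpha_2<\beta_2<\dots<\alpha_n<\beta_n<\infty$. The set $\Omega$ is spectral if and only if there exists a strongly continuous one-parameter unitary group $(U(t))_{t\in\mathbb{R}}$ on $L^2(\Omega)$ with the property that, for all $t\in\mathbb{R}$ and $f\in L^2(\Omega)$, $$(U(t)f)(x)=f(x+t)\quad\text{for almost every }x\in\Omega\cap(\Omega-t).$$
   Context: For $\lambda\in\mathbb{R}$, $e_\lambda(x)=e^{2\pi \mathrm{i}\lambda x}$. $\Omega$ is spectral if there is a set $\Lambda\subset\mathbb{R}$ such that $\{|\Omega|^{-1/2}e_\lambda:\lambda\in\Lambda\}$ is an orthonormal basis of $L^2(\Omega)$, where $|\Omega|$ is Lebesgue measure. *)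

(* Defs.v *)
From HB Require Import structures.
From mathcomp Require Import all_boot all_order all_algebra.
From mathcomp Require Import complex.
From mathcomp Require Import all_classical all_reals all_analysis.

Set Implicit Arguments.
Unset Strict Implicit.
Unset Printing Implicit Defensive.

Import Order.TTheory GRing.Theory Num.Theory.
Import numFieldNormedType.Exports.

Local Open Scope classical_set_scope.
Local Open Scope ring_scope.
Local Open Scope complex_scope.

(* [L^2(D)] is handled as a setoid: its elements are represented by functions
   [R -> R[i]] whose values outside [D] are irrelevant, and equality is [ae_eq_on D].
   An operator on [L^2(D)] is a map on representatives that preserves [L2 D] and
   [ae_eq_on D]; see [operator].
   Measurability is Borel; every Lebesgue measurable function is almost everywhere
   equal to a Borel one, so the space of classes is the usual one. *)
Section L2.
Variable R : realType.
Local Notation mu := (@lebesgue_measure R).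
Local Notation normc := ComplexField.Normc.normc.
Implicit Types (D : set R) (f g : R -> R[i]).

Definition cmeasurable_fun D f : Prop :=
  measurable_fun D (fun x => complex.Re (f x)) /\
  measurable_fun D (fun x => complex.Im (f x)).

Definition cintegral D f : R[i] :=
  (\int[mu]_(x in D) complex.Re (f x)) +i*
  (\int[mu]_(x in D) complex.Im (f x)).

Definition L2 D : set (R -> R[i]) := [set f |
  cmeasurable_fun D f /\
  (\int[mu]_(x in D) (normc (f x) ^+ 2)%:E < +oo)%E].

Definition ae_eq_on D f g : Prop := f = g %[ae mu in D].

Definition inner D f g : R[i] := cintegral D (fun x => f x * (g x)^*).

Definition L2norm D f : R := Num.sqrt (\int[mu]_(x in D) normc (f x) ^+ 2).

Definition orthonormal_on D (I : eqType) (J : set I) (phi : I -> R -> R[i]) : Prop :=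
  (forall i, J i -> L2 D (phi i)) /\
  (forall i j, J i -> J j -> inner D (phi i) (phi j) = (i == j)%:R).

(* The linear span of the family is dense in [L^2(D)]. *)
Definition total_on D (I : Type) (J : set I) (phi : I -> R -> R[i]) : Prop :=
  forall f, L2 D f -> forall eps : R, 0 < eps ->
    exists (m : nat) (k : 'I_m -> I) (c : 'I_m -> R[i]),
      (forall j, J (k j)) /\
      L2norm D (fun x => f x - \sum_(j < m) c j * phi (k j) x) < eps.

Definition orthonormal_basis_on D (I : eqType) (J : set I)
    (phi : I -> R -> R[i]) : Prop :=
  orthonormal_on D J phi /\ total_on D J phi.

Definition expi (l : R) : R -> R[i] :=
  fun x => cos (2 * pi * l * x) +i* sin (2 * pi * l * x).

Definition spectral D : Prop := exists Lambda : set R,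
  orthonormal_basis_on D Lambda
    (fun l x => ((Num.sqrt (fine (mu D)))^-1)%:C * expi l x).

Definition operator D (V : (R -> R[i]) -> (R -> R[i])) : Prop :=
  (forall f, L2 D f -> L2 D (V f)) /\
  (forall f g, L2 D f -> L2 D g -> ae_eq_on D f g -> ae_eq_on D (V f) (V g)).

Definition linear_on D (V : (R -> R[i]) -> (R -> R[i])) : Prop :=
  forall (a : R[i]) f g, L2 D f -> L2 D g ->
    ae_eq_on D (V (fun x => a * f x + g x)) (fun x => a * V f x + V g x).

Definition unitary_on D (V : (R -> R[i]) -> (R -> R[i])) : Prop :=
  [/\ operator D V,
      linear_on D V,
      (forall f g, L2 D f -> L2 D g -> inner D (V f) (V g) = inner D f g) &
      (forall g, L2 D g -> exists2 f, L2 D f & ae_eq_on D (V f) g)].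

Definition strongly_continuous_on D (U : R -> (R -> R[i]) -> (R -> R[i])) : Prop :=
  forall f, L2 D f -> forall t0 : R,
    L2norm D (fun x => U t f x - U t0 f x) @[t --> t0] --> (0 : R).

Definition unitary_group_on D (U : R -> (R -> R[i]) -> (R -> R[i])) : Prop :=
  [/\ forall t, unitary_on D (U t),
      forall f, L2 D f -> ae_eq_on D (U 0 f) f,
      forall s t f, L2 D f -> ae_eq_on D (U (s + t) f) (U s (U t f)) &
      strongly_continuous_on D U].

End L2.

(* Main.v *)
(* If [Omega] is spectral, translating the exponentials of a spectrum multiplies them
   by unimodular constants, hence is isometric on their span, and extends to a unitary
   group by density.  Conversely, let [U] be a unitary group that translates locally.
   The energy of [f] is the supremum over [h] of |U(h) f - f|^2 / h^2.  A Poincare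
   inequality on small cells of [Omega] shows that bounded energy implies precompactness,
   so on the orthogonal complement [P] of all the exponentials that are eigenvectors of
   [U] a unit vector [f] of minimal energy [m] exists, unless no nonzero vector of [P] has
   finite energy.  Its Euler-Lagrange equation makes t |-> <U(t) f, f> solve
   [w'' = - m w], so that this function is [cos (sqrt m t)] and [P] contains an
   eigenvector of [U].  By the local translation property that eigenvector is, up to a
   constant, an exponential on all of [Omega], components included, because the shifts of
   [Omega] relate any two of its points; this contradicts the definition of [P].  Hence
   [P] has no nonzero vector of finite energy, and since the vectors of finite energy
   (Lipschitz functions supported inside [Omega]) are dense and the projection on [P]
   commutes with [U], [P = 0]. *)

Require Import Defs.
From HB Require Import structures.
From mathcomp Require Import all_boot all_order all_algebra.
From mathcomp Require Import complex ring lra.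
From mathcomp Require Import all_classical all_reals all_analysis.
From mathcomp Require Import measurable_realfun.

Set Implicit Arguments.
Unset Strict Implicit.
Unset Printing Implicit Defensive.

Import Order.TTheory GRing.Theory Num.Theory.
Import numFieldNormedType.Exports.

Local Open Scope classical_set_scope.
Local Open Scope ring_scope.

Local Notation normc := ComplexField.Normc.normc.

(** * Real pre-Hilbert spaces *)

(** Working with the generator of [U] would bring in an unbounded operator, its domain and its
    spectral theorem. The energy replaces it: the quotients |U(h) f - f|^2 / h^2 are defined for
    every vector, and along h = 2^-k they increase with k, so their supremum is a limit although it
    has no derivative. The Euler-Lagrange equation is therefore an inequality at each dyadic step,
    with an error uniform in t, and [w'' = - m w] is only used through second differences. The
    variational part concerns a real quadratic form, so it is done in a real space with the real
    part of the inner product; multiplication by i enters afterwards as an isometry [J], which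
    splits a plane rotated by [U] into eigenvectors. Vectors are functions and not classes, so
    operators obey their laws only up to null vectors, and these laws are stated after pairing with
    an arbitrary [z]. One identity, writing the variance of a function on a set as an integral over
    shifts, yields both the Poincare inequality and the constancy of shift-invariant functions. *)

(* The form may be degenerate, as [L2 D] consists of functions rather than classes;
   equality of [x] and [y] in the space is [ip (x - y) (x - y) = 0]. *)
Record is_preip (R : realType) (V : lmodType R) (ip : V -> V -> R) : Prop := {
  ipDl : forall x y z, ip (x + y) z = ip x z + ip y z;
  ipZl : forall a x y, ip (a *: x) y = a * ip x y;
  ipC : forall x y, ip x y = ip y x;
  ip_ge0 : forall x, 0 <= ip x x }.

Section PreHilbert.
Context (R : realType) (V : lmodType R) (ip : V -> V -> R).
Hypothesis ipP : is_preip ip.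
Implicit Types (x y z : V) (a b : R).

Let DL := ipDl ipP.
Let ZL := ipZl ipP.
Let SC := ipC ipP.
Let G0 := ip_ge0 ipP.

Definition nrm x := Num.sqrt (ip x x).

Definition ncvg (u : nat -> V) (l : V) : Prop :=
  (fun n => nrm (u n - l)) @ \oo --> (0 : R).

(* Every Cauchy sequence has a subsequence of this kind. *)
Definition complete_ip : Prop := forall u : nat -> V,
  (forall n, nrm (u n.+1 - u n) <= 2 ^- n) -> exists l, ncvg u l.

Lemma ipDr x y z : ip x (y + z) = ip x y + ip x z.
Proof. by rewrite SC DL !(SC _ x). Qed.

Lemma ipZr a x y : ip x (a *: y) = a * ip x y.
Proof. by rewrite SC ZL (SC _ x). Qed.

Lemma ip0l x : ip 0 x = 0.
Proof. by rewrite -[0](scale0r 0) ZL mul0r. Qed.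

Lemma ip0r x : ip x 0 = 0.
Proof. by rewrite SC ip0l. Qed.

Lemma ipNl x y : ip (- x) y = - ip x y.
Proof. by rewrite -scaleN1r ZL mulN1r. Qed.

Lemma ipNr x y : ip x (- y) = - ip x y.
Proof. by rewrite -scaleN1r ipZr mulN1r. Qed.

Lemma ipBl x y z : ip (x - y) z = ip x z - ip y z.
Proof. by rewrite DL ipNl. Qed.

Lemma ipBr x y z : ip x (y - z) = ip x y - ip x z.
Proof. by rewrite ipDr ipNr. Qed.

Definition ipE := (ipBl, ipBr, ipNl, ipNr, DL, ipDr, ZL, ipZr).

Lemma ip_suml (I : Type) (s : seq I) (F : I -> V) y :
  ip (\sum_(i <- s) F i) y = \sum_(i <- s) ip (F i) y.
Proof. by elim/big_rec2: _ => [|i a x _ <-]; rewrite ?ip0l ?DL. Qed.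

Lemma ip_parallelogram x y :
  ip (x + y) (x + y) + ip (x - y) (x - y) = 2 * ip x x + 2 * ip y y.
Proof. by rewrite !ipE (SC y x); ring. Qed.

(** A nonnegative quadratic without constant term has its minimum at 0, where its derivative [b]
    must vanish. *)
Lemma quad_ge0_lin0 (b c : R) :
  (forall s : R, 0 <= s * b + s ^+ 2 * c) -> b = 0.
Proof.
move=> h; have [c0|c0] := lerP c 0.
  have := h 1; have := h (-1); rewrite !expr2; nra.
have := h (- b / (2 * c)).
have -> : - b / (2 * c) * b + (- b / (2 * c)) ^+ 2 * c = - (b ^+ 2 / (4 * c)).
  by field; rewrite gt_eqF.
rewrite oppr_ge0 pmulr_lle0 ?invr_gt0; last by rewrite mulr_gt0.
by move=> b2; apply/eqP; rewrite -sqrf_eq0 eq_le b2 sqr_ge0.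
Qed.

Lemma ip_CS x y : ip x y ^+ 2 <= ip x x * ip y y.
Proof.
have Q s : 0 <= ip x x + s * (2 * ip x y) + s ^+ 2 * ip y y.
  apply: le_trans (G0 (x + s *: y)) _.
  by rewrite !ipE (SC y x) le_eqVlt; apply/orP; left; apply/eqP; ring.
have [y0|y0] := eqVneq (ip y y) 0.
  have /quad_ge0_lin0 : forall s : R, 0 <= s * (ip x y) + s ^+ 2 * ip x x.
    move=> s; have := G0 (s *: x + y); rewrite !ipE (SC y x) y0.
    have := G0 (s *: x + 2^-1 *: y); rewrite !ipE (SC y x) y0.
    rewrite !expr2; lra.
  by move=> ->; rewrite expr0n /= mulr_ge0.
have yp : 0 < ip y y by rewrite lt_def y0 G0.
have := Q (- ip x y / ip y y).
have -> : ip x x + - ip x y / ip y y * (2 * ip x y) +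
    (- ip x y / ip y y) ^+ 2 * ip y y = ip x x - ip x y ^+ 2 / ip y y.
  by field.
by rewrite subr_ge0 ler_pdivrMr.
Qed.

Lemma nrm_ge0 x : 0 <= nrm x. Proof. exact: sqrtr_ge0. Qed.

Lemma nrm2 x : nrm x ^+ 2 = ip x x. Proof. by rewrite sqr_sqrtr. Qed.

Lemma ip_le_nrm x y : `|ip x y| <= nrm x * nrm y.
Proof.
rewrite -(@ler_pXn2r _ 2) ?nnegrE ?mulr_ge0 ?nrm_ge0//.
by rewrite exprMn !nrm2 real_normK ?num_real// ip_CS.
Qed.

Lemma weak_continuous (f : R -> V) (t0 : R) z :
  nrm (f t - f t0) @[t --> t0] --> (0 : R) ->
  (fun t => ip (f t) z) @ t0 --> ip (f t0) z.
Proof.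
move=> c.
have c2 : (fun t => nrm (f t - f t0) * nrm z) @ t0 --> (0 : R).
  by rewrite -(mul0r (nrm z)); apply: cvgM; [exact: c|exact: cvg_cst].
apply/cvgrPdist_lt => d d0; move/cvgrPdist_lt : c2 => /(_ _ d0).
apply: filterS => t; rewrite sub0r normrN => /(le_lt_trans (ler_norm _)) h.
rewrite distrC -ipBl; apply: le_lt_trans h.
exact: ip_le_nrm.
Qed.

Lemma nrmD x y : nrm (x + y) <= nrm x + nrm y.
Proof.
rewrite -(@ler_pXn2r _ 2) ?nnegrE ?addr_ge0 ?nrm_ge0// nrm2 !ipE sqrrD !nrm2.
have := ip_le_nrm x y; rewrite ler_norml (SC y x) => /andP[_ ?]; lra.
Qed.

Lemma nrmZ a x : nrm (a *: x) = `|a| * nrm x.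
Proof. by rewrite /nrm !ipE mulrA sqrtrM ?sqr_ge0// -expr2 sqrtr_sqr. Qed.

Lemma nrmN x : nrm (- x) = nrm x.
Proof. by rewrite -scaleN1r nrmZ normrN1 mul1r. Qed.

Lemma nrmC x y : nrm (x - y) = nrm (y - x).
Proof. by rewrite -nrmN opprB. Qed.

Lemma nrmB_trans y x z : nrm (x - z) <= nrm (x - y) + nrm (y - z).
Proof. by apply: le_trans (nrmD _ _); rewrite addrA subrK. Qed.

Lemma nrm0 : nrm 0 = 0. Proof. by rewrite /nrm ip0l sqrtr0. Qed.

Lemma ip_eq0l x y : ip x x = 0 -> ip x y = 0.
Proof.
move=> x0; apply/eqP; rewrite -sqrf_eq0 eq_le sqr_ge0 andbT.
by rewrite (le_trans (ip_CS _ _))// x0 mul0r.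
Qed.

Lemma ip_congr x y z : ip (x - y) (x - y) = 0 -> ip x z = ip y z.
Proof. by move=> /(ip_eq0l z); rewrite ipBl => /eqP; rewrite subr_eq0 => /eqP. Qed.

Lemma ip_close x y z : ip (x - y) (x - y) = 0 -> ip (x - z) (x - z) = ip (y - z) (y - z).
Proof.
move=> h; have C := ip_congr _ h.
by rewrite !ipE (C x) (SC y x) (C y) (C z) (SC z x) (C z) (SC z y).
Qed.

Lemma nrm_le x (e : R) : 0 <= e -> ip x x <= e ^+ 2 -> nrm x <= e.
Proof. by move=> e0 h; rewrite -(@ler_pXn2r _ 2) ?nnegrE ?nrm_ge0// nrm2. Qed.

Lemma ncvg_ip2 u v l m : ncvg u l -> ncvg v m ->
  (fun n => ip (u n) (v n)) @ \oo --> ip l m.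
Proof.
move=> ul vm.
have N (f g : nat -> R) : (forall n, `|f n| <= g n) ->
    g @ \oo --> (0 : R) -> f @ \oo --> (0 : R).
  move=> fg g0; apply/norm_cvg0P.
  apply: (@squeeze_cvgr _ _ _ _ (cst 0) g) => //; last exact: cvg_cst.
  by apply: nearW => n; rewrite normr_ge0/=.
have c1 : (fun n => ip (u n - l) (v n - m)) @ \oo --> (0 : R).
  apply: (N _ (fun n => nrm (u n - l) * nrm (v n - m))).
    by move=> n; exact: ip_le_nrm.
  by rewrite -(mulr0 (0 : R)); apply: cvgM.
have c2 : (fun n => ip (u n - l) m) @ \oo --> (0 : R).
  apply: (N _ (fun n => nrm (u n - l) * nrm m)).
    by move=> n; exact: ip_le_nrm.
  by rewrite -(mul0r (nrm m)); apply: cvgM => //; exact: cvg_cst.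
have c3 : (fun n => ip l (v n - m)) @ \oo --> (0 : R).
  apply: (N _ (fun n => nrm l * nrm (v n - m))).
    by move=> n; exact: ip_le_nrm.
  by rewrite -(mulr0 (nrm l)); apply: cvgM => //; exact: cvg_cst.
have c4 : (fun=> ip l m) @ \oo --> ip l m by exact: cvg_cst.
have c5 := cvgD (cvgD (cvgD c1 c2) c3) c4; rewrite !add0r in c5.
rewrite (_ : (fun n => ip (u n) (v n)) = (fun n => ip (u n - l) (v n - m)
   + ip (u n - l) m + ip l (v n - m) + ip l m)); first exact: c5.
by apply/funext => n; rewrite !ipE; ring.
Qed.

Lemma ncvg_cst l : ncvg (fun=> l) l.
Proof. by rewrite /ncvg; under eq_fun do rewrite subrr nrm0; exact: cvg_cst. Qed.

Lemma ncvg_ip u l y : ncvg u l -> (fun n => ip (u n) y) @ \oo --> ip l y.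
Proof. by move=> ul; apply: ncvg_ip2 => //; exact: ncvg_cst. Qed.

Lemma ncvgB u v l m : ncvg u l -> ncvg v m -> ncvg (fun n => u n - v n) (l - m).
Proof.
move=> ul vm; apply: (@squeeze_cvgr _ _ _ _ (cst 0)
    (fun n => nrm (u n - l) + nrm (v n - m))); last 2 first.
- exact: cvg_cst.
- by rewrite -(addr0 (0 : R)); exact: cvgD.
apply: nearW => n; rewrite nrm_ge0/= -(nrmN (v n - m)).
by apply: le_trans (nrmD _ _); rewrite !opprD !opprK addrACA.
Qed.

Lemma ncvgZ a u l : ncvg u l -> ncvg (fun n => a *: u n) (a *: l).
Proof.
move=> ul; rewrite /ncvg; under eq_fun do rewrite -scalerBr nrmZ.
by rewrite -(mulr0 `|a|); apply: cvgM => //; exact: cvg_cst.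
Qed.

Lemma ncvgD u v l m : ncvg u l -> ncvg v m -> ncvg (fun n => u n + v n) (l + m).
Proof.
move=> ul vm.
have := ncvgB ul (ncvgZ (-1) vm); rewrite scaleN1r opprK.
by under eq_fun do rewrite scaleN1r opprK.
Qed.

Lemma ncvg_dist2 u l : ncvg u l -> (fun n => ip (l - u n) (l - u n)) @ \oo --> (0 : R).
Proof.
move=> ul; have c := ncvgB (ncvg_cst l) ul.
by have := ncvg_ip2 c c; rewrite subrr ip0l.
Qed.

Lemma ncvg_lt u l (e : R) : ncvg u l -> 0 < e -> exists n, nrm (u n - l) < e.
Proof.
move=> /cvgrPdist_lt/(_ _)/[apply] -[N _ /(_ N)]; rewrite /= sub0r normrN.
by rewrite ger0_norm ?nrm_ge0// => h; exists N; apply: h.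
Qed.

Lemma cvg_ge_lim (f : nat -> R) (l c : R) :
  f @ \oo --> l -> (forall n, c <= f n) -> c <= l.
Proof.
move=> fl cf; rewrite -(cvg_lim _ fl)//.
by apply: limr_ge; [apply/cvg_ex; exists l | exact: nearW].
Qed.

Lemma cvg_le_lim (f : nat -> R) (l c : R) :
  f @ \oo --> l -> (forall n, f n <= c) -> l <= c.
Proof.
move=> fl cf; rewrite -(cvg_lim _ fl)//.
by apply: limr_le; [apply/cvg_ex; exists l | exact: nearW].
Qed.

Lemma cvg_const_lim (f : nat -> R) (l c : R) :
  f @ \oo --> l -> (forall n, f n = c) -> l = c.
Proof.
by move=> fl cf; apply/eqP; rewrite eq_le (cvg_le_lim fl) ?(cvg_ge_lim fl)// =>
  n; rewrite cf.
Qed.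

Section Projection.
Context (W : V -> Prop).
Hypothesis W0 : W 0.
Hypothesis WD : forall x y, W x -> W y -> W (x + y).
Hypothesis WZ : forall a x, W x -> W (a *: x).
Hypothesis complete : complete_ip.

Definition perp x := forall w, W w -> ip x w = 0.

(** [W] is not assumed closed, so the nearest point [p] is only a limit of elements of [W]. A
    minimising sequence is Cauchy by the parallelogram law, and at the minimum the first variation
    in each direction of [W] vanishes. *)
Lemma projection x : exists p (w : nat -> V),
  [/\ forall n, W (w n), ncvg w p & perp (x - p)].
Proof.
pose S := [set ip (x - w) (x - w) | w in W].
have S0 : S !=set0 by exists (ip (x - 0) (x - 0)), 0.
have Slb : has_inf S by split => //; exists 0 => _ [w _ <-]; exact: G0.
set d := inf S.
have dle w : W w -> d <= ip (x - w) (x - w).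
  by move=> Ww; apply: ge_inf; [case: Slb | exists w].
have e0 n : 0 < (4^-1 : R) ^+ n.+1 by rewrite exprn_gt0// invr_gt0.
(* With excess [4^-1 ^+ n.+1] over the infimum, the parallelogram law bounds the squared increment
   by 5/2 of this number, which is below the [(2 ^- n) ^+ 2] that [complete_ip] asks for. *)
have /choice[w wP] : forall n, exists w,
    W w /\ ip (x - w) (x - w) < d + 4^-1 ^+ n.+1.
  by move=> n; have [_ [w Ww <-] wd] := inf_adherent (e0 n) Slb; exists w.
have Ww n := (wP n).1; have wd n := (wP n).2.
have [|p wp] := complete (u := w).
  move=> n; apply: nrm_le; first by rewrite invr_ge0 exprn_ge0.
  have := ip_parallelogram (x - w n) (x - w n.+1).
  have -> : x - w n - (x - w n.+1) = w n.+1 - w n.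
    by rewrite opprB addrC addrA subrK.
  have -> : x - w n + (x - w n.+1) = 2 *: (x - 2^-1 *: (w n + w n.+1)).
    rewrite scalerBr scalerA divff ?pnatr_eq0// scale1r scaler_nat mulr2n.
    by rewrite addrACA opprD.
  have := dle _ (WZ 2^-1 (WD (Ww n) (Ww n.+1))).
  have := wd n; have := wd n.+1; rewrite ZL ipZr.
  have -> : (2 ^- n) ^+ 2 = 4 * 4^-1 ^+ n.+1 :> R.
    rewrite [X in _ = _ * X]exprS mulrA divff ?pnatr_eq0// mul1r -exprVn -exprM mulnC exprM.
    by congr (_ ^+ n); rewrite expr2; field.
  have -> : 4^-1 ^+ n.+2 = 4^-1 * 4^-1 ^+ n.+1 :> R by rewrite -exprS.
  have := e0 n; set E := _ ^+ n.+1; lra.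
exists p, w; split => // v Wv.
have h s : d <= ip (x - p - s *: v) (x - p - s *: v).
  have c : ncvg (fun n => x - w n - s *: v) (x - p - s *: v).
    by apply: ncvgB; [apply: ncvgB => //|]; exact: ncvg_cst.
  apply: cvg_ge_lim (ncvg_ip2 c c) _ => n.
  rewrite -addrA -opprD; apply: dle; apply: WD => //; exact: WZ.
have h' : ip (x - p) (x - p) <= d.
  have c : ncvg (fun n => x - w n) (x - p).
    by apply: ncvgB => //; exact: ncvg_cst.
  have e0' : (fun n => d + 4^-1 ^+ n.+1) @ \oo --> d.
    rewrite -[X in _ --> X]addr0; apply: cvgD; first exact: cvg_cst.
    have h4 : @GRing.exp R 4^-1 @ \oo --> (0 : R).
      by apply: cvg_expr; rewrite ger0_norm//; lra.
    by move: h4; rewrite -(cvg_shiftS (@GRing.exp R 4^-1)).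
  apply: ler_cvg_to (ncvg_ip2 c c) e0' _.
  by apply: nearW => n; apply: ltW; exact: wd.
have /quad_ge0_lin0 : forall s : R,
    0 <= s * (- 2 * ip (x - p) v) + s ^+ 2 * ip v v.
  move=> s; have := le_trans h' (h s); move: (x - p) => y.
  by rewrite !ipE (SC v y); nra.
by move=> h2; lra.
Unshelve. all: by end_near.
Qed.
End Projection.
End PreHilbert.

(** * Orthogonal groups and their energy *)

(** Carries estimates from multiples of 2^-k to all h by continuity. Approximation from below
    matters: it keeps the points inside [0, h]. *)
Lemma dyadic_floor_cvg (R : realType) (h : R) : 0 <= h ->
  exists2 j : nat -> nat, (forall k, (j k)%:R / 2 ^+ k <= h) &
    (fun k => (j k)%:R / 2 ^+ k) @ \oo --> h.
Proof.
move=> h0; pose j k := Num.truncn (h * 2 ^+ k).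
pose r k := (j k)%:R / 2 ^+ k : R.
have rle k : r k <= h < r k + 2 ^- k.
  have p2 : 0 < 2 ^+ k :> R by rewrite exprn_gt0.
  have /truncn_itv : 0 <= h * 2 ^+ k by rewrite mulr_ge0// ltW.
  have -> : r k + 2 ^- k = (j k).+1%:R / 2 ^+ k.
    by rewrite -[(j k).+1%:R]natr1 mulrDl mul1r.
  by rewrite ler_pdivrMr// ltr_pdivlMr.
exists j; first by move=> k; case/andP: (rle k).
apply: (@squeeze_cvgr _ _ _ _ (fun k => h - 2 ^- k) (cst h)); last 2 first.
- rewrite -[X in _ --> X]subr0; apply: cvgB; first exact: cvg_cst.
  have h2 : @GRing.exp R 2^-1 @ \oo --> (0 : R).
    by apply: cvg_expr; rewrite ger0_norm//; lra.
  by under eq_fun do rewrite -exprVn; exact: h2.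
- exact: cvg_cst.
- apply: nearW => k; case/andP: (rle k) => -> hr /=.
  by rewrite lerBlDr ltW.
Qed.

(** The laws are tested against [z] because they hold only up to null vectors. For isometries weak
    continuity is equivalent to strong continuity, as |U t x - U s x|^2 = 2 |x|^2 - 2 ip (U t x) (U
    s x). *)
Record is_ogroup (R : realType) (V : lmodType R) (ip : V -> V -> R)
    (U : R -> V -> V) : Prop := {
  Uiso : forall t x y, ip (U t x) (U t y) = ip x y;
  Ulin : forall t a x y z,
    ip (U t (a *: x + y)) z = a * ip (U t x) z + ip (U t y) z;
  Uid : forall x z, ip (U 0 x) z = ip x z;
  Uadd : forall s t x z, ip (U (s + t) x) z = ip (U s (U t x)) z;
  Ucont : forall x z, continuous (fun t => ip (U t x) z) }.

Section OrthogonalGroup.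
Context (R : realType) (V : lmodType R) (ip : V -> V -> R).
Hypothesis ipP : is_preip ip.
Context (U : R -> V -> V).
Hypothesis UP : is_ogroup ip U.
Implicit Types (x y z : V) (a b t h M : R).

Let SC := ipC ipP.
Let E := ipE ipP.

Local Notation nrm := (nrm ip).

Lemma Uadj t x y : ip (U t x) y = ip x (U (- t) y).
Proof.
rewrite -(Uiso UP t x) [RHS]SC -(Uadd UP) subrr (Uid UP); exact: SC.
Qed.

Lemma UDl t x y z : ip (U t (x + y)) z = ip (U t x) z + ip (U t y) z.
Proof. by rewrite -{1}[x]scale1r (Ulin UP) mul1r. Qed.

Lemma U0v t z : ip (U t 0) z = 0.
Proof. by have := UDl t 0 0 z; rewrite addr0 => h; lra. Qed.

Lemma UZl t a x z : ip (U t (a *: x)) z = a * ip (U t x) z.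
Proof. by rewrite -[a *: x]addr0 (Ulin UP) U0v addr0. Qed.

Lemma UNl t x z : ip (U t (- x)) z = - ip (U t x) z.
Proof. by rewrite -scaleN1r UZl mulN1r. Qed.

Lemma UBl t x y z : ip (U t (x - y)) z = ip (U t x) z - ip (U t y) z.
Proof. by rewrite UDl UNl. Qed.

Lemma UDr t x y z : ip z (U t (x + y)) = ip z (U t x) + ip z (U t y).
Proof. by rewrite !(SC z) UDl. Qed.

Lemma UBr t x y z : ip z (U t (x - y)) = ip z (U t x) - ip z (U t y).
Proof. by rewrite !(SC z) UBl. Qed.

Definition UE := (UDl, UBl, UZl, UNl, UDr, UBr).

(** The polarisation of |U h x - x|^2, see [dqE]. It is minus the second difference at 0 of h |->
    [ip (U h x) y], which is how the equation [w'' = - m w] will appear. *)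
Definition dq h x y := 2 * ip x y - ip (U h x) y - ip (U (- h) x) y.

Lemma dqE h x y : ip (U h x - x) (U h y - y) = dq h x y.
Proof.
rewrite /dq !E (Uiso UP) (SC x (U h y)) (Uadj h y x) (SC y).
by rewrite mulr_natl mulr2n; ring.
Qed.

Lemma dqD h x y z : dq h (x + y) z = dq h x z + dq h y z.
Proof. by rewrite /dq !E !UE; ring. Qed.

Lemma dqN h x z : dq h (- x) z = - dq h x z.
Proof. by rewrite /dq !E !UE; ring. Qed.

Lemma dqC h x y : dq h x y = dq h y x.
Proof. by rewrite -!dqE SC. Qed.

Lemma dqDD h x y : dq h (x + y) (x + y) = dq h x x + 2 * dq h x y + dq h y y.
Proof. by rewrite dqD 2![dq h _ (x + y)]dqC !dqD (dqC h y x); ring. Qed.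

Lemma dqBB h x y : dq h (x - y) (x - y) = dq h x x - 2 * dq h x y + dq h y y.
Proof.
by rewrite dqDD [dq h (- y) _]dqN ![dq h _ (- y)]dqC !dqN (dqC h y x); ring.
Qed.

Lemma dq_ge0 h x : 0 <= dq h x x.
Proof. by rewrite -dqE (ip_ge0 ipP). Qed.

Lemma dq_nrm h x : Num.sqrt (dq h x x) = nrm (U h x - x).
Proof. by rewrite -dqE. Qed.

Lemma dqU h t x y : dq h (U t x) (U t y) = dq h x y.
Proof.
rewrite /dq (Uiso UP); congr (_ - _ - _).
  by rewrite -(Uadd UP) addrC (Uadd UP) (Uiso UP).
by rewrite -(Uadd UP) addrC (Uadd UP) (Uiso UP).
Qed.

Lemma dq_opp h x : dq (- h) x x = dq h x x.
Proof. by rewrite /dq opprK; ring. Qed.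

(** Telescoping: [U (n h) x - x] is a sum of [n] isometric images of [U h x - x]. *)
Lemma dqMn n h x : dq (n%:R * h) x x <= n%:R ^+ 2 * dq h x x.
Proof.
rewrite -ler_sqrt ?mulr_ge0 ?sqr_ge0 ?dq_ge0// sqrtrM ?sqr_ge0// sqrtr_sqr.
rewrite ger0_norm// !dq_nrm; elim: n => [|n IH].
  rewrite !mul0r le_eqVlt; apply/orP; left; apply/eqP.
  rewrite -dq_nrm /dq oppr0 !(Uid UP) (_ : 2 * _ - _ - _ = 0) ?sqrtr0//; ring.
rewrite -natr1 mulrDl mulrDl !mul1r.
have -> : nrm (U (n%:R * h + h) x - x) = nrm (U (n%:R * h) (U h x) - x).
  rewrite /nrm; congr Num.sqrt; rewrite !E !(Uiso UP).
  by rewrite !(SC x) !(Uadd UP).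
apply: le_trans (nrmB_trans ipP (U (n%:R * h) x) _ _) _.
rewrite addrC lerD//.
rewrite le_eqVlt; apply/orP; left; apply/eqP.
by rewrite /nrm; congr Num.sqrt; rewrite !E !(Uiso UP).
Qed.

Lemma dq_continuous x : continuous (fun h => dq h x x).
Proof.
move=> h; rewrite /dq; apply: cvgB; first apply: cvgB.
- exact: cvg_cst.
- exact: (Ucont UP).
- apply: (@continuous_comp _ _ _ (fun h => - h) (fun h => ip (U h x) x)).
    exact: continuousN.
  exact: (Ucont UP).
Qed.

(** The energy is a supremum that may be infinite; only its finite bounds are ever named. *)
Definition energy_le M x := forall h, dq h x x <= M * h ^+ 2.

(** The difference quotient at the step h = 2^-k, where 1 / h^2 is 4^k, in polarised form. *)
Definition dyadic_energy k x y := 4 ^+ k * dq (2 ^- k) x y.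

(* |U(2h) x - x| <= 2 |U(h) x - x|. *)
Lemma dyadic_energy_homo x k l : (k <= l)%N ->
  dyadic_energy k x x <= dyadic_energy l x x.
Proof.
move=> /subnK <-; elim: (l - k)%N => //= n IH.
rewrite (le_trans IH)// addSn /dyadic_energy exprS (mulrC 4) -mulrA ler_pM2l ?exprn_gt0//.
have := dqMn 2 (2 ^- (n + k).+1) x.
by rewrite exprS invfM mulrA divff// mul1r expr2 -natrM.
Qed.

(** At a dyadic point r = j / 2^k, [dqMn] bounds [dq r] by r^2 times the dyadic energy; such points
    tend to h from below and [dq] is continuous in h. *)
Lemma dyadic_energyP M x : (forall k, dyadic_energy k x x <= M) -> energy_le M x.
Proof.
move=> hM h.
wlog h0 : h / 0 <= h.
  have [h0|h0] := leP 0 h; first exact.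
  by move=> /(_ (- h)); rewrite dq_opp sqrrN; apply; rewrite oppr_ge0 ltW.
have [j rle rh] := dyadic_floor_cvg h0.
pose r k := (j k)%:R / 2 ^+ k : R.
have M0 : 0 <= M by apply: le_trans (hM 0); rewrite mulr_ge0 ?dq_ge0 ?exprn_ge0.
have c : (fun k => dq (r k) x x) @ \oo --> dq h x x.
  exact: (@cvg_comp _ _ _ r (fun h => dq h x x) _ _ _ rh (@dq_continuous x h)).
apply: (cvg_le_lim c) => k.
apply: le_trans (dqMn _ _ _) _.
have -> : (j k)%:R ^+ 2 * dq (2 ^- k) x x = r k ^+ 2 * dyadic_energy k x x.
  rewrite /dyadic_energy /r; move: (dq _ _ _) => D.
  have -> : 4 ^+ k = 2 ^+ k ^+ 2 :> R by rewrite -exprM mulnC exprM expr2 -natrM.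
  by field; rewrite expf_neq0.
rewrite mulrC ler_pM ?dyadic_energy_ge0 ?sqr_ge0//.
  by rewrite mulr_ge0 ?dq_ge0 ?exprn_ge0.
by rewrite ler_sqr ?nnegrE ?rle// /r divr_ge0// exprn_ge0.
Qed.

Lemma energy_le_dyadic M x k : energy_le M x -> dyadic_energy k x x <= M.
Proof.
move=> /(_ (2 ^- k)); rewrite -ler_pdivrMr; last by rewrite exprn_gt0// invr_gt0 exprn_gt0.
by rewrite /dyadic_energy mulrC; rewrite exprVn invrK -exprM mulnC exprM expr2 -natrM.
Qed.

Lemma energy_leU M t x : energy_le M x -> energy_le M (U t x).
Proof. by move=> e h; rewrite dqU. Qed.

End OrthogonalGroup.

(** * Vectors of minimal energy and their Euler-Lagrange equation *)

Section MinimalEnergy.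
Context (R : realType) (V : lmodType R) (ip : V -> V -> R).
Hypothesis ipP : is_preip ip.
Context (U : R -> V -> V).
Hypothesis UP : is_ogroup ip U.
Implicit Types (x y z : V) (a b t h M : R).

Local Notation nrm := (nrm ip).
Local Notation energy_le := (energy_le ip U).
Local Notation dq := (dq ip U).
Local Notation dyadic_energy := (dyadic_energy ip U).

Let SC := ipC ipP.
Let E := ipE ipP.

(* Up to [e * M], the norm is controlled by finitely many coordinates; this makes sets
   of bounded energy precompact. *)
Definition compact_energy : Prop := forall e : R, 0 < e ->
  exists s : seq V, forall x M, energy_le M x ->
    ip x x <= \sum_(c <- s) ip x c ^+ 2 + e * M.

Hypothesis cpt : compact_energy.
Hypothesis complete : complete_ip ip.

Lemma energy_le_ge0 M x : energy_le M x -> 0 <= M.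
Proof.
by move=> /(_ 1); rewrite expr1n mulr1; apply: le_trans; exact: (dq_ge0 ipP UP).
Qed.

Lemma energy_leB M x y : energy_le M x -> energy_le M y ->
  energy_le (4 * M) (x - y).
Proof.
move=> xM yM h; have := xM h; have := yM h.
have := dq_ge0 ipP UP h (x + y).
rewrite (dqBB ipP UP) (dqDD ipP UP); lra.
Qed.

(** The ultrafilter replaces repeated extraction of subsequences: every coordinate is bounded, hence
    converges along [F], so finitely many coordinates of [f i - f j] are small on one member of [F],
    and [compact_energy] bounds the norm by them. *)
Lemma ultra_cauchy (F : set_system nat) (f : nat -> V) M (B : R) :
  UltraFilter F -> (forall k, energy_le M (f k)) -> (forall k, nrm (f k) <= B) ->
  forall e : R, 0 < e ->
  exists2 A, F A & forall i j, A i -> A j -> ip (f i - f j) (f i - f j) <= e.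
Proof.
move=> FU fM fB e e0.
have M0 := energy_le_ge0 (fM 0%N).
have B0 : 0 <= B by apply: le_trans (fB 0%N); exact: nrm_ge0.
(* The difference [f i - f j] has energy at most [4 * M], so this choice leaves at most e / 2 for
   the remainder; the 1 prevents a division by zero. *)
have [|s sP] := cpt (e := e / (2 * (4 * M + 1))).
  by rewrite divr_gt0// mulr_gt0//; lra.
have coord y : exists c : R, forall d : R, 0 < d ->
    F [set k | `|ip (f k) y - c| < d].
  have FB : ((fun k => ip (f k) y) @ F) `[- (B * nrm y), B * nrm y]%classic.
    apply: (@filterS _ F _ setT) => [k _ /=|]; last exact: filterT.
    rewrite in_itv/= -ler_norml; apply: le_trans (ip_le_nrm ipP _ _) _.
    by rewrite ler_wpM2r ?nrm_ge0.
  have [c [_ Fc]] := segment_compact (fmap_proper_filter _ _) FB.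
  exists c => d d0; have [//|Fn] := in_ultra_setVsetC [set k | `|ip (f k) y - c| < d] FU.
  have [z [/= + ]] := Fc [set z | ~ `|z - c| < d] (ball c d) Fn (nbhsx_ballx c d d0).
  by rewrite /ball/= distrC.
have [A FA AP] : exists2 A, F A & forall i j, A i -> A j ->
    \sum_(c <- s) ip (f i - f j) c ^+ 2 <= e / 2.
  have : 0 < e / 2 by lra.
  elim: s {sP} (e / 2) => [d d0|y s IH d d0].
    by exists setT; [exact: filterT | move=> i j _ _; rewrite big_nil ltW].
  have [A FA AP] := IH (d / 2) ltac:(lra).
  have [c cP] := coord y.
  (* Two values within [r] of [c] differ by at most [2 * r], and (2 r)^2 <= 4 r <= d / 2 because r
     is at most 1 and at most d / 8. *)
  pose r := Num.min 1 (d / 8).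
  have r0 : 0 < r by rewrite lt_min; apply/andP; split; lra.
  exists (A `&` [set k | `|ip (f k) y - c| < r]).
    by apply: filterI => //; exact: cP.
  move=> i j [Ai /= ri] [Aj /= rj]; rewrite big_cons (splitr d) lerD ?AP//.
  have h : `|ip (f i - f j) y| <= 2 * r.
    rewrite !E (_ : _ - _ = ip (f i) y - c - (ip (f j) y - c)); last by ring.
    by apply: le_trans (ler_normB _ _) _; lra.
  rewrite -real_normK ?num_real//.
  have := normr_ge0 (ip (f i - f j) y); move: h.
  have := ge_min (d / 8) 1 (d / 8); rewrite lexx orbT -/r.
  have := ge_min 1 1 (d / 8); rewrite lexx -/r /= expr2.
  move: `| _ | => q r1 rd qr q0.
  have : q * q <= 2 * r * (2 * 1) by apply: ler_pM => //; lra.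
  lra.
exists A => // i j Ai Aj.
apply: le_trans (sP _ _ (energy_leB (fM i) (fM j))) _.
rewrite [leRHS]splitr lerD ?AP//.
rewrite (_ : e / 2 = e / (2 * (4 * M + 1)) * (4 * M + 1)); last by field; lra.
by rewrite ler_wpM2l//; last lra; rewrite divr_ge0//; lra.
Qed.

(** Finitely many members of an ultrafilter meet, so [phi n] can be taken in [A 0], ..., [A n] at
    once and beyond [n]. Consecutive terms then both have their index in [A n] and are 2^-n close.
    The map [phi] dominates the identity but may fail to increase. *)
Lemma energy_precompact (f : nat -> V) M (B : R) :
  (forall k, energy_le M (f k)) -> (forall k, nrm (f k) <= B) ->
  exists (phi : nat -> nat) l, (forall n, (n <= phi n)%N) /\ ncvg ip (f \o phi) l.
Proof.
move=> fM fB.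
have [F [FU Foo]] := @ultraFilterLemma nat \oo _.
have e0 n : 0 < ((2 ^- n) ^+ 2 : R) by rewrite exprn_gt0// invr_gt0 exprn_gt0.
have /choice[A AP] : forall n : nat, exists A : set nat, F A /\
      forall i j, A i -> A j -> ip (f i - f j) (f i - f j) <= (2 ^- n) ^+ 2.
  by move=> n; have [A FA AP] := @ultra_cauchy F f M B FU fM fB _ (e0 n); exists A.
pose C n := [set k | forall i, (i <= n)%N -> A i k] `&` [set k | (n <= k)%N].
have /choice[phi phiP] : forall n, exists k, C n k.
  move=> n; apply: (@filter_ex _ F); apply: filterI; last by apply: Foo; exists n.
  elim: n => [|n IH].
    by apply: filterS (AP 0%N).1 => k Ak i; rewrite leqn0 => /eqP ->.
  apply: filterS (filterI IH (AP n.+1).1) => k [Ak Ank] i.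
  by rewrite leq_eqVlt => /orP[/eqP -> //|]; rewrite ltnS; exact: Ak.
exists phi.
have Aphi n k : (k <= n)%N -> A k (phi n) by move=> kn; apply: (phiP n).1.
have [|l fl] := complete (u := f \o phi).
  move=> n; apply: (nrm_le ipP); first by rewrite invr_ge0 exprn_ge0.
  by apply: (AP n).2; exact: Aphi.
by exists l; split => // n; exact: (phiP n).2.
Qed.

Section Minimizer.
(* [P] is a closed invariant subspace, on which the energy is minimised. *)
Context (P : V -> Prop).
Hypothesis PD : forall x y, P x -> P y -> P (x + y).
Hypothesis PZ : forall a x, P x -> P (a *: x).
Hypothesis Plim : forall u l, (forall n, P (u n)) -> ncvg ip u l -> P l.
Hypothesis PU : forall t x, P x -> P (U t x).

Definition minimizer f m := [/\ P f, ip f f = 1, energy_le m f &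
  forall g M, P g -> energy_le M g -> m * ip g g <= M].

Lemma energy_leZ a M x : energy_le M x -> energy_le (a ^+ 2 * M) (a *: x).
Proof.
move=> xM h; have -> : dq h (a *: x) (a *: x) = a ^+ 2 * dq h x x.
  by rewrite /dq !E !(UZl UP); ring.
by rewrite -mulrA ler_wpM2l// sqr_ge0.
Qed.

(** The direct method: a normalised minimising sequence has energy at most [m + 1], hence a
    norm-convergent extraction. The norm passes to the limit, and so does the energy bound at each
    fixed h, since [dq h] is continuous in norm. *)
Lemma minimizer_exists x M : P x -> energy_le M x -> ip x x != 0 ->
  exists f m, minimizer f m.
Proof.
move=> Px xM x0.
pose S := [set N | exists f, [/\ P f, ip f f = 1 & energy_le N f]].
have normalize g N : P g -> energy_le N g -> ip g g != 0 -> S (N / ip g g).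
  move=> Pg gN g0; have gp : 0 < ip g g by rewrite lt_def g0 (ip_ge0 ipP).
  have nE : (nrm g)^-1 ^+ 2 = (ip g g)^-1 by rewrite exprVn (nrm2 ipP).
  exists ((nrm g)^-1 *: g); split; first exact: PZ.
    by rewrite !E mulrA -expr2 nE mulVf.
  by rewrite mulrC -nE; exact: energy_leZ.
have Slb : has_inf S.
  split; first by eexists; exact: (normalize _ _ Px xM x0).
  by exists 0 => N [f [_ _ /energy_le_ge0]].
set m := inf S.
have e0 n : 0 < (2^-1 : R) ^+ n by rewrite exprn_gt0// invr_gt0.
have /choice[f fP] : forall n, exists f,
    [/\ P f, ip f f = 1 & energy_le (m + 2^-1 ^+ n) f].
  move=> n; have [N [f [Pf f1 fN]] Nm] := inf_adherent (e0 n) Slb.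
  exists f; split => // h; apply: le_trans (fN h) _.
  by rewrite ler_wpM2r ?sqr_ge0// ltW.
have fM n : energy_le (m + 1) (f n).
  case: (fP n) => _ _ fN h; apply: le_trans (fN h) _.
  by rewrite ler_wpM2r ?sqr_ge0// lerD2l exprn_ile1//; lra.
have [|phi [l [phin fl]]] := energy_precompact (B := 1) fM.
  by move=> n; case: (fP n) => _ f1 _; rewrite /nrm f1 sqrtr1.
exists l, m; split.
- by apply: (Plim _ fl) => n; case: (fP (phi n)).
- by apply: (cvg_const_lim (ncvg_ip2 ipP fl fl)) => n; case: (fP (phi n)).
- move=> h.
  have c1 : (fun n => dq h (f (phi n)) (f (phi n))) @ \oo --> dq h l l.
    have Ul s : ncvg ip (fun n => U s (f (phi n))) (U s l).
      rewrite /ncvg (_ : (fun n => _) = (fun n => nrm (f (phi n) - l)))//.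
      by apply/funext => n; rewrite /nrm; congr Num.sqrt; rewrite !E !(Uiso UP).
    have -> : (fun n => dq h (f (phi n)) (f (phi n))) = (fun n =>
        ip (U h (f (phi n)) - f (phi n)) (U h (f (phi n)) - f (phi n))).
      by apply/funext => n; rewrite -(dqE ipP UP).
    by rewrite -(dqE ipP UP); apply: ncvg_ip2 => //; apply: ncvgB.
  have c2 : (fun n => (m + 2^-1 ^+ n) * h ^+ 2) @ \oo --> m * h ^+ 2.
    apply: cvgM; last exact: cvg_cst.
    rewrite -[X in _ --> X]addr0; apply: cvgD; first exact: cvg_cst.
    by apply: cvg_expr; rewrite ger0_norm//; lra.
  apply: ler_cvg_to c1 c2 _; apply: nearW => n.
  case: (fP (phi n)) => _ _ /(_ h)/le_trans; apply.
  rewrite ler_wpM2r ?sqr_ge0// lerD2l.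
  by rewrite ler_wiXn2l ?phin//; lra.
- move=> g N Pg gN; have [->|g0] := eqVneq (ip g g) 0.
    by rewrite mulr0; exact: energy_le_ge0 gN.
  rewrite -ler_pdivlMr; last by rewrite lt_def g0 (ip_ge0 ipP).
  by apply: ge_inf (normalize _ _ Pg gN g0); case: Slb.
Qed.

Section EulerLagrange.
Context (f : V) (m : R).
Hypothesis fm : minimizer f m.

Lemma minimizer_dyadic_le k : dyadic_energy k f f <= m.
Proof. by case: fm => _ _ + _; exact: energy_le_dyadic. Qed.

(** Otherwise, by monotonicity, every dyadic quotient of [f] would stay below [m - e], which would
    then bound the energy of [f] and contradict minimality. *)
Lemma minimizer_dyadic_cvg (e : R) : 0 < e ->
  exists k, forall l, (k <= l)%N -> m - dyadic_energy l f f <= e.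
Proof.
move=> e0; apply: contrapT => /forallNP h.
have : energy_le (m - e) f.
  apply: (dyadic_energyP ipP UP) => k; rewrite leNgt; apply/negP => hk.
  apply: (h k) => l kl; have := dyadic_energy_homo ipP UP f kl.
  by lra.
case: fm => Pf f1 _ /(_ _ _ Pf)/[apply]; rewrite f1; lra.
Qed.

(* At the steps [2 ^- l] with [k <= l] the parallelogram law bounds the energy of
   [f + g] through that of [f - g], which is at least its value at [k]. *)
Lemma minimizer_energy_add k g : P g -> energy_le m g ->
  (forall l, dyadic_energy l g g = dyadic_energy l f f) -> ip g g = 1 ->
  m * ip f g - dyadic_energy k f g <= 2 * (m - dyadic_energy k f f).
Proof.
move=> Pg gm gE g1; case: (fm) => Pf f1 _ fmin.
have DD l : dyadic_energy l (f + g) (f + g) =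
    2 * dyadic_energy l f f + 2 * dyadic_energy l f g.
  have := gE l; rewrite /dyadic_energy (dqDD ipP UP).
  by set p := 4 ^+ l; nra.
have BB l : dyadic_energy l (f - g) (f - g) =
    2 * dyadic_energy l f f - 2 * dyadic_energy l f g.
  have := gE l; rewrite /dyadic_energy (dqBB ipP UP).
  by set p := 4 ^+ l; nra.
have : energy_le (2 * m + 2 * dyadic_energy k f g
    + 4 * (m - dyadic_energy k f f)) (f + g).
  apply: (dyadic_energyP ipP UP) => l.
  have fl := minimizer_dyadic_le l; have fk := minimizer_dyadic_le k.
  have [kl|/ltnW lk] := leqP k l.
    by have := dyadic_energy_homo ipP UP (f - g) kl; rewrite DD !BB; lra.
  by have := dyadic_energy_homo ipP UP (f + g) lk; rewrite !DD; lra.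
have /fmin h := PD Pf Pg => /h; rewrite !E f1 g1 (SC g f); lra.
Qed.

(** The previous estimate is used for [U t f] and for [- U t f], both of norm 1 and with the dyadic
    energies of [f]. The error bound does not depend on t and tends to 0 by
    [minimizer_dyadic_cvg]. *)
Lemma euler_lagrange k t :
  `|dyadic_energy k f (U t f) - m * ip f (U t f)|
    <= 2 * (m - dyadic_energy k f f).
Proof.
case: (fm) => Pf f1 fE fmin; set g := U t f.
have gE l : dyadic_energy l g g = dyadic_energy l f f.
  by rewrite /dyadic_energy (dqU UP).
have Pg : P g by exact: PU.
have gm : energy_le m g by exact: (energy_leU UP).
have g1 : ip g g = 1 by rewrite (Uiso UP).
have h1 := minimizer_energy_add k Pg gm gE g1.
have dN l : dyadic_energy l (- g) (- g) = dyadic_energy l f f.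
  rewrite -gE /dyadic_energy (dqN ipP UP) (dqC ipP UP _ g) (dqN ipP UP) opprK.
  by [].
have dfN : dyadic_energy k f (- g) = - dyadic_energy k f g.
  by rewrite /dyadic_energy (dqC ipP UP _ f) (dqN ipP UP) (dqC ipP UP _ g) mulrN.
have PN : P (- g) by rewrite -scaleN1r; exact: PZ.
have mN : energy_le m (- g).
  by rewrite -scaleN1r; have := energy_leZ (-1) gm; rewrite sqrrN expr1n mul1r.
have N1 : ip (- g) (- g) = 1 by rewrite !E opprK.
have := minimizer_energy_add k PN mN dN N1; rewrite !E dfN => h2.
by rewrite ler_norml; apply/andP; split; lra.
Qed.

Definition autocorrelation t := ip (U t f) f.
Local Notation u := autocorrelation.

Lemma autocorrelation_continuous : continuous u.
Proof. exact: (Ucont UP). Qed.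

Lemma autocorrelation0 : u 0 = 1.
Proof. by rewrite /u (Uid UP); case: fm. Qed.

Lemma autocorrelationN t : u (- t) = u t.
Proof. by rewrite /u (Uadj ipP UP) opprK SC. Qed.

Lemma autocorrelation_le1 t : `|u t| <= 1.
Proof.
case: fm => _ f1 _ _; apply: le_trans (ip_le_nrm ipP _ _) _.
by rewrite /nrm (Uiso UP) f1 sqrtr1 mulr1.
Qed.

(** Pairing [f] with [U t f] in [dq] produces the values of the autocorrelation at t and at t plus
    or minus the step. *)
Lemma autocorrelation_recurrence (e : R) : 0 < e ->
  exists k, forall l, (k <= l)%N -> forall t,
  `|4 ^+ l * (2 * u t - u (t - 2 ^- l) - u (t + 2 ^- l)) - m * u t| <= e.
Proof.
move=> e0; have [|k hk] := @minimizer_dyadic_cvg (e / 2); first by lra.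
exists k => l /hk hl t; have := euler_lagrange l t.
have uE s : ip (U s f) (U t f) = u (t - s).
  by rewrite SC /autocorrelation addrC (Uadd UP) (Uadj ipP UP (- s)) opprK.
rewrite /dyadic_energy /dq !uE (SC f) -/(u t) opprK => h.
by apply: le_trans h _; move: hl; rewrite /dyadic_energy /dq; lra.
Qed.
End EulerLagrange.
End Minimizer.
End MinimalEnergy.

(** * The equation w'' = - m w *)

Section Oscillation.
Context (R : realType).
Implicit Types (a m e t T : R) (u w : R -> R).

(* Approximate form of [w'' = - m w], along the steps [2 ^- l]. *)
Definition oscillates m w := forall e, 0 < e ->
  exists k, forall l, (k <= l)%N -> forall t,
  `|4 ^+ l * (2 * w t - w (t - 2 ^- l) - w (t + 2 ^- l)) - m * w t| <= e.

(** This is sin'(0) = 1 along the half steps a / 2^(l+1) that occur in the second difference of the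
    cosine. *)
Lemma sin_over_cvg a : (fun l => 2 ^+ l.+1 * sin (a / 2 ^+ l.+1)) @ \oo --> a.
Proof.
have [->|a0] := eqVneq a 0.
  by under eq_fun do rewrite mul0r sin0 mulr0; exact: cvg_cst.
have x0 : (fun l => a / 2 ^+ l.+1) @ \oo --> (0 : R).
  rewrite -(mulr0 a); apply: cvgM; first exact: cvg_cst.
  have h2 : @GRing.exp R 2^-1 @ \oo --> (0 : R).
    by apply: cvg_expr; rewrite ger0_norm//; lra.
  move: h2; rewrite -(cvg_shiftS (@GRing.exp R 2^-1)).
  by under eq_fun do rewrite exprVn.
have d : (fun h => h^-1 *: (sin (h *: 1 + 0) - sin 0)) @ (0:R)^' --> (1 : R).
  have H : (fun h => h^-1 *: (sin (h *: 1 + 0) - sin 0)) @ (0:R)^' --> 'D_1 sin (0 : R).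
    exact: derivable_sin.
  by move: H; rewrite (@derive_val _ _ _ _ _ _ _ (is_derive_sin _)) cos0.
have e : (fun l => (a / 2 ^+ l.+1)^-1 * sin (a / 2 ^+ l.+1)) @ \oo --> (1 : R).
  apply/cvgrPdist_lt => e e0.
  move/cvgrPdist_lt : d => /(_ _ e0)[r /= r0 hr].
  move/cvgrPdist_lt : x0 => /(_ _ r0)[N _ hN]; exists N => // l /hN /= /hr.
  rewrite /GRing.scale /= mulr1 addr0 sin0 subr0; apply.
  by rewrite mulf_neq0 ?invr_neq0 ?expf_neq0.
rewrite (_ : (fun l => _) = fun l =>
    a * ((a / 2 ^+ l.+1)^-1 * sin (a / 2 ^+ l.+1))).
  by rewrite -[X in _ --> X]mulr1; apply: cvgM => //; exact: cvg_cst.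
by apply/funext => l; field; rewrite a0 expf_neq0.
Qed.

(** From 2 cos y - cos (y - 2 x) - cos (y + 2 x) = 4 sin(x)^2 cos y with y = a t and 2 x = a /
    2^l. *)
Lemma cos_oscillates a : oscillates (a ^+ 2) (fun t => cos (a * t)).
Proof.
have c : (fun l => (2 ^+ l.+1 * sin (a / 2 ^+ l.+1)) ^+ 2) @ \oo --> a ^+ 2.
  by rewrite expr2; under eq_fun do rewrite expr2; apply: cvgM; exact: sin_over_cvg.
move=> e e0; move/cvgrPdist_le : c => /(_ _ e0)[k _ hk]; exists k => l kl t.
have -> : 4 ^+ l * (2 * cos (a * t) - cos (a * (t - 2 ^- l)) -
   cos (a * (t + 2 ^- l))) = (2 ^+ l.+1 * sin (a / 2 ^+ l.+1)) ^+ 2 * cos (a * t).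
  set x := a / 2 ^+ l.+1.
  have ax : a * 2 ^- l = x *+ 2.
    by rewrite /x exprS; field; rewrite expf_neq0.
  rewrite (mulrBr a) (mulrDr a) ax (cosB (a * t)) (cosD (a * t)) cos_mulr2n cos2sin2 exprMn.
  have -> : (2 ^+ l.+1) ^+ 2 = 4 * 4 ^+ l :> R.
    by rewrite -exprM mulnC exprM expr2 -natrM -exprS.
  ring.
rewrite -mulrBl normrM distrC.
have /= := hk _ kl.
rewrite -{2}[e]mulr1 => h; apply: ler_pM => //; exact: cos_max.
Qed.

Lemma oscillatesB m u w : oscillates m u -> oscillates m w ->
  oscillates m (fun t => u t - w t).
Proof.
move=> hu hw e e0; have e2 : 0 < e / 2 by lra.
have [k hk] := hu _ e2; have [k' hk'] := hw _ e2.
exists (maxn k k') => l; rewrite geq_max => /andP[kl k'l] t.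
have := hk _ kl t; have := hk' _ k'l t; rewrite !ler_norml; lra.
Qed.

(** A discrete contraction. Evenness and [w 0 = 0] provide the initial conditions w(0) = w'(0) = 0;
    summing second differences twice with step h bounds |w| on [0, T] by T^2 (m X + e / 2), where X
    is the supremum of |w| on [-T, T]. As T <= 1 and m T^2 <= 1/2, letting e tend to 0 gives X <= X
    / 2. *)
Lemma oscillates_unique m w : 0 <= m -> continuous w -> w 0 = 0 ->
  (forall t, w (- t) = w t) -> (forall t, `|w t| <= 2) -> oscillates m w ->
  exists2 T, 0 < T & forall t, `|t| <= T -> w t = 0.
Proof.
move=> m0 wc w0 wN wb wo.
pose T := Num.min 1 (1 / (2 * (m + 1))).
have T0 : 0 < T by rewrite lt_min ltr01 divr_gt0//; lra.
have T1 : T <= 1 by rewrite ge_min lexx.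
have Tm : m * T ^+ 2 <= 1 / 2.
  have : T <= 1 / (2 * (m + 1)) by rewrite ge_min lexx orbT.
  rewrite ler_pdivlMr; last lra.
  rewrite expr2; nra.
pose S := [set `|w t| | t in [set t | `|t| <= T]].
have Ssup : has_sup S.
  split; first by exists `|w 0|, 0 => //=; rewrite normr0 ltW.
  by exists 2 => _ [t _ <-].
set X := sup S.
have leX t : `|t| <= T -> `|w t| <= X.
  by move=> tT; apply: ub_le_sup; [case: Ssup | exists t].
have X0 : 0 <= X by apply: le_trans (leX 0 _) => //; rewrite normr0 ltW.
have half t : 0 <= t <= T -> `|w t| <= X / 2.
  move=> /andP[t0 tT]; apply/ler_addgt0Pr => e e0.
  have e2 : 0 < e / 2 by lra.
  have [k hk] := wo _ e2.
  have [j jt jc] := dyadic_floor_cvg t0.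
  have c : (fun l => `|w ((j l)%:R / 2 ^+ l)|) @ \oo --> `|w t|.
    apply: cvg_norm.
    exact: (@cvg_comp _ _ _ (fun l => (j l)%:R / 2 ^+ l) w _ _ _ jc (wc t)).
  rewrite -(cvg_lim _ c)//; apply: limr_le; first by apply/cvg_ex; eexists; exact: c.
  exists k => // l /= kl.
  set h : R := 2 ^- l.
  have h0 : 0 < h by rewrite invr_gt0 exprn_gt0.
  have hh : 4 ^+ l * h ^+ 2 = 1.
    have -> : 4 ^+ l = 2 ^+ l ^+ 2 :> R by rewrite -exprM mulnC exprM expr2 -natrM.
    by rewrite /h -exprMn mulfV ?expr1n ?expf_neq0.
  have rec s : `|w (s + h) - 2 * w s + w (s - h)| <= h ^+ 2 * (m * `|w s| + e / 2).
    have := hk _ kl s; rewrite -/h => H.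
    have -> : w (s + h) - 2 * w s + w (s - h) = - (h ^+ 2 * (4 ^+ l *
        (2 * w s - w (s - h) - w (s + h)) - m * w s) + h ^+ 2 * (m * w s)).
      transitivity (- (4 ^+ l * h ^+ 2 * (2 * w s - w (s - h) - w (s + h)))); last ring.
      by rewrite hh; ring.
    rewrite normrN; apply: le_trans (ler_normD _ _) _.
    rewrite [leRHS]mulrDr [leRHS]addrC lerD//.
      by rewrite normrM (ger0_norm (sqr_ge0 _)) ler_wpM2l ?sqr_ge0.
    by rewrite normrM (normrM m) (ger0_norm m0) (ger0_norm (sqr_ge0 _)).
  set B := m * X + e / 2.
  have B0 : 0 <= B by rewrite addr_ge0 ?mulr_ge0// ltW.
  have step i : i%:R * h <= T ->
      `|w (i%:R * h)| <= i%:R ^+ 2 * h ^+ 2 * B /\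
      `|w (i.+1%:R * h) - w (i%:R * h)| <= i.+1%:R * h ^+ 2 * B.
    have iX (i' : nat) : i'%:R * h <= T -> h ^+ 2 * (m * `|w (i'%:R * h)| + e / 2) <= h ^+ 2 * B.
      move=> iT; rewrite ler_wpM2l ?sqr_ge0// lerD2r ler_wpM2l// leX//.
      by rewrite ger0_norm// mulr_ge0// ltW.
    elim: i => [|i IH] iT.
      rewrite !mul0r w0 normr0 subr0 !mul1r; split => //.
        by rewrite expr0n /= !mul0r.
      (* At 0 evenness turns the second difference into [2 * w h]: the discrete form of w'(0) =
         0. *)
      have := le_trans (rec (0%:R * h)) (iX 0%N iT).
      rewrite mul0r add0r sub0r wN w0 mulr0 subr0 -mulr2n normrMn => H.
      by have := normr_ge0 (w h); lra.
    have iT' : i%:R * h <= T.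
      by apply: le_trans iT; rewrite ler_wpM2r ?(ltW h0)// ler_nat.
    have [IH1 IH2] := IH iT'; split.
      have := ler_normD (w (i.+1%:R * h) - w (i%:R * h)) (w (i%:R * h)).
      rewrite subrK => /le_trans; apply; apply: le_trans (lerD IH2 IH1) _.
      rewrite -!mulrDl ler_wpM2r// ler_wpM2r ?sqr_ge0//.
      by rewrite -natrX -natrD -natrX ler_nat -!mulnn mulSn mulnS leq_add2l leq_addl.
    have E : i.+2%:R * h = i.+1%:R * h + h by rewrite -[i.+2%:R]natr1 mulrDl mul1r.
    have E' : i%:R * h = i.+1%:R * h - h by rewrite -[i.+1%:R]natr1 mulrDl mul1r addrK.
    have := le_trans (rec (i.+1%:R * h)) (iX _ iT); rewrite -E -E' => H.
    have -> : w (i.+2%:R * h) - w (i.+1%:R * h) = (w (i.+2%:R * h) -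
       2 * w (i.+1%:R * h) + w (i%:R * h)) + (w (i.+1%:R * h) - w (i%:R * h)) by ring.
    apply: le_trans (ler_normD _ _) _; apply: le_trans (lerD H IH2) _.
    by rewrite -[i.+2%:R]natr1 [leLHS]addrC !mulrDl mul1r.
  have jT : (j l)%:R * h <= T by apply: le_trans tT; exact: jt.
  have [/le_trans -> //] := step _ jT.
  rewrite -exprMn.
  have : ((j l)%:R * h) ^+ 2 <= T ^+ 2.
    by rewrite ler_sqr ?nnegrE ?(ltW T0)// mulr_ge0// ltW.
  have : T ^+ 2 <= 1 by rewrite expr_le1// ltW.
  move: ((j l)%:R * h) => y T21 yT.
  apply: (@le_trans _ _ (T ^+ 2 * B)); first by rewrite ler_wpM2r.
  rewrite /B mulrDr mulrA (mulrC _ m) lerD//; first by rewrite (mulrC X) ler_wpM2r//; lra.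
  by rewrite -[leRHS]mul1r ; apply: ler_pM => //; rewrite ?sqr_ge0//; lra.
have all_half t : `|t| <= T -> `|w t| <= X / 2.
  have [t0|t0] := leP 0 t; first by rewrite ger0_norm// => tT; apply: half; rewrite t0.
  by rewrite ltr0_norm// -wN => tT; apply: half; rewrite tT oppr_ge0 ltW.
have XX : X <= X / 2.
  by apply: ge_sup; [case: Ssup | move=> _ [t tT <-]; exact: all_half].
exists T => // t tT; apply/eqP; rewrite -normr_eq0 eq_le normr_ge0 andbT.
by apply: le_trans (all_half _ tT) _; lra.
Qed.

End Oscillation.

(** * Eigenvectors of minimal energy *)

(* [J] is the multiplication by the imaginary unit. *)
Record is_cstructure (R : realType) (V : lmodType R) (ip : V -> V -> R)
    (J : V -> V) : Prop := {
  JD : forall x y, J (x + y) = J x + J y;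
  JZ : forall a x, J (a *: x) = a *: J x;
  JJ : forall x, J (J x) = - x;
  Jiso : forall x y, ip (J x) (J y) = ip x y }.

Section Eigenvector.
Context (R : realType) (V : lmodType R) (ip : V -> V -> R).
Hypothesis ipP : is_preip ip.
Context (U : R -> V -> V).
Hypothesis UP : is_ogroup ip U.
Implicit Types (x y z : V) (a b t s h M : R).

Let SC := ipC ipP.
Let E := ipE ipP.
Hypothesis cpt : compact_energy ip U.
Hypothesis complete : complete_ip ip.
Context (P : V -> Prop).
Hypothesis PD : forall x y, P x -> P y -> P (x + y).
Hypothesis PZ : forall a x, P x -> P (a *: x).
Hypothesis Plim : forall u l, (forall n, P (u n)) -> ncvg ip u l -> P l.
Hypothesis PU : forall t x, P x -> P (U t x).

(** Uniqueness identifies the autocorrelation with the cosine near 0 only. There it upgrades to an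
    identity of vectors, and (U t + U (- t))^2 = U (2 t) + 2 + U (- 2 t) doubles the range of t as
    often as desired. *)
Lemma minimizer_cosine f m : minimizer ip U P f m -> forall t z,
  ip (U t f) z + ip (U (- t) f) z = 2 * cos (Num.sqrt m * t) * ip f z.
Proof.
move=> fm; set a := Num.sqrt m; have [Pf f1 fE _] := fm.
have m0 : 0 <= m by exact: energy_le_ge0 fE.
pose u := autocorrelation ip U f.
have uosc : oscillates m u.
  exact: (autocorrelation_recurrence ipP UP PD PZ PU fm).
have cosc : oscillates m (fun t => cos (a * t)).
  by rewrite -(sqr_sqrtr m0); exact: cos_oscillates.
have [|||||T T0 hT] := @oscillates_unique R m (fun t => u t - cos (a * t)) m0.
- move=> t; apply: cvgB; first exact: (autocorrelation_continuous UP).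
  apply: (@continuous_comp _ _ _ (fun t => a * t) cos).
    exact: mulrl_continuous.
  exact: continuous_cos.
- by rewrite /u (autocorrelation0 UP fm) mulr0 cos0 subrr.
- by move=> t; rewrite /u (autocorrelationN ipP UP) mulrN cosN.
- move=> t; apply: le_trans (ler_normB _ _) _.
  by rewrite (_ : 2 = 1 + 1)// lerD ?cos_max// (autocorrelation_le1 ipP UP fm).
- exact: oscillatesB.
pose CI t := forall z,
  ip (U t f) z + ip (U (- t) f) z = 2 * cos (a * t) * ip f z.
have small t : `|2 * t| <= T -> CI t.
  move=> tT; have u2 := hT _ tT.
  have u1 : u t - cos (a * t) = 0.
    by apply: hT; apply: le_trans tT; rewrite normrM ger0_norm// ler_peMl//; lra.
  (* |g|^2 involves only the values of [u] at t and 2 t, which are known cosines; it vanishes by the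
     double angle formula. *)
  move=> z; set g := U t f + U (- t) f - (2 * cos (a * t)) *: f.
  have g0 : ip g g = 0.
    rewrite /g !E !(Uiso UP) (SC (U (- t) f) (U t f)) !(SC f (U _ _)) f1.
    have -> : ip (U t f) (U (- t) f) = u (2 * t).
      rewrite /u /autocorrelation mulr_natl mulr2n (Uadd UP).
      by rewrite (Uadj ipP UP t (U t f)).
    rewrite -/(autocorrelation ip U f t) -/(autocorrelation ip U f (- t)).
    rewrite (autocorrelationN ipP UP) -/u.
    have -> : u t = cos (a * t) by lra.
    have -> : u (2 * t) = cos (a * (2 * t)) by lra.
    rewrite (_ : a * (2 * t) = (a * t) *+ 2); last by rewrite -mulr_natl; ring.
    by rewrite cos_mulr2n; ring.
  have := ip_eq0l ipP z g0; rewrite /g !E; lra.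
have double t : CI t -> CI (2 * t).
  move=> h z.
  have -> : a * (2 * t) = (a * t) *+ 2 by rewrite -mulr_natl; ring.
  have e1 : ip (U (2 * t) f) z = ip (U t f) (U (- t) z).
    by rewrite mulr_natl mulr2n (Uadd UP) (Uadj ipP UP).
  have e2 : ip (U (- (2 * t)) f) z = ip (U (- t) f) (U t z).
    by rewrite mulr_natl mulr2n opprD (Uadd UP) (Uadj ipP UP) opprK.
  have h1 := h (U (- t) z); have h2 := h (U t z); have h3 := h z.
  rewrite (Uiso UP) in h1; rewrite (Uiso UP) in h2.
  have e3 : ip f (U (- t) z) = ip (U t f) z by rewrite (Uadj ipP UP).
  have e4 : ip f (U t z) = ip (U (- t) f) z by rewrite (Uadj ipP UP) opprK.
  rewrite e3 in h1; rewrite e4 in h2.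
  rewrite e1 e2 cos_mulr2n.
  have -> : ip (U t f) (U (- t) z) = 2 * cos (a * t) * ip (U t f) z - ip f z by lra.
  have -> : ip (U (- t) f) (U t z) = 2 * cos (a * t) * ip (U (- t) f) z - ip f z by lra.
  have -> : ip (U (- t) f) z = 2 * cos (a * t) * ip f z - ip (U t f) z by lra.
  ring.
have iter n t : `|2 * t| <= 2 ^+ n * T -> CI t.
  elim: n t => [|n IH] t; first by rewrite mul1r; exact: small.
  move=> h; have -> : t = 2 * (t / 2) by field.
  apply: double; apply: IH.
  have -> : 2 * (t / 2) = t by field.
  by move: h; rewrite normrM exprS ger0_norm// -mulrA ler_pM2l.
(* Any number n of doublings above |2 t| / T is enough, because n <= 2^n. *)
move=> t; apply: (iter (Num.truncn (`|2 * t| / T)).+1).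
have := @truncn_itv R (`|2 * t| / T); rewrite divr_ge0 ?(ltW T0)// => /(_ isT)/andP[_ h].
rewrite -ler_pdivrMr//; apply: le_trans (ltW h) _.
by rewrite -natrX ler_nat ltnW// ltn_expl.
Qed.

Context (J : V -> V).
Hypothesis JP : is_cstructure ip J.
Hypothesis PJ : forall x, P x -> P (J x).
Hypothesis UJ : forall t x z, ip (U t (J x)) z = ip (J (U t x)) z.

Lemma Jadj x y : ip (J x) y = - ip x (J y).
Proof. by rewrite -(Jiso JP x) (JJ JP) E opprK. Qed.

(* [U t F = exp (i b t) F], tested against [z]. *)
Definition eigenvector b F := forall t z,
  ip (U t F) z = cos (b * t) * ip F z + sin (b * t) * ip (J F) z.

(** [U t] rotates the plane of [f] and [g = U s0 f] through the angle a t, so [f - J g] and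
    [f + J g] are eigenvectors for a and - a. They are not both null, since their sum is twice
    [f]. *)
Theorem eigenvector_exists x M : P x -> energy_le ip U M x -> ip x x != 0 ->
  exists F b, [/\ P F, ip F F != 0 & eigenvector b F].
Proof.
move=> Px xM x0.
have [f [m fm]] := minimizer_exists ipP UP cpt complete PZ Plim Px xM x0.
have CI := minimizer_cosine fm; set a := Num.sqrt m in CI.
have [Pf f1 fE _] := fm.
(* With a = 0 there is no quarter period, but then the autocorrelation is constantly 1 and [f]
   itself is fixed by the group. *)
have [a0|a0] := eqVneq a 0.
  exists f, 0; split; rewrite ?f1 ?oner_eq0// => t z.
  rewrite mul0r cos0 sin0 mul1r mul0r addr0.
  have g0 : ip (U t f - f) (U t f - f) = 0.
    have := CI t f; rewrite a0 mul0r cos0 f1 -!/(autocorrelation _ _ _ _).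
    rewrite (autocorrelationN ipP UP) /autocorrelation => h.
    by rewrite !E (Uiso UP) f1 (SC f); lra.
  by have := ip_eq0l ipP z g0; rewrite E; lra.
pose s0 := pi / (2 * a).
have as0 : a * s0 = pi / 2 by rewrite /s0; field.
have dA t s z : ip (U (t + s) f) z + ip (U (t - s) f) z
    = 2 * cos (a * s) * ip (U t f) z.
  by rewrite !(Uadd UP) !(Uadj ipP UP t) CI.
have Uf t z : ip (U t f) z =
    cos (a * t) * ip f z + sin (a * t) * ip (U s0 f) z.
  have h1 := CI t z.
  (* As cos (a s0) = 0, the two relations below differ by U(t) f - U(-t) f = 2 sin (a t) U(s0) f;
     [h1] gives the sum of the same two vectors. *)
  have := dA s0 (s0 - t) z; rewrite mulrBr as0 cosB cos_pihalf sin_pihalf.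
  have := dA (s0 - t) s0 z; rewrite as0 cos_pihalf.
  rewrite (_ : s0 - t - s0 = - t); last by ring.
  rewrite (_ : s0 + (s0 - t) = s0 - t + s0); last by ring.
  rewrite (_ : s0 - (s0 - t) = t); last by ring.
  lra.
set g := U s0 f.
have Ug t z : ip (U t g) z = - sin (a * t) * ip f z + cos (a * t) * ip g z.
  by rewrite /g -(Uadd UP) Uf mulrDr as0 cosDpihalf sinDpihalf.
have UJE t y z : ip (U t (J y)) z = - ip (U t y) (J z).
  by rewrite UJ Jadj.
have [h1|h1] := eqVneq (ip (f - J g) (f - J g)) 0; last first.
  exists (f - J g), a; split => //.
    apply: PD => //; rewrite -scaleN1r; apply: PZ; apply: PJ; exact: PU.
  move=> t z; rewrite (UBl UP) UJE Uf Ug.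
  have -> : J (f - J g) = J f + g.
    by rewrite (JD JP) -scaleN1r (JZ JP) (JJ JP) scaleN1r opprK.
  by rewrite !E !Jadj; ring.
exists (f + J g), (- a); split => //.
- by apply: PD => //; apply: PJ; exact: PU.
- apply/eqP => h2; have := ip_eq0l ipP f h1; have := ip_eq0l ipP f h2.
  by rewrite !E f1; lra.
move=> t z; rewrite (UDl UP) UJE Uf Ug.
have -> : J (f + J g) = J f - g by rewrite (JD JP) (JJ JP).
by rewrite (mulNr a) cosN sinN !E !Jadj; ring.
Qed.

End Eigenvector.

(** * Extension of isometries by density *)

Section Extension.
Context (R : realType) (V : lmodType R) (ip : V -> V -> R).
Hypothesis ipP : is_preip ip.
Hypothesis complete : complete_ip ip.
Implicit Types (x y z w : V) (a s t : R).
Local Notation nrm := (nrm ip).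
Local Notation ncvg := (ncvg ip).
Let SC := ipC ipP.
Let E := ipE ipP.

Context (W : V -> Prop) (T : R -> V -> V).
Hypothesis WD : forall x y, W x -> W y -> W (x + y).
Hypothesis WZ : forall a x, W x -> W (a *: x).
Hypothesis Wdense : forall x (e : R), 0 < e -> exists2 w, W w & nrm (x - w) < e.
Hypothesis TW : forall t w, W w -> W (T t w).
Hypothesis Tlin : forall t a w w', W w -> W w' ->
  T t (a *: w + w') = a *: T t w + T t w'.
Hypothesis Tiso : forall t w w', W w -> W w' -> ip (T t w) (T t w') = ip w w'.
Hypothesis T0 : forall w, W w -> T 0 w = w.
Hypothesis TD : forall s t w, W w -> T (s + t) w = T s (T t w).

(** The closure of the graph of [T t]. It is a relation because the image of [x] is determined only
    up to null vectors. *)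
Definition extends t x y := exists w : nat -> V,
  [/\ forall n, W (w n), ncvg w x & ncvg (fun n => T t (w n)) y].

Lemma nrm_cvg0 (u : nat -> V) (l : V) (c : nat -> R) :
  (forall n, nrm (u n - l) <= c n) -> c @ \oo --> (0 : R) -> ncvg u l.
Proof.
move=> uc c0; apply: (@squeeze_cvgr _ _ _ _ (cst 0) c) => //; last exact: cvg_cst.
by apply: nearW => n; rewrite nrm_ge0 uc.
Qed.

Lemma half_pow_cvg0 : (fun n => 2 ^- n) @ \oo --> (0 : R).
Proof.
have h2 : @GRing.exp R 2^-1 @ \oo --> (0 : R).
  by apply: cvg_expr; rewrite ger0_norm//; lra.
by under eq_fun do rewrite -exprVn; exact: h2.
Qed.

Lemma TB t w w' : W w -> W w' -> T t w - T t w' = T t (w - w').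
Proof.
move=> Ww Ww'; rewrite -[- T t w']scaleN1r addrC -Tlin//.
by rewrite scaleN1r addrC.
Qed.

Lemma WB w w' : W w -> W w' -> W (w - w').
Proof. by move=> Ww Ww'; apply: WD => //; rewrite -scaleN1r; exact: WZ. Qed.

Lemma nrmT t w : W w -> nrm (T t w) = nrm w.
Proof. by move=> Ww; rewrite /nrm Tiso. Qed.

Lemma extends_exists t x : exists y, extends t x y.
Proof.
have e0 n : 0 < (2 ^- n.+1 / 2 : R) by rewrite divr_gt0// invr_gt0 exprn_gt0.
(* The radii 2^-(n+1) / 2 keep |w (n+1) - w n| below 2^-n, the rate [complete_ip] asks for. *)
have /choice[w wP] : forall n, exists w, W w /\ nrm (x - w) < 2 ^- n.+1 / 2.
  by move=> n; have [w Ww wx] := Wdense x (e0 n); exists w.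
have Ww n := (wP n).1; have wx n := (wP n).2.
have [|y wy] := complete (u := fun n => T t (w n)).
  move=> n; rewrite TB// nrmT; last exact: WB.
  apply: le_trans (nrmB_trans ipP x _ _) _; rewrite (nrmC ipP).
  have := wx n; have := wx n.+1; have := e0 n.
  have -> : 2 ^- n.+2 = 2 ^- n.+1 / 2 :> R by rewrite exprS invfM mulrC.
  have -> : 2 ^- n = 2 ^- n.+1 * 2 :> R by rewrite exprS; field; rewrite expf_neq0.
  lra.
exists y, w; split => //; apply: nrm_cvg0 half_pow_cvg0 => n.
have := wx n; have := e0 n; rewrite (nrmC ipP).
have -> : 2 ^- n = 2 ^- n.+1 * 2 :> R by rewrite exprS; field; rewrite expf_neq0.
lra.
Qed.

Lemma extends_ip t x y x' y' : extends t x y -> extends t x' y' ->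
  ip y y' = ip x x'.
Proof.
move=> [w [Ww wx wy]] [w' [Ww' wx' wy']].
have c := ncvg_ip2 ipP wy wy'; have c' := ncvg_ip2 ipP wx wx'.
rewrite (_ : (fun n => _) = fun n => ip (w n) (w' n)) in c.
  exact: (cvg_unique _ c c').
by apply/funext => n; rewrite Tiso.
Qed.

Lemma extends_lin t a x y x' y' : extends t x y -> extends t x' y' ->
  extends t (a *: x + x') (a *: y + y').
Proof.
move=> [w [Ww wx wy]] [w' [Ww' wx' wy']].
exists (fun n => a *: w n + w' n); split.
- by move=> n; apply: WD => //; exact: WZ.
- by apply: (ncvgD ipP) => //; exact: (ncvgZ ipP).
- rewrite (_ : (fun n => _) = fun n => a *: T t (w n) + T t (w' n)).
    by apply: (ncvgD ipP) => //; exact: (ncvgZ ipP).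
  by apply/funext => n; rewrite Tlin.
Qed.

Lemma extends_unique t x y y' : extends t x y -> extends t x y' ->
  ip (y - y') (y - y') = 0.
Proof.
move=> h h'; have := extends_lin (-1) h' h; rewrite !scaleN1r addNr => h0.
by rewrite [y - y']addrC (extends_ip h0 h0) ip0l.
Qed.

Lemma extends_W t w : W w -> extends t w (T t w).
Proof. by move=> Ww; exists (fun=> w); split => //; exact: (ncvg_cst ipP). Qed.

Lemma ncvg_close (u v : nat -> V) l : ncvg u l ->
  (fun n => nrm (v n - u n)) @ \oo --> (0 : R) -> ncvg v l.
Proof.
move=> ul vu; apply: (@nrm_cvg0 _ _ (fun n => nrm (v n - u n) + nrm (u n - l))).
  by move=> n; exact: (nrmB_trans ipP).
by rewrite -(addr0 0); apply: cvgD.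
Qed.

(** The vector [y] has two approximating sequences, [T t (w n)] and [v n]. Their difference tends to
    0 and [T s] is isometric, so their images have the same limit. *)
Lemma extends_add s t x y z : extends t x y -> extends s y z ->
  extends (s + t) x z.
Proof.
move=> [w [Ww wx wy]] [v [Wv vy vz]].
exists w; split => //; apply: (ncvg_close vz).
rewrite (_ : (fun n => _) = fun n => nrm (T t (w n) - v n - (y - y))).
  exact: (ncvgB ipP).
apply/funext => n; rewrite TD// TB//; last exact: TW.
by rewrite nrmT ?subrr ?subr0//; apply: WB => //; exact: TW.
Qed.

Lemma extends_id x : extends 0 x x.
Proof.
have [y [w [Ww wx wy]]] := extends_exists 0 x; exists w; split => //.
by rewrite (_ : (fun n => _) = w)//; apply/funext => n; rewrite T0.
Qed.

(** The default 0 is never taken, by [extends_exists]. *)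
Definition extension t x := xget 0 (extends t x).

Lemma extensionP t x : extends t x (extension t x).
Proof. by apply: xgetPex; exact: extends_exists. Qed.

Lemma extends_ncvg t x y w0 : W w0 -> extends t x y ->
  nrm (y - T t w0) = nrm (x - w0).
Proof.
move=> Ww0 h; have := extends_lin (-1) (@extends_W t w0 Ww0) h.
by rewrite !scaleN1r ![- _ + _]addrC => h'; rewrite /nrm (extends_ip h' h').
Qed.

Hypothesis Tcont : forall w t0, W w -> nrm (T t w - T t0 w) @[t --> t0] --> (0 : R).

Lemma extension_continuous x t0 :
  nrm (extension t x - extension t0 x) @[t --> t0] --> (0 : R).
Proof.
apply/cvgrPdist_lt => e e0.
have [w Ww xw] := Wdense x (divr_gt0 e0 (ltr0n _ 4)).
have /cvgrPdist_lt/(_ _ (divr_gt0 e0 (ltr0n _ 2))) := @Tcont w t0 Ww.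
apply: filterS => t; rewrite /= !sub0r !normrN !ger0_norm ?nrm_ge0// => h.
have := extends_ncvg Ww (extensionP t x); have := extends_ncvg Ww (extensionP t0 x).
have := nrmB_trans ipP (T t w) (extension t x) (extension t0 x).
have := nrmB_trans ipP (T t0 w) (T t w) (extension t0 x).
rewrite [nrm (T t0 w - extension _ _)](nrmC ipP); lra.
Qed.

End Extension.

(** * The point spectrum of an orthogonal group *)

Section EigenAlgebra.
Context (R : realType) (V : lmodType R) (ip : V -> V -> R).
Hypothesis ipP : is_preip ip.
Context (U : R -> V -> V).
Hypothesis UP : is_ogroup ip U.
Context (J : V -> V).
Hypothesis jc : is_cstructure ip J.
Hypothesis UJ : forall t x z, ip (U t (J x)) z = ip (J (U t x)) z.
Implicit Types (x y z : V) (a b t : R).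

Let SC := ipC ipP.
Let E := ipE ipP.
Local Notation eigen := (eigenvector ip U J).

Lemma eigen_mul_i b x : eigen b x -> eigen b (J x).
Proof.
move=> h t z; rewrite UJ (Jadj ipP jc) h (Jiso jc) (JJ jc) (Jadj ipP jc x z).
by rewrite (ipNl ipP); ring.
Qed.

Lemma eigenZ a b x : eigen b x -> eigen b (a *: x).
Proof. by move=> h t z; rewrite (UZl UP) h (JZ jc) !E; ring. Qed.

Lemma eigenD b x y : eigen b x -> eigen b y -> eigen b (x + y).
Proof. by move=> hF hG t z; rewrite (UDl UP) hF hG (JD jc) !E; ring. Qed.

Lemma eigen_congr b x y : ip (x - y) (x - y) = 0 -> eigen b x -> eigen b y.
Proof.
move=> h hx t z; have xy := ip_congr ipP _ h.
have Uxy : ip (U t x) z = ip (U t y) z by rewrite !(Uadj ipP UP).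
by rewrite -Uxy hx xy (Jadj ipP jc) xy -(Jadj ipP jc).
Qed.

(** Applying [U t] to both vectors turns their complex inner product by the angle (b - b') t; at t =
    pi / (b - b') this gives [ip x y = - ip x y]. *)
Lemma eigen_orthogonal b b' x y : b != b' -> eigen b x -> eigen b' y ->
  ip x y = 0.
Proof.
move=> bb hx hy.
have h t : ip x y = cos ((b - b') * t) * ip x y - sin ((b - b') * t) * ip x (J y).
  rewrite -{1}(Uiso UP t x y) hx (SC x (U t y)) (SC (J x)) !hy.
  rewrite mulrBl cosB sinB (SC y (J x)) (SC (J y) (J x)) (Jiso jc) (Jadj ipP jc x y).
  by rewrite (SC y x) (SC (J y) x); ring.
have := h (pi / (b - b')).
rewrite mulrCA mulfV ?subr_eq0// mulr1 cospi sinpi; lra.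
Qed.

Lemma eigenE b x t : eigen b x ->
  let y := cos (b * t) *: x + sin (b * t) *: J x in
  ip (U t x - y) (U t x - y) = 0.
Proof.
by move=> h y; rewrite [ip (U t x - y) _](ipBl ipP) h /y (ipDl ipP) !(ipZl ipP); ring.
Qed.

End EigenAlgebra.

Section ComplexSpan.
Context (R : realType) (V : lmodType R) (ip : V -> V -> R).
Hypothesis ipP : is_preip ip.
Context (J : V -> V).
Hypothesis jc : is_cstructure ip J.
Context (e : R -> V) (L : set R).
Implicit Types (x y z : V) (a b t : R) (s : seq (R * (R * R))).

Let SC := ipC ipP.
Let E := ipE ipP.

(* The entry [(l, (a, b))] stands for the complex multiple [(a + i b) e_l]. *)
Definition lincomb s : V := \sum_(p <- s) (p.2.1 *: e p.1 + p.2.2 *: J (e p.1)).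

Definition freqs_in s := forall p, p \in s -> L p.1.

Definition cspan x := exists s, freqs_in s /\ x = lincomb s.

Lemma lincomb_cat s s' : lincomb (s ++ s') = lincomb s + lincomb s'.
Proof. by rewrite /lincomb big_cat. Qed.

Definition scale_coefs a s := [seq (p.1, (a * p.2.1, a * p.2.2)) | p <- s].

Lemma lincomb_scale a s : lincomb (scale_coefs a s) = a *: lincomb s.
Proof.
rewrite /lincomb big_map scaler_sumr; apply: eq_bigr => p _.
by rewrite /= scalerDr !scalerA.
Qed.

Definition mul_i_coefs s := [seq (p.1, (- p.2.2, p.2.1)) | p <- s].

Lemma J0 : J 0 = 0.
Proof. by rewrite -[0 in LHS](scale0r 0) (JZ jc) scale0r. Qed.

Lemma lincomb_mul_i s : lincomb (mul_i_coefs s) = J (lincomb s).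
Proof.
rewrite /lincomb big_map; elim: s => [|p s IH]; first by rewrite !big_nil J0.
rewrite !big_cons IH (JD jc); congr (_ + _).
by rewrite (JD jc) !(JZ jc) (JJ jc) scalerN scaleNr addrC.
Qed.

Lemma freqs_in_cat s s' : freqs_in s -> freqs_in s' -> freqs_in (s ++ s').
Proof. by move=> h h' p; rewrite mem_cat => /orP[/h|/h']. Qed.

Lemma freqs_in_map (f : R * (R * R) -> R * (R * R)) s :
  (forall p, (f p).1 = p.1) -> freqs_in s -> freqs_in [seq f p | p <- s].
Proof. by move=> f1 h _ /mapP[p ps ->]; rewrite f1; exact: h. Qed.

Lemma cspan0 : cspan 0.
Proof. by exists [::]; rewrite /lincomb big_nil. Qed.

Lemma cspanD x y : cspan x -> cspan y -> cspan (x + y).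
Proof.
move=> [s [Ls ->]] [s' [Ls' ->]]; exists (s ++ s').
by rewrite lincomb_cat; split => //; exact: freqs_in_cat.
Qed.

Lemma cspanZ a x : cspan x -> cspan (a *: x).
Proof.
move=> [s [Ls ->]]; exists (scale_coefs a s).
by rewrite lincomb_scale; split => //; exact: freqs_in_map.
Qed.

Lemma cspanJ x : cspan x -> cspan (J x).
Proof.
move=> [s [Ls ->]]; exists (mul_i_coefs s).
by rewrite lincomb_mul_i; split => //; exact: freqs_in_map.
Qed.

Lemma perp_cspan x : perp ip cspan x <->
  forall l, L l -> ip x (e l) = 0 /\ ip x (J (e l)) = 0.
Proof.
split=> [h l Ll|h _ [s [Ls ->]]].
  split; apply: h.
    exists [:: (l, (1, 0))]; split; first by move=> p; rewrite inE => /eqP ->.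
    by rewrite /lincomb big_seq1 /= scale1r scale0r addr0.
  exists [:: (l, (0, 1))]; split; first by move=> p; rewrite inE => /eqP ->.
  by rewrite /lincomb big_seq1 /= scale1r scale0r add0r.
elim: s Ls => [|p s IH] Ls; first by rewrite /lincomb big_nil (ip0r ipP).
rewrite /lincomb big_cons (ipDr ipP) -/(lincomb s) IH ?addr0; last first.
  by move=> q qs; apply: Ls; rewrite inE qs orbT.
have [h1 h2] : ip x (e p.1) = 0 /\ ip x (J (e p.1)) = 0.
  by apply: h; apply: Ls; rewrite mem_head.
by rewrite (ipDr ipP) !(ipZr ipP) h1 h2 !mulr0 addr0.
Qed.

Lemma ip_mul_i_self x : ip x (J x) = 0.
Proof. by have := Jadj ipP jc x x; rewrite SC => h; lra. Qed.

Lemma JB x y : J (x - y) = J x - J y.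
Proof. by rewrite (JD jc) -scaleN1r (JZ jc) scaleN1r. Qed.

Lemma nrm_mul_i x : nrm ip (J x) = nrm ip x.
Proof. by rewrite /nrm (Jiso jc). Qed.

End ComplexSpan.

Section Spectrum.
Context (R : realType) (V : lmodType R) (ip : V -> V -> R).
Hypothesis ipP : is_preip ip.
Hypothesis complete : complete_ip ip.
Context (U : R -> V -> V).
Hypothesis UP : is_ogroup ip U.
Context (J : V -> V).
Hypothesis jc : is_cstructure ip J.
Hypothesis UJ : forall t x z, ip (U t (J x)) z = ip (J (U t x)) z.
Hypothesis cpt : compact_energy ip U.
Hypothesis total : forall x,
  (forall y, (exists M, energy_le ip U M y) -> ip x y = 0) -> ip x x = 0.
Context (e : R -> V) (kappa : R).
Hypothesis kappa_gt0 : 0 < kappa.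
Local Notation eigen := (eigenvector ip U J).
Hypothesis eigen_e : forall l x, eigen (kappa * l) x -> exists c1 c2 : R,
  ip (x - (c1 *: e l + c2 *: J (e l))) (x - (c1 *: e l + c2 *: J (e l))) = 0.
Implicit Types (x y z : V) (a b t : R).

Let SC := ipC ipP.
Let E := ipE ipP.

(** In the application [kappa] is 2 pi. An index counts when [e l] itself is an eigenvector, rather
    than when [kappa * l] is an eigenvalue; for non-null eigenvectors [eigen_e] makes the two
    agree. *)
Definition spectrum : set R := [set l | eigen (kappa * l) (e l)].

Local Notation P := (perp ip (cspan J e spectrum)).

Lemma perp_spectrumU t x : P x -> P (U t x).
Proof.
move=> /(perp_cspan ipP) h; apply/(perp_cspan ipP) => l Ll.
have [h1 h2] := h l Ll; split.
  by rewrite (Uadj ipP UP) SC Ll !(SC _ x) h1 h2 !mulr0 addr0.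
rewrite (Uadj ipP UP) SC (eigen_mul_i ipP jc UJ Ll) (JJ jc) !(SC _ x) h2.
by rewrite (ipNr ipP) h1 oppr0 !mulr0 addr0.
Qed.

Lemma perp_spectrumJ x : P x -> P (J x).
Proof.
move=> /(perp_cspan ipP) h; apply/(perp_cspan ipP) => l Ll.
have [h1 h2] := h l Ll; split; first by rewrite (Jadj ipP jc) h2 oppr0.
by rewrite (Jiso jc).
Qed.

Lemma perp_lim (W : V -> Prop) (u : nat -> V) x :
  (forall n, perp ip W (u n)) -> ncvg ip u x -> perp ip W x.
Proof.
move=> Pu ux w Ww.
exact: (cvg_const_lim (ncvg_ip ipP (y := w) ux) (fun n => Pu n w Ww)).
Qed.

Lemma perpD (W : V -> Prop) x y : perp ip W x -> perp ip W y -> perp ip W (x + y).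
Proof. by move=> hx hy w Ww; rewrite (ipDl ipP) hx// hy// addr0. Qed.

Lemma perpZ (W : V -> Prop) a x : perp ip W x -> perp ip W (a *: x).
Proof. by move=> hx w Ww; rewrite (ipZl ipP) hx// mulr0. Qed.

Lemma perp_finite_energy x M : P x -> energy_le ip U M x -> ip x x = 0.
Proof.
move=> Px xM; apply/eqP; apply: contrapT => /negP x0.
have [F [b [PF F0 Fb]]] := eigenvector_exists ipP UP cpt complete (@perpD _)
  (@perpZ _) (@perp_lim _) perp_spectrumU jc perp_spectrumJ UJ Px xM x0.
pose l := b / kappa.
have lb : kappa * l = b by rewrite /l; field; rewrite gt_eqF.
have [c1 [c2 h]] : exists c1 c2 : R,
    ip (F - (c1 *: e l + c2 *: J (e l))) (F - (c1 *: e l + c2 *: J (e l))) = 0.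
  by apply: eigen_e; rewrite lb.
set G := c1 *: e l + c2 *: J (e l) in h.
have FG y : ip F y = ip G y by exact: ip_congr h.
have Gb : eigen b G by exact: eigen_congr h Fb.
have c0 : c1 ^+ 2 + c2 ^+ 2 != 0.
  rewrite paddr_eq0 ?sqr_ge0// !sqrf_eq0; apply/negP => /andP[/eqP c10 /eqP c20].
  by move: F0; rewrite FG /G c10 c20 !scale0r addr0 (ip0l ipP) eqxx.
(* Division of [G] by the complex number c1 + i c2, which is nonzero as [F] is not null; it
   transfers the eigenvector property from [G] to [e l]. *)
have El : e l = (c1 ^+ 2 + c2 ^+ 2)^-1 *: (c1 *: G + (- c2) *: J G).
  have -> : c1 *: G + - c2 *: J G = (c1 ^+ 2 + c2 ^+ 2) *: e l.
    rewrite /G (JD jc) !(JZ jc) (JJ jc) !scalerDr scalerN scaleNr !scalerA.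
    rewrite scaleNr scalerN opprK scalerA (mulrC c2 c1) [- _ + _]addrC addrACA.
    by rewrite subrr addr0 -scalerDl -!expr2.
  by rewrite scalerA mulVf// scale1r.
have Ll : spectrum l.
  rewrite /spectrum /= lb El; apply: (eigenZ ipP UP jc).
  apply: (eigenD ipP UP jc); first exact: (eigenZ ipP UP jc).
  by apply: (eigenZ ipP UP jc); exact: (eigen_mul_i ipP jc UJ).
have [h1 h2] := (perp_cspan ipP _ _ _ _).1 PF l Ll.
move: F0; rewrite (FG F) /G (ipDl ipP) !(ipZl ipP) (SC (e l)) (SC (J (e l))) h1 h2.
by rewrite !mulr0 addr0 eqxx.
Qed.

Lemma spectrum_total x (d : R) : 0 < d ->
  exists2 w, cspan J e spectrum w & nrm ip (x - w) < d.
Proof.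
move=> d0.
have proj := projection ipP (cspan0 J e spectrum) (@cspanD _ _ J e spectrum)
  (@cspanZ _ _ J e spectrum) complete.
have [p [w [Ww wp Pp]]] := proj x.
set f := x - p in Pp.
have f0 : ip f f = 0.
  apply: total => y [M yM].
  have [q [v [Wv vq Pq]]] := proj y.
  have qP z : P z -> ip z q = 0.
    move=> Pz; rewrite SC; apply: (cvg_const_lim (ncvg_ip ipP (y := z) vq)) => n.
    by rewrite SC; exact: Pz.
  set g := y - q in Pq.
  have yE : y = g + q by rewrite /g subrK.
  (* [P] is invariant, so [g] and its images under [U] are orthogonal to [q]. At each h the forms
     [dq] of [g] and [q] therefore add up to that of [y], and [g] inherits its bound. *)
  have gM : energy_le ip U M g.
    move=> h; apply: le_trans (yM h).
    have -> : dq ip U h y y = dq ip U h (g + q) (g + q) by rewrite -yE.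
    rewrite (dqDD ipP UP) (_ : dq ip U h g q = 0); last first.
      rewrite /dq (qP g Pq) !qP//; first ring; exact: perp_spectrumU.
    by rewrite mulr0 addr0 lerDl (dq_ge0 ipP UP).
  have g0 := perp_finite_energy Pq gM.
  by rewrite yE (ipDr ipP) (qP f Pp) addr0 SC; exact: ip_eq0l.
have [n nw] := ncvg_lt wp d0.
exists (w n) => //; apply: le_lt_trans (nrmB_trans ipP p _ _) _.
by rewrite {1}/nrm f0 sqrtr0 add0r (nrmC ipP).
Qed.

End Spectrum.

(** * The group that rotates the coefficients over an orthogonal family *)

Section SpectralExtension.
Context (R : realType) (V : lmodType R) (ip : V -> V -> R).
Hypothesis ipP : is_preip ip.
Hypothesis complete : complete_ip ip.
Context (J : V -> V).
Hypothesis jc : is_cstructure ip J.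
Context (e : R -> V) (L : set R) (kappa : R) (T : R -> V -> V).
Implicit Types (x y z w : V) (a b t : R) (s : seq (R * (R * R))).
Hypothesis e_orth : forall l l', L l -> L l' -> l != l' ->
  ip (e l) (e l') = 0 /\ ip (e l) (J (e l')) = 0.

Let SC := ipC ipP.
Let E := ipE ipP.
Local Notation W := (cspan J e L).

(* Multiplies the coefficient of [e_l] by [exp (i kappa l t)]. *)
Definition rotate t (p : R * (R * R)) : R * (R * R) :=
  let c := cos (kappa * p.1 * t) in let d := sin (kappa * p.1 * t) in
  (p.1, (c * p.2.1 - d * p.2.2, d * p.2.1 + c * p.2.2)).

Hypothesis T_lincomb : forall t s,
  T t (lincomb J e s) = lincomb J e [seq rotate t p | p <- s].

Lemma T_cspan t w : W w -> W (T t w).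
Proof.
move=> [s [Ls ->]]; exists [seq rotate t p | p <- s].
by split => //; exact: freqs_in_map.
Qed.

Lemma T_lin t a w w' : W w -> W w' -> T t (a *: w + w') = a *: T t w + T t w'.
Proof.
move=> [s [_ ->]] [s' [_ ->]].
rewrite -lincomb_scale -lincomb_cat !T_lincomb map_cat lincomb_cat -lincomb_scale.
congr (lincomb _ _ _ + _); rewrite /scale_coefs -!map_comp; apply: eq_map => -[l [u v]] /=.
by congr (_, (_, _)); rewrite /=; ring.
Qed.

(** Only pairs of equal frequency contribute, and there both coefficients turn by the same angle. *)
Lemma T_iso t w w' : W w -> W w' -> ip (T t w) (T t w') = ip w w'.
Proof.
move=> [s [Ls ->]] [s' [Ls' ->]]; rewrite !T_lincomb /lincomb !big_map.
rewrite !(ip_suml ipP) big_seq [RHS]big_seq; apply: eq_bigr => p ps.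
rewrite !(SC _ (\sum_(i <- s') _)) !(ip_suml ipP) big_seq [RHS]big_seq.
apply: eq_bigr => q qs.
have [pq|pq] := eqVneq p.1 q.1; last first.
  have [h1 h2] := e_orth (Ls _ ps) (Ls' _ qs) pq.
  by rewrite !E !(SC (e q.1)) !(SC (J (e q.1))) (Jiso jc) !(Jadj ipP jc (e p.1)) h1 h2; ring.
rewrite /= pq !E (Jiso jc) (Jadj ipP jc (e q.1)) (ip_mul_i_self ipP jc).
have := cos2Dsin2 (kappa * q.1 * t); set c := cos _; set d := sin _.
set A := ip _ _; move: (p.2) (q.2) => [u v] [u' v'] /= cd.
transitivity ((c ^+ 2 + d ^+ 2) * ((u * u' + v * v') * A)); first ring.
by rewrite cd; ring.
Qed.

Lemma T_id w : W w -> T 0 w = w.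
Proof.
move=> [s [_ ->]]; rewrite T_lincomb -[in RHS](map_id s); congr lincomb.
apply: eq_map => -[l [u v]]; rewrite /rotate /= mulr0 cos0 sin0.
by congr (_, (_, _)); ring.
Qed.

Lemma T_add a b w : W w -> T (a + b) w = T a (T b w).
Proof.
move=> [s [_ ->]]; rewrite !T_lincomb -map_comp; congr lincomb.
apply: eq_map => -[l [u v]]; rewrite /rotate /= mulrDr cosD sinD.
by congr (_, (_, _)); ring.
Qed.

Lemma T_mul_i t w : W w -> T t (J w) = J (T t w).
Proof.
move=> [s [_ ->]]; rewrite -(lincomb_mul_i jc) !T_lincomb -(lincomb_mul_i jc).
congr lincomb; rewrite /mul_i_coefs -!map_comp; apply: eq_map => -[l [u v]] /=.
by congr (_, (_, _)); rewrite /=; ring.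
Qed.

(** |T t w - T t0 w|^2 = 2 |w|^2 - 2 ip (T t w) (T t0 w), and the last pairing is a trigonometric
    polynomial in t. *)
Lemma T_continuous w t0 : W w -> nrm ip (T t w - T t0 w) @[t --> t0] --> (0 : R).
Proof.
move=> Ww.
have cip z : (fun t => ip (T t w) z) @ t0 --> ip (T t0 w) z.
  case: Ww => s [_ ->].
  pose f (p : R * (R * R)) t :=
    (cos (kappa * p.1 * t) * p.2.1 - sin (kappa * p.1 * t) * p.2.2) * ip (e p.1) z +
    (sin (kappa * p.1 * t) * p.2.1 + cos (kappa * p.1 * t) * p.2.2) * ip (J (e p.1)) z.
  have E1 t : ip (T t (lincomb J e s)) z = \sum_(p <- s) f p t.
    rewrite T_lincomb /lincomb big_map (ip_suml ipP); apply: eq_bigr => p _.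
    by rewrite /= !E.
  have cc b : (fun t => cos (b * t)) @ t0 --> cos (b * t0).
    apply: (@continuous_comp _ _ _ (fun t => b * t) cos).
      exact: mulrl_continuous.
    exact: continuous_cos.
  have cs b : (fun t => sin (b * t)) @ t0 --> sin (b * t0).
    apply: (@continuous_comp _ _ _ (fun t => b * t) sin).
      exact: mulrl_continuous.
    exact: continuous_sin.
  have cf p : f p @ t0 --> f p t0.
    apply: cvgD; (apply: cvgM; last exact: cvg_cst).
      by apply: cvgB; (apply: cvgM; last exact: cvg_cst).
    by apply: cvgD; (apply: cvgM; last exact: cvg_cst).
  rewrite E1 (_ : (fun t => _) = fun t => \sum_(p <- s) f p t); last first.
    by apply/funext => t; exact: E1.
  elim: (s) => [|p s' IH].
    rewrite big_nil (_ : (fun t => _) = cst 0); first exact: cvg_cst.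
    by apply/funext => t; rewrite big_nil.
  rewrite big_cons (_ : (fun t => _) = fun t => f p t + \sum_(q <- s') f q t).
    exact: cvgD.
  by apply/funext => t; rewrite big_cons.
have Nc : (fun t => Num.sqrt (2 * ip w w - 2 * ip (T t w) (T t0 w))) @ t0 -->
    Num.sqrt (2 * ip w w - 2 * ip (T t0 w) (T t0 w)).
  apply: (@cvg_comp _ _ _ (fun t => 2 * ip w w - 2 * ip (T t w) (T t0 w)) Num.sqrt);
    last exact: sqrt_continuous.
  by apply: cvgB; [exact: cvg_cst|apply: cvgM; [exact: cvg_cst|exact: cip]].
rewrite T_iso// subrr sqrtr0 in Nc.
rewrite (_ : (fun t => nrm ip _) = fun t => Num.sqrt (2 * ip w w - 2 * ip (T t w) (T t0 w)))//.
apply/funext => t; rewrite /nrm; congr Num.sqrt.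
by rewrite !E !T_iso// (SC (T t0 w)); ring.
Qed.

Hypothesis span_dense : forall x (d : R), 0 < d ->
  exists2 w, W w & nrm ip (x - w) < d.

Local Notation extends := (extends ip W T).
Local Notation U := (extension ip W T).

Let WD := @cspanD _ _ J e L.
Let WZ := @cspanZ _ _ J e L.

Lemma extends_mul_i t x y : extends t x y -> extends t (J x) (J y).
Proof.
have Jlim u l : ncvg ip u l -> ncvg ip (fun n => J (u n)) (J l).
  move=> ul; rewrite /ncvg (_ : (fun n => _) = fun n => nrm ip (u n - l))//.
  apply/funext => n; rewrite -(nrm_mul_i jc (u n - l)) (JB jc); congr nrm.
move=> [w [Ww wx wy]]; exists (fun n => J (w n)); split.
- by move=> n; exact: (cspanJ jc).
- exact: Jlim.
- rewrite (_ : (fun n => _) = fun n => J (T t (w n))); first exact: Jlim.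
  by apply/funext => n; rewrite T_mul_i.
Qed.

Lemma extensionE t x y : extends t x y -> ip (U t x - y) (U t x - y) = 0.
Proof.
exact: (extends_unique ipP WD WZ T_lin T_iso
  (extensionP ipP complete WD WZ span_dense T_lin T_iso t x)).
Qed.

Lemma extends_extension t x : extends t x (U t x).
Proof. exact: (extensionP ipP complete WD WZ span_dense T_lin T_iso t x). Qed.

Lemma extends_weak t x y z : extends t x y -> ip (U t x) z = ip y z.
Proof. by move=> h; apply: (ip_congr ipP); exact: extensionE. Qed.

Lemma extension_mul_i t x z : ip (U t (J x)) z = ip (J (U t x)) z.
Proof. by apply: extends_weak; exact: extends_mul_i (extends_extension t x). Qed.

Lemma extension_ogroup : is_ogroup ip U.
Proof.
split.
- move=> t x y.
  exact: (extends_ip ipP T_iso (extends_extension t x) (extends_extension t y)).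
- move=> t a x y z; rewrite -(ipZl ipP) -(ipDl ipP); apply: extends_weak.
  exact: (extends_lin ipP WD WZ T_lin a (extends_extension t x) (extends_extension t y)).
- move=> x z; apply: extends_weak.
  exact: (extends_id ipP complete WD WZ span_dense T_lin T_iso T_id).
- move=> s t x z; apply: extends_weak.
  exact: (extends_add ipP WD WZ T_cspan T_lin T_iso T_add
    (extends_extension t x) (extends_extension s (U t x))).
- move=> x z t0.
  apply: (weak_continuous ipP).
  exact: (extension_continuous ipP complete WD WZ span_dense T_lin T_iso
    T_continuous x t0).
Qed.

End SpectralExtension.

(** * The space L2 of a set of finite measure *)

Section SquareIntegrable.
Context (R : realType).
Local Notation RT := (measurableTypeR R).
Local Notation mu := (@lebesgue_measure R).
Context (D : set RT).
Hypothesis mD : measurable D.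
Implicit Types (f g : RT -> R).

Definition sqint f := measurable_fun D f /\
  mu.-integrable D (fun x => (f x ^+ 2)%:E).

Lemma eq_sqint f g : f =1 g -> sqint f -> sqint g.
Proof. by move=> /funext ->. Qed.

Definition rint f g : R := \int[mu]_(x in D) (f x * g x).

Lemma rintC f g : rint f g = rint g f.
Proof. by apply: eq_Rintegral => x _; rewrite mulrC. Qed.

Lemma sqint_mul f g : sqint f -> sqint g ->
  mu.-integrable D (fun x => (f x * g x)%:E).
Proof.
move=> [mf f2] [mg g2].
have h := integrableD mD f2 g2.
apply: le_integrable h => //.
  by apply/measurable_EFinP; exact: measurable_funM.
move=> x Dx; rewrite /= lee_fin [leRHS]ger0_norm ?addr_ge0 ?sqr_ge0//.
rewrite ler_norml; have := sqr_ge0 (f x - g x); have := sqr_ge0 (f x + g x).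
by rewrite !expr2 => h1 h2; apply/andP; split; nra.
Qed.

Lemma sqintZ a f : sqint f -> sqint (fun x => a * f x).
Proof.
move=> [mf f2]; split; first exact: measurable_funM.
have := integrableZl mD (a ^+ 2) f2.
by apply: eq_integrable => // x _; rewrite -EFinM exprMn.
Qed.

Lemma sqintD f g : sqint f -> sqint g -> sqint (fun x => f x + g x).
Proof.
move=> sf sg; have [[mf f2] [mg g2]] := (sf, sg).
split; first exact: measurable_funD.
have := integrableD mD (integrableD mD f2 g2) (integrableZl mD 2 (sqint_mul sf sg)).
by apply: eq_integrable => // x _; rewrite -EFinM -!EFinD; congr EFin; ring.
Qed.

Lemma rintDl f g h : sqint f -> sqint g -> sqint h ->
  rint (fun x => f x + g x) h = rint f h + rint g h.
Proof.
move=> sf sg sh; rewrite -RintegralD//; try exact: sqint_mul.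
by apply: eq_Rintegral => x _; rewrite mulrDl.
Qed.

Lemma rintZl a f g : sqint f -> sqint g ->
  rint (fun x => a * f x) g = a * rint f g.
Proof.
move=> sf sg; rewrite -RintegralZl//; try exact: sqint_mul.
by apply: eq_Rintegral => x _; rewrite mulrA.
Qed.

Lemma rint_ge0 f : 0 <= rint f f.
Proof. by apply: Rintegral_ge0 => x _; rewrite -expr2 sqr_ge0. Qed.

Lemma rintE f : sqint f -> (rint f f)%:E = (\int[mu]_(x in D) (f x ^+ 2)%:E)%E.
Proof.
move=> [mf f2]; rewrite /rint /Rintegral fineK.
  by apply: eq_integral => x _; rewrite expr2.
have := integrable_fin_num mD f2.
by congr (is_true (_ \is a fin_num)); apply: eq_integral => x _; rewrite expr2.
Qed.

Lemma sqint_lty f : measurable_fun D f ->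
  (\int[mu]_(x in D) (f x ^+ 2)%:E < +oo)%E -> sqint f.
Proof.
move=> mf h; split => //; apply/integrableP; split.
  by apply/measurable_EFinP; exact: measurable_funX.
apply: le_lt_trans h; apply: ge0_le_integral => //.
- apply: measurableT_comp => //; apply/measurable_EFinP; exact: measurable_funX.
- by apply/measurable_EFinP; exact: measurable_funX.
- by move=> x _ /=; rewrite lee_fin ger0_norm ?sqr_ge0.
Qed.

Lemma normc2 (z : R[i]) : normc z ^+ 2 = complex.Re z ^+ 2 + complex.Im z ^+ 2.
Proof. by case: z => a b; rewrite /= sqr_sqrtr// addr_ge0 ?sqr_ge0. Qed.

Lemma L2P (F : R -> R[i]) : L2 D F <->
  sqint (fun x => complex.Re (F x)) /\ sqint (fun x => complex.Im (F x)).
Proof.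
split.
  move=> [[mr mi] h].
  have bound (f : RT -> R) : measurable_fun D f ->
      (forall x, f x ^+ 2 <= normc (F x) ^+ 2) -> sqint f.
    move=> mf fb; apply: sqint_lty => //; apply: le_lt_trans h.
    apply: ge0_le_integral => //.
    - by move=> x _; rewrite lee_fin sqr_ge0.
    - by apply/measurable_EFinP; exact: measurable_funX.
    - rewrite (_ : (fun x => _) = EFin \o (fun x : RT =>
          complex.Re (F x) ^+ 2 + complex.Im (F x) ^+ 2)); last first.
        by apply/funext => x; rewrite /= normc2.
      by apply/measurable_EFinP; apply: measurable_funD; exact: measurable_funX.
    - by move=> x _; rewrite lee_fin.
  by split; apply: bound => // x; rewrite normc2 ?lerDl ?lerDr sqr_ge0.
move=> [[mr r2] [mi i2]]; split => //.
under eq_integral do rewrite normc2 EFinD.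
rewrite integralD//; apply: lte_add_pinfty.
  exact: integrable_lty r2.
exact: integrable_lty i2.
Qed.

End SquareIntegrable.

(** Measurability and finite measure are bundled with the set so that the type [l2 O] carries its
    module structure without side conditions. *)
Record fmset (R : realType) := Fmset {
  fmset_set :> set R;
  fmset_measurable : measurable (fmset_set : set (measurableTypeR R));
  fmset_finite : (@lebesgue_measure R fmset_set < +oo)%E }.

(* [Rcomplex R] is [R[i]] as a real vector space: [l2 O] is a real [lmodType], whose
   complex structure is [mul_i] below. *)
Section L2Space.
Context (R : realType) (O : fmset R).

Definition l2_pred : {pred R -> Rcomplex R} :=
  fun F => `[< L2 O (F : R -> R[i]) >].

Lemma l2_submod_closed : submod_closed l2_pred.
Proof.
have mO := fmset_measurable O.
split.
  apply/asboolP/(L2P mO); split; split; try exact: measurable_cst.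
    by under eq_fun do rewrite expr0n; exact: integrable0.
  by under eq_fun do rewrite expr0n; exact: integrable0.
move=> a f g /asboolP/(L2P mO)[fr fi] /asboolP/(L2P mO)[gr gi].
apply/asboolP/(L2P mO); split.
  apply: eq_sqint (sqintD mO (sqintZ mO a fr) gr) => x.
  by rewrite !fctE; case: (f x) => u v; case: (g x).
apply: eq_sqint (sqintD mO (sqintZ mO a fi) gi) => x.
by rewrite !fctE; case: (f x) => u v; case: (g x).
Qed.

HB.instance Definition _ :=
  GRing.isSubmodClosed.Build R (R -> Rcomplex R) l2_pred l2_submod_closed.

Record l2 := L2Sub { l2_val : R -> Rcomplex R; _ : l2_val \in l2_pred }.

HB.instance Definition _ := [isSub for l2_val].
HB.instance Definition _ := [Choice of l2 by <:].
HB.instance Definition _ := [SubChoice_isSubLmodule of l2 by <:].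
End L2Space.

(** * Completeness of L2 *)

Section L2Limit.
Context (R : realType).
Local Notation RT := (measurableTypeR R).
Local Notation mu := (@lebesgue_measure R).

Lemma sum_half_pow n : \sum_(0 <= i < n) (2 ^- i : R) = 2 - 2 * 2 ^- n.
Proof.
elim: n => [|n IH]; first by rewrite big_geq// expr0 invr1; ring.
by rewrite big_nat_recr//= IH exprS; field; rewrite expf_neq0.
Qed.

Lemma cvg_of_summable_increments (u : nat -> R) (M : R) :
  (forall n, \sum_(0 <= i < n) `|u i.+1 - u i| <= M) -> cvgn u.
Proof.
move=> h.
have : cvgn (series (telescope u)).
  apply: normed_cvg.
  have -> : [normed series (telescope u)] = series (fun i => `|u i.+1 - u i|) by [].
  apply: nondecreasing_is_cvgn.
    apply/nondecreasing_seqP => n; rewrite !seriesEnat /= big_nat_recr//= lerDl.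
    exact: normr_ge0.
  by exists M => _ [n _ <-]; rewrite seriesEnat; exact: h.
move=> /cvg_ex[l cl]; apply/cvg_ex; exists (u 0 + l).
have E : (fun n => u 0 + series (telescope u) n) = u.
  by apply/funext => n; rewrite -eq_sum_telescope.
by rewrite -[X in X @ _]E; apply: cvgD; [exact: cvg_cst|exact: cl].
Qed.

Context (D : set RT).
Hypothesis mD : measurable D.
Hypothesis Dfin : (mu D < +oo)%E.

(** Riesz-Fischer: on a set of finite measure the increments are summable in L1, so [u] converges
    almost everywhere, and Fatou's lemma carries the distance bounds to the limit. *)
Lemma L2_limit (u : nat -> RT -> R) : (forall n, sqint D (u n)) ->
  (forall k m, (k <= m)%N ->
    (\int[mu]_(x in D) ((u m x - u k x) ^+ 2)%:E <= (4 * 4^-1 ^+ k)%:E)%E) ->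
  exists l, sqint D l /\ forall k,
    (\int[mu]_(x in D) ((l x - u k x) ^+ 2)%:E <= (4 * 4^-1 ^+ k)%:E)%E.
Proof.
move=> su hu.
have mu_ n : measurable_fun D (u n) by exact: (su n).1.
pose g n (x : RT) := (`|u n.+1 x - u n x|)%:E.
have mg n : measurable_fun D (g n).
  apply/measurable_EFinP; apply: measurableT_comp => //; exact: measurable_funB.
have g0 n x : D x -> (0 <= g n x)%E by rewrite lee_fin.
pose K := 4 + fine (mu D).
have muD c : (\int[mu]_(x in D) c%:E = (c * fine (mu D))%:E)%E.
  by rewrite integral_cst// EFinM fineK// ge0_fin_numE.
have ig n : (\int[mu]_(x in D) g n x <= (2 ^- n * K)%:E)%E.
  (* The weighted inequality |y| <= 2^n y^2 + 2^-n trades the L1 norm for the square norm; the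
     latter is at most 4 * 4^-n, hence the constant [K]. *)
  apply: (@le_trans _ _ (\int[mu]_(x in D)
      ((2 ^+ n)%:E * ((u n.+1 x - u n x) ^+ 2)%:E + (2 ^- n)%:E))%E).
    apply: (ge0_le_integral mu mD) => //.
    - exact: g0.
    - apply: emeasurable_funD; last exact: measurable_cst.
      by apply/measurable_EFinP; apply: measurable_funM => //;
        apply: measurable_funX; exact: measurable_funB.
    - move=> x Dx; rewrite -EFinM -EFinD lee_fin.
      set y := `|_|; rewrite -real_normK ?num_real// -/y.
      have p : 0 < 2 ^+ n :> R by rewrite exprn_gt0.
      have := sqr_ge0 (2 ^+ n * y - 1).
      rewrite -(ler_pM2l p) mulrDr mulfV ?gt_eqF// mulrA.
      have := sqr_ge0 (2 ^+ n * y); rewrite !expr2.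
      move: (2 ^+ n) => p'; nra.
  rewrite ge0_integralD//; last 2 first.
  - by move=> x _; rewrite -EFinM lee_fin mulr_ge0 ?sqr_ge0 ?exprn_ge0.
  - by apply/measurable_EFinP; apply: measurable_funM => //;
      apply: measurable_funX; exact: measurable_funB.
  rewrite ge0_integralZl_EFin//; last 2 first.
  - by move=> x _; rewrite lee_fin sqr_ge0.
  - by apply/measurable_EFinP; apply: measurable_funX; exact: measurable_funB.
  rewrite muD.
  apply: (@le_trans _ _ ((2 ^+ n)%:E * (4 * 4^-1 ^+ n)%:E + (2 ^- n * fine (mu D))%:E)%E).
    by rewrite leeD2r// lee_pmul2l ?lte_fin ?exprn_gt0// hu.
  rewrite -EFinM -EFinD lee_fin /K mulrDr lerD2r.
  rewrite exprVn (_ : 4 ^+ n = 2 ^+ n * 2 ^+ n :> R); last first.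
    by rewrite -exprMn; congr (_ ^+ n); ring.
  rewrite le_eqVlt; apply/orP; left; apply/eqP.
  by field; rewrite expf_neq0.
have intS : (\int[mu]_(x in D) (\sum_(n <oo) g n x) < +oo)%E.
  rewrite integral_nneseries//.
  apply: (@le_lt_trans _ _ (2 * K)%:E); last by rewrite ltry.
  apply: lime_le; first by apply: is_cvg_nneseries => n _ _; apply: integral_ge0 => x; exact: g0.
  apply: nearW => n.
  apply: (@le_trans _ _ (\sum_(0 <= i < n) (2 ^- i * K)%:E)%E).
    by apply: lee_sum => i _.
  rewrite sumEFin lee_fin -mulr_suml sum_half_pow ler_wpM2r//.
    by rewrite /K addr_ge0// fine_ge0.
  by rewrite gerBl mulr_ge0// invr_ge0 exprn_ge0.
have mS : measurable_fun D (fun x => \sum_(n <oo) g n x)%E.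
  by apply: ge0_emeasurable_sum => // k x Dx _; exact: g0.
have aeS : {ae mu, forall x, D x -> ((\sum_(n <oo) g n x)%E \is a fin_num)}.
  apply: (@integrable_ae _ _ _ mu D mD).
  apply/integrableP; split => //; apply: le_lt_trans intS.
  apply: ge0_le_integral => //.
  - exact: measurableT_comp.
  - by move=> x Dx; rewrite gee0_abs//; apply: nneseries_ge0 => n _ _; exact: g0.
have aeC : {ae mu, forall x, D x -> cvgn (fun n => u n x)}.
  apply: filterS aeS => x h Dx; have := h Dx => hf.
  apply: (@cvg_of_summable_increments _ (fine (\sum_(n <oo) g n x)%E)) => n.
  rewrite -lee_fin fineK// -sumEFin.
  apply: (@nneseries_lim_ge _ (fun i => g i x) xpredT) => i _ _; exact: g0.
(* The upper limit is measurable on all of [D], and it is the pointwise limit wherever there is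
   one. *)
pose l (x : RT) : R := fine (limn_esup (fun n => (u n x)%:E)).
have ml : measurable_fun D l.
  apply: (@measurableT_comp _ _ _ _ _ _ fine) => //.
  by apply: measurable_fun_limn_esup => n; apply/measurable_EFinP.
have aeL : {ae mu, forall x, D x -> (fun n => u n x) @ \oo --> l x}.
  apply: filterS aeC => x h Dx; have := h Dx => hc.
  rewrite /l is_cvg_limn_esupE; last first.
    by apply/cvg_ex; exists (limn (fun n => u n x))%:E; apply: cvg_EFin => //; exact: nearW.
  rewrite (_ : limn _ = (limn (fun n => u n x))%:E)//.
  by apply/cvg_lim => //; apply: cvg_EFin => //; exact: nearW.
have bound k : (\int[mu]_(x in D) ((l x - u k x) ^+ 2)%:E <= (4 * 4^-1 ^+ k)%:E)%E.
  pose F m (x : RT) := ((u m x - u k x) ^+ 2)%:E.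
  have mF m : measurable_fun D (F m).
    by apply/measurable_EFinP; apply: measurable_funX; exact: measurable_funB.
  have F0 m x : D x -> (0 <= F m x)%E by rewrite lee_fin sqr_ge0.
  apply: (@le_trans _ _ (\int[mu]_(x in D) limn_einf (F^~ x))%E).
    rewrite le_eqVlt; apply/orP; left; apply/eqP.
    apply: ge0_ae_eq_integral => //.
    - by apply/measurable_EFinP; apply: measurable_funX; exact: measurable_funB.
    - rewrite /limn_einf; apply: measurableT_comp => //.
      apply: measurable_fun_limn_esup => m.
      by apply: (measurableT_comp (f := -%E)).
    - by move=> x _; rewrite lee_fin sqr_ge0.
    - move=> x Dx; rewrite limn_einf_lim; apply: lime_ge; first exact: is_cvg_einfs.
      by apply: nearW => n; apply: le_ereal_inf_tmp => _ [m /= nm <-]; exact: F0.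
    - apply: filterS aeL => x h Dx; have := h Dx => hl.
      have c : F^~ x @ \oo --> ((l x - u k x) ^+ 2)%:E.
        have c1 : (fun m => u m x - u k x) @ \oo --> l x - u k x.
          by apply: cvgB => //; exact: cvg_cst.
        by apply: cvg_EFin; [exact: nearW|exact: (cvgM c1 c1)].
      by rewrite is_cvg_limn_einfE; [rewrite (cvg_lim _ c)|apply/cvg_ex; eexists; exact: c].
  apply: le_trans (fatou mu mD mF F0) _.
  rewrite limn_einf_lim; apply: lime_le; first exact: is_cvg_einfs.
  (* The hypothesis compares [u m] with [u k] for m >= k only; the lower limit does not see the
     earlier indices. *)
  apply: nearW => n; apply: (@le_trans _ _ (\int[mu]_(x in D) F (maxn n k) x)%E).
    by apply: ereal_inf_lbound; exists (maxn n k) => //=; rewrite leq_maxl.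
  by apply: hu; rewrite leq_maxr.
exists l; split => //.
have sl : sqint D (fun x => l x - u 0%N x).
  apply: (sqint_lty mD); first exact: (measurable_funB ml (mu_ 0%N)).
  by apply: le_lt_trans (bound 0%N) _; rewrite ltry.
by apply: eq_sqint (sqintD mD sl (su 0%N)) => x; rewrite subrK.
Qed.

End L2Limit.

Section AlmostEverywhere.
Context (R : realType).
Local Notation mu := (@lebesgue_measure R).
Implicit Types P Q S : measurableTypeR R -> Prop.

Lemma ae_imp P Q : (forall x, P x -> Q x) ->
  {ae mu, forall x, P x} -> {ae mu, forall x, Q x}.
Proof. exact: (@filterS _ _ (ae_filter_ringOfSetsType mu)). Qed.

Lemma ae_imp2 P Q S : (forall x, P x -> Q x -> S x) ->
  {ae mu, forall x, P x} -> {ae mu, forall x, Q x} -> {ae mu, forall x, S x}.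
Proof. exact: (@filterS2 _ _ (ae_filter_ringOfSetsType mu)). Qed.

Lemma ae_all P : (forall x, P x) -> {ae mu, forall x, P x}.
Proof.
move=> h; apply: (@ae_imp (fun=> True)) => //.
exact: (@filterT _ _ (ae_filter_ringOfSetsType mu)).
Qed.

End AlmostEverywhere.

Section L2Hilbert.
Context (R : realType) (O : fmset R).
Local Notation RT := (measurableTypeR R).
Local Notation mu := (@lebesgue_measure R).
Local Notation V := (l2 O).
Implicit Types (F G : V) (f g : R -> R[i]).

Let mO := fmset_measurable O.

Definition fn F : R -> R[i] := l2_val F.
Definition re F : RT -> R := fun x => complex.Re (fn F x).
Definition im F : RT -> R := fun x => complex.Im (fn F x).

(** A function outside L2 is sent to the default 0. *)
Definition to_l2 f : V := insubd 0 f.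

Lemma fnP F : L2 O (fn F). Proof. exact: (asboolP _ (valP F)). Qed.

Lemma fn_to_l2 f : L2 O f -> fn (to_l2 f) = f.
Proof. by move=> h; rewrite /fn val_insubd ifT//; apply/asboolP. Qed.

Lemma fnK F : to_l2 (fn F) = F.
Proof. exact: valKd. Qed.

Lemma fnD F G x : fn (F + G) x = fn F x + fn G x. Proof. by []. Qed.
Lemma fnB F G x : fn (F - G) x = fn F x - fn G x. Proof. by []. Qed.
Lemma fn0 x : fn 0 x = 0. Proof. by []. Qed.

Lemma reD F G x : re (F + G) x = re F x + re G x.
Proof. by rewrite /re fnD raddfD. Qed.
Lemma imD F G x : im (F + G) x = im F x + im G x.
Proof. by rewrite /im fnD raddfD. Qed.
Lemma reB F G x : re (F - G) x = re F x - re G x.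
Proof. by rewrite /re fnB raddfB. Qed.
Lemma imB F G x : im (F - G) x = im F x - im G x.
Proof. by rewrite /im fnB raddfB. Qed.

Lemma fnZ a F x : fn (a *: F) x = (a *: (fn F x : Rcomplex R)).
Proof. by []. Qed.
Lemma reZ a F x : re (a *: F) x = a * re F x.
Proof. by rewrite /re fnZ; case: (fn F x). Qed.
Lemma imZ a F x : im (a *: F) x = a * im F x.
Proof. by rewrite /im fnZ; case: (fn F x). Qed.

Lemma sqint_re F : sqint O (re F). Proof. by have /(L2P mO)[] := fnP F. Qed.
Lemma sqint_im F : sqint O (im F). Proof. by have /(L2P mO)[] := fnP F. Qed.

(** The real part of [inner]; its imaginary part is recovered as [rip F (mul_i G)] in [innerE]. *)
Definition rip F G : R := rint O (re F) (re G) + rint O (im F) (im G).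

Lemma rip_preip : is_preip rip.
Proof.
have sr := sqint_re; have si := sqint_im.
split.
- move=> F G H; rewrite /rip.
  have -> : re (F + G) = fun x => re F x + re G x by apply/funext => x; exact: reD.
  have -> : im (F + G) = fun x => im F x + im G x by apply/funext => x; exact: imD.
  by rewrite !(rintDl mO)//; ring.
- move=> a F G; rewrite /rip.
  have -> : re (a *: F) = fun x => a * re F x by apply/funext => x; exact: reZ.
  have -> : im (a *: F) = fun x => a * im F x by apply/funext => x; exact: imZ.
  by rewrite !(rintZl mO)//; ring.
- by move=> F G; rewrite /rip rintC; congr (_ + _); exact: rintC.
- by move=> F; rewrite addr_ge0// rint_ge0.
Qed.

Lemma sub_cauchy (u : nat -> V) : (forall n, nrm rip (u n.+1 - u n) <= 2 ^- n) ->
  forall k m, (k <= m)%N -> nrm rip (u m - u k) <= 2 * 2 ^- k.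
Proof.
move=> h k m /subnK <-.
suff H n : nrm rip (u (n + k)%N - u k) <= 2 * 2 ^- k - 2 * 2 ^- (n + k).
  by apply: le_trans (H _) _; rewrite gerBl mulr_ge0// invr_ge0 exprn_ge0.
elim: n => [|n IH]; first by rewrite add0n !subrr (nrm0 rip_preip).
apply: le_trans (nrmB_trans rip_preip (u (n + k)%N) _ _) _.
have := h (n + k)%N; rewrite -addSn exprS => h'.
have -> : 2 * (2 * 2 ^+ (n + k))^-1 = 2 ^- (n + k) :> R.
  by rewrite invfM mulrA mulfV// mul1r.
by move: h' IH; rewrite addSn; lra.
Qed.

Lemma rint_EFin (f : RT -> R) : sqint O f ->
  (\int[mu]_(x in O) (f x ^+ 2)%:E = (rint O f f)%:E)%E.
Proof. by move=> h; rewrite (rintE mO). Qed.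

Lemma rip_complete : complete_ip rip.
Proof.
move=> u hu; have Hc := sub_cauchy hu.
have pw k : (2 * 2 ^- k) ^+ 2 = 4 * 4^-1 ^+ k :> R.
  rewrite exprMn exprVn; congr (_ * _); first by rewrite expr2; ring.
  by rewrite exprVn -exprM mulnC exprM; congr (_ ^- k); rewrite expr2; ring.
have Hb k m : (k <= m)%N -> rip (u m - u k) (u m - u k) <= 4 * 4^-1 ^+ k.
  move=> /Hc; rewrite -pw -(nrm2 rip_preip) => ?.
  by rewrite ler_sqr ?nnegrE ?nrm_ge0// mulr_ge0// invr_ge0 exprn_ge0.
have [||lr [slr Hlr]] := @L2_limit R O mO (fmset_finite O) (fun n => re (u n)).
- by move=> n; exact: sqint_re.
- move=> k m km; have := Hb _ _ km; rewrite /rip.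
  have -> : re (u m - u k) = fun x => re (u m) x - re (u k) x by apply/funext => x; exact: reB.
  move=> h; rewrite rint_EFin ?lee_fin; last first.
    by apply: eq_sqint (sqint_re (u m - u k)) => x; exact: reB.
  by apply: le_trans h; rewrite lerDl rint_ge0.
have [||li [sli Hli]] := @L2_limit R O mO (fmset_finite O) (fun n => im (u n)).
- by move=> n; exact: sqint_im.
- move=> k m km; have := Hb _ _ km; rewrite /rip.
  have -> : im (u m - u k) = fun x => im (u m) x - im (u k) x by apply/funext => x; exact: imB.
  move=> h; rewrite rint_EFin ?lee_fin; last first.
    by apply: eq_sqint (sqint_im (u m - u k)) => x; exact: imB.
  by apply: le_trans h; rewrite lerDr rint_ge0.
pose l := to_l2 (fun x => Complex (lr x) (li x)).
have lE : fn l = fun x => Complex (lr x) (li x).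
  by rewrite fn_to_l2//; apply/(L2P mO).
exists l.
have Hk k : nrm rip (u k - l) <= 2 ^- k * 4.
  rewrite (nrmC rip_preip); apply: (nrm_le rip_preip).
    by rewrite mulr_ge0// invr_ge0 exprn_ge0.
  have -> : (2 ^- k * 4) ^+ 2 = 4 * ((2 * 2 ^- k) ^+ 2) :> R.
    by rewrite !exprMn; ring.
  rewrite pw /rip.
  have sr := sqint_re (l - u k); have si := sqint_im (l - u k).
  have h1 : rint O (re (l - u k)) (re (l - u k)) <= 4 * 4^-1 ^+ k.
    rewrite -lee_fin -rint_EFin//; apply: le_trans (Hlr k).
    rewrite le_eqVlt; apply/orP; left; apply/eqP; apply: eq_integral => x _.
    by rewrite reB /re lE.
  have h2 : rint O (im (l - u k)) (im (l - u k)) <= 4 * 4^-1 ^+ k.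
    rewrite -lee_fin -rint_EFin//; apply: le_trans (Hli k).
    rewrite le_eqVlt; apply/orP; left; apply/eqP; apply: eq_integral => x _.
    by rewrite imB /im lE.
  have : 0 <= (4^-1 : R) ^+ k by rewrite exprn_ge0.
  lra.
apply: (nrm_cvg0 Hk); rewrite -(mul0r 4); apply: cvgM; last exact: cvg_cst.
exact: half_pow_cvg0.
Qed.

Definition mul_i F : V := to_l2 (fun x => Complex (- im F x) (re F x)).

Lemma fn_mul_i F : fn (mul_i F) = fun x => Complex (- im F x) (re F x).
Proof.
rewrite fn_to_l2//; apply/(L2P mO); split; last exact: sqint_re.
apply: eq_sqint (sqintZ mO (-1) (sqint_im F)) => x; by rewrite /= mulN1r.
Qed.

Lemma re_mul_i F x : re (mul_i F) x = - im F x.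
Proof. by rewrite /re fn_mul_i. Qed.

Lemma im_mul_i F x : im (mul_i F) x = re F x.
Proof. by rewrite /im fn_mul_i. Qed.

Lemma l2_ext F G : re F =1 re G -> im F =1 im G -> F = G.
Proof.
move=> hr hi; apply/val_inj/funext => x; have := hr x; have := hi x.
by rewrite /re /im /fn /=; case: (l2_val F x) => a b; case: (l2_val G x) => c d /= -> ->.
Qed.

Lemma mul_i_cstructure : is_cstructure rip mul_i.
Proof.
have N (F G : V) : rint O (fun x => - im F x) (fun x => - im G x) = rint O (im F) (im G).
  by apply: eq_Rintegral => x _; rewrite mulrNN.
split.
- by move=> F G; apply: l2_ext => x;
    rewrite !(re_mul_i, im_mul_i, reD, imD)// opprD.
- by move=> a F; apply: l2_ext => x;
    rewrite !(re_mul_i, im_mul_i, reZ, imZ)// mulrN.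
- move=> F; apply: l2_ext => x; rewrite !(re_mul_i, im_mul_i) -scaleN1r.
    by rewrite reZ mulN1r.
  by rewrite imZ mulN1r.
- move=> F G; rewrite /rip addrC; congr (_ + _).
    by apply: eq_Rintegral => x _; rewrite !im_mul_i.
  by apply: eq_Rintegral => x _; rewrite !re_mul_i mulrNN.
Qed.

Lemma innerE F G : inner O (fn F) (fn G) = Complex (rip F G) (rip F (mul_i G)).
Proof.
have mr := sqint_re; have mi := sqint_im.
rewrite /inner /cintegral; congr Complex; rewrite /rip /rint -RintegralD//.
- apply: eq_Rintegral => x _; rewrite /re /im.
  by case: (fn F x) => a b; case: (fn G x) => c d /=; ring.
- exact: sqint_mul.
- exact: sqint_mul.
- apply: eq_Rintegral => x _; rewrite re_mul_i im_mul_i /re /im.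
  by case: (fn F x) => a b; case: (fn G x) => c d /=; ring.
- exact: sqint_mul.
- exact: sqint_mul.
Qed.

Lemma L2normE F : L2norm O (fn F) = nrm rip F.
Proof.
rewrite /L2norm /nrm; congr Num.sqrt; rewrite /rip /rint -RintegralD//.
- by apply: eq_Rintegral => x _; rewrite normc2 !expr2.
- exact: (sqint_mul mO (sqint_re F) (sqint_re F)).
- exact: (sqint_mul mO (sqint_im F) (sqint_im F)).
Qed.

Lemma rint_eq0 (f : RT -> R) : sqint O f -> rint O f f = 0 <->
  {ae mu, forall x, fmset_set O x -> f x = 0}.
Proof.
move=> sf; have [mf f2] := sf.
have mf2 : measurable_fun O (fun x => (f x ^+ 2)%:E).
  by apply/measurable_EFinP; exact: measurable_funX.
have := ae_eq_integral_abs mu mO mf2.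
have -> : (\int[mu]_(x in O) `|(f x ^+ 2)%:E| = (rint O f f)%:E)%E.
  rewrite -rint_EFin//; apply: eq_integral => x _.
  by rewrite gee0_abs// lee_fin sqr_ge0.
move=> H; split.
  move=> f0; have /H : (rint O f f)%:E = 0%E by rewrite f0.
  apply: ae_imp => x h Ox; have /eqP := h Ox.
  by rewrite eqe sqrf_eq0 => /eqP.
move=> h; have h0 : {ae mu, forall x, fmset_set O x -> (f x ^+ 2)%:E = 0%E}.
  by apply: ae_imp h => x h Ox; rewrite h// expr0n.
by apply: EFin_inj; exact: (H.2 h0).
Qed.

Lemma rip_eq0 F : rip F F = 0 <-> {ae mu, forall x, fmset_set O x -> fn F x = 0}.
Proof.
have r0 := @rint_ge0 R O (re F); have i0 := @rint_ge0 R O (im F).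
split.
  move=> h.
  have /(rint_eq0 (sqint_re F)) hr : rint O (re F) (re F) = 0 by move: h; rewrite /rip; lra.
  have /(rint_eq0 (sqint_im F)) hi : rint O (im F) (im F) = 0 by move: h; rewrite /rip; lra.
  apply: ae_imp2 hr hi => x hr hi Ox; have := hr Ox; have := hi Ox.
  by rewrite /re /im; case: (fn F x) => a b /= -> ->.
move=> h; rewrite /rip (_ : rint O (re F) (re F) = 0) ?add0r.
  apply/(rint_eq0 (sqint_im F)); apply: ae_imp h => x h Ox.
  by rewrite /im h.
apply/(rint_eq0 (sqint_re F)); apply: ae_imp h => x h Ox.
by rewrite /re h.
Qed.

Lemma ae_eqE F G : ae_eq_on O (fn F) (fn G) <-> rip (F - G) (F - G) = 0.
Proof.
split.
  move=> h; apply/rip_eq0; apply: ae_imp h => x h Ox.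
  by rewrite fnB h ?subrr.
move=> /rip_eq0; apply: ae_imp => x h Ox; have := h Ox.
by rewrite fnB => /eqP; rewrite subr_eq0 => /eqP.
Qed.

End L2Hilbert.

(** * Translation invariance of Lebesgue measure *)

Section Translation.
Context (R : realType).
Local Notation RT := (measurableTypeR R).
Local Notation mu := (@lebesgue_measure R).
Local Open Scope ereal_scope.

Lemma measurable_shift (t : R) : measurable_fun [set: RT] (fun x : RT => (x + t)%R : RT).
Proof. by apply: measurable_funD => //; exact: measurable_cst. Qed.

Lemma lebesgue_measure_shift (t : R) (A : set RT) : measurable A ->
  pushforward mu (fun x : RT => (x + t)%R : RT) A = mu A.
Proof.
pose m := pushforward mu (fun x : RT => (x + t)%R : RT).
move=> mA; apply/esym.
have mt := measurable_shift t.
pose f : {mfun RT >-> RT} := HB.pack (fun x : RT => (x + t)%R : RT)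
  (isMeasurableFun.Build _ _ _ _ _ mt).
apply: (lebesgue_measure_unique (mu := pushforward mu f)) => //= _ [[a b]] _ <-.
rewrite /pushforward.
have -> : (f @^-1` [set` `]a, b]%R] : set RT) = [set` `](a - t)%R, (b - t)%R]].
  by apply/seteqP; split => x /=; rewrite !in_itv/= ltrBlDr lerBrDr.
rewrite !lebesgue_measure_itv/= !lte_fin ltrD2r.
by case: ifP => // _; congr EFin; ring.
Qed.

Lemma integral_shift (t : R) (f : RT -> \bar R) : measurable_fun setT f ->
  (forall x, 0 <= f x) -> \int[mu]_x f (x + t)%R = \int[mu]_x f x.
Proof.
move=> mf f0.
have := ge0_integral_pushforward (measurable_shift t) mu measurableT mf.
rewrite preimage_setT => <-//.
apply: eq_measure_integral; first exact: measurable_shift.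
by move=> h A mA _; exact: lebesgue_measure_shift.
Qed.

(** Substitute y = x + s in the inner integral, then exchange the integrals by Tonelli. *)
Lemma double_integral_shift (f : RT * RT -> \bar R) : measurable_fun setT f ->
  (forall z, 0 <= f z) ->
  \int[mu]_x \int[mu]_y f (x, y) = \int[mu]_s \int[mu]_x f (x, (x + s)%R).
Proof.
move=> mf f0.
have mx (x : RT) : measurable_fun setT (fun y => f (x, y)).
  exact: measurableT_comp.
transitivity (\int[mu]_x \int[mu]_s f (x, (x + s)%R)).
  apply: eq_integral => x _.
  rewrite -(integral_shift x (mx x)) //.
  by apply: eq_integral => s _; rewrite addrC.
apply: (fubini_tonelli (fun z : RT * RT => f (z.1, (z.1 + z.2)%R))) => //.
apply: measurableT_comp => //; apply/measurable_fun_pairP; split => //=.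
  exact: measurable_fst.
by apply: (@measurable_funD _ _ R setT (fun z : RT * RT => z.1 : R)
  (fun z : RT * RT => z.2 : R)); [exact: measurable_fst|exact: measurable_snd].
Qed.
End Translation.

(** * Poincare inequality from shifts *)

Section Variance.
Context (R : realType).
Local Notation RT := (measurableTypeR R).
Local Notation mu := (@lebesgue_measure R).
Context (J : set RT).
Hypothesis mJ : measurable J.
Hypothesis Jfin : (mu J < +oo)%E.

Lemma integral_indicE (f : RT -> R) :
  (\int[mu]_x (\1_J x * f x)%:E = \int[mu]_(x in J) (f x)%:E)%E.
Proof.
rewrite [RHS]integral_mkcond; apply: eq_integral => x _.
rewrite patchE indicE; case: ifPn => h; first by rewrite mul1r.
by rewrite mul0r.
Qed.

Lemma integrable_cst (a : R) : mu.-integrable J (fun=> a%:E).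
Proof.
apply/integrableP; split; first exact: measurable_cst.
rewrite (_ : (fun=> _) = fun=> `|a|%:E)// integral_cst//.
by rewrite lte_mul_pinfty ?lee_fin.
Qed.

Lemma sqint_cst (a : R) : sqint J (fun=> a).
Proof.
split; first exact: measurable_cst.
exact: integrable_cst.
Qed.

Lemma rint_int (f : RT -> R) : rint J f (fun=> 1) = \int[mu]_(x in J) f x.
Proof. by apply: eq_Rintegral => x _; rewrite mulr1. Qed.

Lemma rint_cst (a : R) : rint J (fun=> a) (fun=> 1) = a * fine (mu J).
Proof.
rewrite rint_int /Rintegral integral_cst// fineM// ge0_fin_numE//.
Qed.

Lemma sqint_integrable f : sqint J f -> mu.-integrable J (EFin \o f).
Proof.
move=> sf; have := sqint_mul mJ sf (sqint_cst 1).
by apply: eq_integrable => // x _; rewrite /= mulr1.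
Qed.

Lemma EFin_Rintegral (f : RT -> R) : mu.-integrable J (EFin \o f) ->
  (\int[mu]_(x in J) (f x)%:E = (\int[mu]_(x in J) f x)%:E)%E.
Proof. by move=> h; rewrite fineK//; exact: integrable_fin_num. Qed.

Lemma rint_sqB (g : RT -> R) (a : R) : sqint J g ->
  \int[mu]_(y in J) (g y - a) ^+ 2 =
  rint J g g - 2 * a * rint J g (fun=> 1) + a ^+ 2 * fine (mu J).
Proof.
move=> sg; have sa := sqint_cst (- a).
have sga := sqintD mJ sg sa.
have s1 := sqint_cst 1.
have c1 : rint J (fun=> - a) g = - a * rint J g (fun=> 1).
  rewrite -rintC -(rintZl mJ)// rintC.
  by apply: eq_Rintegral => x _; ring.
transitivity (rint J (fun x => g x + - a) (fun x => g x + - a)).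
  by apply: eq_Rintegral => x _; rewrite expr2.
have Dr h : sqint J h -> rint J h (fun x => g x + - a) =
    rint J h g + rint J h (fun=> - a).
  by move=> sh; rewrite rintC (rintDl mJ)// (rintC _ g h) (rintC _ (fun=> - a) h).
rewrite (rintDl mJ)// !Dr// c1 (rintC _ g (fun=> - a)) c1.
have -> : rint J (fun=> - a) (fun=> - a) = a ^+ 2 * fine (mu J).
  rewrite -rint_cst; apply: eq_Rintegral => x _; ring.
ring.
Qed.

(** The left side is the expanded integral of (g y - g x)^2 over the square of [J]. The shear y = x
    + s groups it by shifts, and for a fixed shift these are the differences that a locally
    translating group controls. *)
Lemma variance_shift (g : RT -> R) : measurable_fun setT g -> sqint J g ->
  ((2 * (fine (mu J) * rint J g g - rint J g (fun=> 1) ^+ 2))%:E =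
  \int[mu]_s \int[mu]_x (\1_J x * \1_J (x + s)%R * (g (x + s)%R - g x) ^+ 2)%:E)%E.
Proof.
move=> mg sg; set m := fine (mu J); set S := rint J g g; set I := rint J g _.
have s1 := sqint_cst 1.
have ig := sqint_integrable sg.
pose f (z : RT * RT) := (\1_J z.1 * \1_J z.2 * (g z.2 - g z.1) ^+ 2)%:E.
have m1 (A : set RT) : measurable A ->
    measurable_fun [set: RT] (\1_A : RT -> R).
  by move=> mA; exact: measurable_indic.
rewrite -(double_integral_shift (f := f)); last 2 first.
- apply/measurable_EFinP; apply: measurable_funM.
    apply: measurable_funM.
      by apply: (measurableT_comp (m1 _ mJ)); exact: measurable_fst.
    by apply: (measurableT_comp (m1 _ mJ)); exact: measurable_snd.
  apply: measurable_funX; apply: measurable_funB.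
    by apply: (measurableT_comp mg); exact: measurable_snd.
  by apply: (measurableT_comp mg); exact: measurable_fst.
- by move=> z; rewrite lee_fin mulr_ge0 ?sqr_ge0// mulr_ge0.
have inner x : (\int[mu]_y f (x, y) =
    (\1_J x * (S - 2 * g x * I + g x ^+ 2 * m))%:E)%E.
  transitivity (\int[mu]_y (\1_J y * (\1_J x * (g y - g x) ^+ 2))%:E)%E.
    by apply: eq_integral => y _; rewrite /f; congr EFin; ring.
  rewrite integral_indicE.
  have sb : sqint J (fun y => g y - g x) by exact: (sqintD mJ sg (sqint_cst (- g x))).
  rewrite EFin_Rintegral; last first.
    have := integrableZl mJ (\1_J x) sb.2.
    by apply: eq_integrable => // y _; rewrite /= EFinM.
  by rewrite RintegralZl ?rint_sqB//; exact: sb.2.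
under eq_integral do rewrite inner.
rewrite integral_indicE EFin_Rintegral; last first.
  have iS := integrable_cst S.
  have := integrableD mJ (integrableD mJ iS
    (integrableZl mJ (- 2 * I) ig)) (integrableZl mJ m sg.2).
  apply: eq_integrable => // y _; rewrite /= -!EFinM -!EFinD; congr EFin; ring.
congr EFin.
have -> : \int[mu]_(x in J) (S - 2 * g x * I + g x ^+ 2 * m) =
  rint J (fun x => S + (- 2 * I) * g x) (fun=> 1) + m * rint J g g.
  rewrite /rint -RintegralZl//; last exact: sqint_mul.
  rewrite -RintegralD//.
  - by apply: eq_Rintegral => x _; ring.
  - by apply: sqint_mul => //; apply: sqintD => //; [exact: sqint_cst|exact: sqintZ].
  - have := integrableZl mJ m (sqint_mul mJ sg sg).
    by apply: eq_integrable => // y _; rewrite /= EFinM.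
have sS := sqint_cst S; have sI := sqintZ mJ (- 2 * I) sg.
rewrite (rintDl mJ)// (rintZl mJ)// rint_cst -/m -/I -/S; ring.
Qed.
End Variance.

Section Poincare.
Context (R : realType).
Local Notation RT := (measurableTypeR R).
Local Notation mu := (@lebesgue_measure R).

Definition shift_energy (J : set RT) (g : RT -> R) (s : R) :=
  (\int[mu]_x (\1_J x * \1_J (x + s)%R * (g (x + s)%R - g x) ^+ 2)%:E)%E.

Lemma measurable_shift_energy (J : set RT) (g : RT -> R) :
  measurable J -> measurable_fun setT g ->
  measurable_fun [set: RT] (shift_energy J g).
Proof.
move=> mJ mg.
have mI : measurable_fun [set: RT] (\1_J : RT -> R) by exact: measurable_indic.
have ma : measurable_fun [set: RT * RT] (fun z => z.1 + z.2 : RT).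
  by apply: (@measurable_funD _ _ R setT (fun z : RT * RT => z.1 : R)
    (fun z : RT * RT => z.2 : R)); [exact: measurable_fst|exact: measurable_snd].
pose f (z : RT * RT) :=
  (\1_J z.1 * \1_J (z.1 + z.2)%R * (g (z.1 + z.2)%R - g z.1) ^+ 2)%:E.
apply: (@measurable_fun_fubini_tonelli_G _ _ RT RT R mu f).
  apply/measurable_EFinP; apply: measurable_funM.
    apply: measurable_funM.
      by apply: (measurableT_comp mI); exact: measurable_fst.
    exact: (measurableT_comp mI ma).
  apply: measurable_funX; apply: measurable_funB; first exact: (measurableT_comp mg ma).
  by apply: (measurableT_comp mg); exact: measurable_fst.
by move=> z; rewrite lee_fin mulr_ge0 ?sqr_ge0// mulr_ge0.
Qed.

(** In [variance_shift], shifts longer than d - c contribute nothing, and those in [c - d, d - c]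
    contribute at most M (d - c)^2 each. *)
Lemma cell_poincare (g : RT -> R) (J : set RT) (c d M : R) :
  measurable J -> c < d ->
  (`]c, d[%classic : set RT) `<=` J -> J `<=` (`[c, d]%classic : set RT) ->
  measurable_fun setT g -> sqint J g ->
  (forall s, (shift_energy J g s <= (M * s ^+ 2)%:E)%E) ->
  rint J g g <= rint J g (fun=> 1) ^+ 2 / (d - c) + M * (d - c) ^+ 2.
Proof.
move=> mJ cd sJ Js mg sg hM.
have e0 s : (0 <= shift_energy J g s)%E.
  by apply: integral_ge0 => x _; rewrite lee_fin mulr_ge0 ?sqr_ge0// mulr_ge0.
have M0 : 0 <= M.
  by have := le_trans (e0 1) (hM 1); rewrite lee_fin expr1n mulr1.
set dl := d - c; have dl0 : 0 < dl by rewrite subr_gt0.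
have muJ : mu J = dl%:E.
  have h1 : (mu J <= mu (`[c, d]%classic : set RT))%E.
    by apply: le_measure; rewrite ?inE//; exact: measurable_itv.
  have h2 : (mu (`]c, d[%classic : set RT) <= mu J)%E.
    by apply: le_measure; rewrite ?inE//; exact: measurable_itv.
  move: h1 h2; rewrite !lebesgue_measure_itv/= lte_fin cd -EFinD => h1 h2.
  by apply/eqP; rewrite eq_le h1 h2.
have Jfin : (mu J < +oo)%E by rewrite muJ ltry.
have := variance_shift mJ Jfin mg sg; rewrite muJ /=.
rewrite -[X in _ = X -> _]/(\int[mu]_s shift_energy J g s)%E => H.
have : ((2 * (dl * rint J g g - rint J g (fun=> 1) ^+ 2))%:E <=
    (2 * dl * (M * dl ^+ 2))%:E)%E.
  rewrite H; apply: (@le_trans _ _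
      (\int[mu]_s (\1_(`[- dl, dl]%classic : set RT) s * (M * dl ^+ 2))%:E)%E).
    apply: (ge0_le_integral mu measurableT) => //.
    - exact: measurable_shift_energy.
    - apply/measurable_EFinP; apply: measurable_funM => //; exact: measurable_indic.
    - move=> s _; rewrite indicE; case: (asboolP (`[- dl, dl]%classic s)) => hs.
        rewrite mem_set// mul1r; apply: le_trans (hM s) _.
        rewrite lee_fin ler_wpM2l// -[s ^+ 2]real_normK ?num_real//.
        rewrite ler_sqr ?nnegrE ?(ltW dl0)// ler_norml.
        by move: hs; rewrite /= in_itv.
      rewrite memNset// mul0r /shift_energy integral0_eq// => x _.
      have [xJ|xJ] := boolP (x \in J); last by rewrite indicE (negbTE xJ) !mul0r.
      have [yJ|yJ] := boolP ((x + s)%R \in J); last first.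
        by rewrite [\1_J (x + s)%R]indicE (negbTE yJ) mulr0 mul0r.
      exfalso; apply: hs; move: xJ yJ; rewrite !inE => /Js + /Js.
      by rewrite /= !in_itv/= /dl => /andP[? ?] /andP[? ?]; apply/andP; split; lra.
  have muI : mu (`[- dl, dl]%classic : set RT) = (dl + dl)%:E.
    rewrite lebesgue_measure_itv/= lte_fin ifT; last by lra.
    by rewrite -EFinD opprK.
  rewrite integral_indicE integral_cst//.
  apply: (@le_trans _ _ ((M * dl ^+ 2)%:E * (dl + dl)%:E)%E).
    by rewrite le_eqVlt -muI eqxx.
  by rewrite -EFinM lee_fin; lra.
rewrite lee_fin => h.
rewrite -(ler_pM2l dl0) mulrDr mulrCA mulfV ?gt_eqF// mulr1.
lra.
Qed.

End Poincare.

(** * Bounded energy is controlled by means over small cells *)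

Section CompactEnergy.
Context (R : realType) (O : fmset R).
Local Notation RT := (measurableTypeR R).
Local Notation mu := (@lebesgue_measure R).
Local Notation V := (l2 O).
Local Notation rip := (@rip R O).
Let ipP := rip_preip O.
Let mO := fmset_measurable O.

Definition translates (t : R) (F G : V) := {ae mu, forall x : RT,
  fmset_set O x -> fmset_set O (x + t) -> fn G x = fn F (x + t)}.

Definition cmp (b : bool) (F : V) : RT -> R := if b then re F else im F.

Lemma sqint_cmp b F : sqint O (cmp b F).
Proof. by case: b; [exact: sqint_re|exact: sqint_im]. Qed.

Lemma cmpB b F G x : cmp b (F - G) x = cmp b F x - cmp b G x.
Proof. by case: b; [exact: reB|exact: imB]. Qed.

Lemma ripE F G : rip F G = \sum_b rint O (cmp b F) (cmp b G).
Proof. by rewrite big_bool. Qed.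

Lemma rint_cmp_le b F : rint O (cmp b F) (cmp b F) <= rip F F.
Proof. by rewrite ripE (bigD1 b)//= lerDl sumr_ge0// => i _; exact: rint_ge0. Qed.

Lemma sqint_subset (D J : set RT) (f : RT -> R) : measurable D -> measurable J ->
  J `<=` D -> sqint D f -> sqint J f.
Proof.
move=> mD mJ JD [mf f2]; split; first exact: measurable_funS mf.
exact: integrableS f2.
Qed.

Lemma eq_in_sqint (J : set RT) (f g : RT -> R) : {in J, f =1 g} ->
  measurable J -> sqint J f -> sqint J g.
Proof.
move=> fg mJ [mf f2]; split; first exact: eq_measurable_fun mf.
by apply: eq_integrable f2 => // x xJ; rewrite fg.
Qed.

(** A representative is arbitrary outside [O], possibly not measurable there; extension by 0 gives a
    function measurable on the whole line. *)
Definition patched b F : RT -> R := cmp b F \_ O.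

Lemma patchedE b F x : fmset_set O x -> patched b F x = cmp b F x.
Proof. by move=> Ox; rewrite /patched patchE mem_set. Qed.

Lemma measurable_patched b F : measurable_fun setT (patched b F).
Proof. by apply/(measurable_restrictT _ mO); exact: (sqint_cmp b F).1. Qed.

Lemma sqint_patched b F (J : set RT) : measurable J -> J `<=` O ->
  sqint J (patched b F).
Proof.
move=> mJ JO; apply: eq_in_sqint (sqint_subset mO mJ JO (sqint_cmp b F)) => //.
by move=> x; rewrite inE => /JO Ox; rewrite patchedE.
Qed.

Lemma rint_patched b F (J : set RT) h : J `<=` O ->
  rint J (patched b F) h = rint J (cmp b F) h.
Proof.
by move=> JO; apply: eq_Rintegral => x; rewrite inE => /JO Ox; rewrite patchedE.
Qed.

(** When x and x + s both lie in [J], the translation property makes the difference of values equal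
    to the component of [G - F] at x. *)
Lemma shift_energy_le b F G (J : set RT) s : measurable J -> J `<=` O ->
  translates s F G ->
  (shift_energy J (patched b F) s <= (rip (G - F) (G - F))%:E)%E.
Proof.
move=> mJ JO FG.
apply: (@le_trans _ _ (rint O (cmp b (G - F)) (cmp b (G - F)))%:E); last first.
  by rewrite lee_fin rint_cmp_le.
rewrite (rintE mO (sqint_cmp b _)) -integral_indicE//.
have mI (A : set RT) : measurable A -> measurable_fun [set: RT] (\1_A : RT -> R).
  by move=> mA; exact: measurable_indic.
have ms := measurable_shift s; have mp := measurable_patched b F.
apply: ae_ge0_le_integral => //.
- by move=> x _; rewrite lee_fin mulr_ge0 ?sqr_ge0// mulr_ge0.
- apply/measurable_EFinP; apply: measurable_funM.
    apply: measurable_funM; first exact: mI.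
    exact: (measurableT_comp (mI _ mJ) ms).
  apply: measurable_funX; apply: measurable_funB => //.
  exact: (measurableT_comp mp ms).
- by move=> x _; rewrite lee_fin mulr_ge0 ?sqr_ge0.
- have mc := sqint_cmp b (G - F).
  rewrite (_ : (fun x => _) = EFin \o ((fun x => cmp b (G - F) x ^+ 2) \_ O)).
    apply/measurable_EFinP; apply/(measurable_restrictT _ mO).
    by apply: measurable_funX; exact: mc.1.
  apply/funext => x; rewrite /= patchE indicE; case: ifPn => _; first by rewrite mul1r.
  by rewrite mul0r.
- apply: ae_imp FG => x hx _; rewrite lee_fin.
  have [xJ|xJ] := boolP (x \in J); last first.
    by rewrite indicE (negbTE xJ) !mul0r mulr_ge0 ?sqr_ge0.
  have [yJ|yJ] := boolP ((x + s)%R \in J); last first.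
    by rewrite [\1_J (x + s)%R]indicE (negbTE yJ) mulr0 mul0r mulr_ge0 ?sqr_ge0.
  have Ox : fmset_set O x by apply: JO; move: xJ; rewrite inE.
  have Oy : fmset_set O (x + s) by apply: JO; move: yJ; rewrite inE.
  rewrite !indicE xJ yJ (mem_set Ox) !mul1r cmpB !patchedE//.
  by rewrite (_ : cmp b G x = cmp b F (x + s))// /cmp; case: (b);
    rewrite /re /im hx.
Qed.

Lemma rint_cover (K : finType) (J : K -> set RT) (f : RT -> R) :
  (forall k, measurable (J k)) -> (forall k, J k `<=` O) ->
  (fmset_set O : set RT) `<=` \bigcup_k J k -> sqint O f ->
  rint O f f <= \sum_k rint (J k) f f.
Proof.
move=> mJ JO OJ sf; rewrite -lee_fin (rintE mO sf).
have sJ k : sqint (J k) f by exact: sqint_subset sf.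
rewrite -sumEFin; under eq_bigr do rewrite (rintE (mJ _) (sJ _)).
pose h := (fun x : RT => f x ^+ 2) \_ O.
have mh : measurable_fun setT h.
  by apply/(measurable_restrictT _ mO); apply: measurable_funX; exact: sf.1.
have hE x : fmset_set O x -> h x = f x ^+ 2.
  by move=> Ox; rewrite /h patchE mem_set.
have h0 x : 0 <= h x by rewrite /h patchE; case: ifP => // _; exact: sqr_ge0.
have E (A : set RT) : A `<=` O ->
    (\int[mu]_(x in A) (f x ^+ 2)%:E = \int[mu]_x (\1_A x * h x)%:E)%E.
  move=> AO; rewrite integral_indicE//.
  by apply: eq_integral => x; rewrite inE => /AO Ox; rewrite hE.
rewrite E//; under eq_bigr do rewrite E//.
rewrite -ge0_integral_sum//.
- apply: ge0_le_integral => //.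
  + by move=> x _; rewrite lee_fin mulr_ge0.
  + by apply/measurable_EFinP; apply: measurable_funM => //; exact: measurable_indic.
  + apply: emeasurable_sum => k; apply/measurable_EFinP.
    by apply: measurable_funM => //; exact: measurable_indic.
  + move=> x _; rewrite sumEFin lee_fin -mulr_suml ler_wpM2r//.
    have [xO|xO] := boolP (x \in (O : set RT)); last first.
      by rewrite indicE (negbTE xO) sumr_ge0.
    move: (xO); rewrite inE => /OJ[k _ Jk].
    by rewrite (bigD1 k)//= !indicE xO (mem_set Jk) lerDl sumr_ge0.
- by move=> k; apply/measurable_EFinP; apply: measurable_funM => //; exact: measurable_indic.
- by move=> k x _; rewrite lee_fin mulr_ge0.
Qed.

Definition chi (J : set RT) : V := to_l2 O (fun x => Complex (\1_J x) 0).

Lemma fn_chi (J : set RT) : measurable J -> fn (chi J) = fun x => Complex (\1_J x) 0.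
Proof.
move=> mJ; rewrite fn_to_l2//; apply/(L2P mO).
have s0 a := sqint_cst mO (fmset_finite O) a; split; last exact: s0.
split.
  by apply: (measurable_funS measurableT) => //; exact: measurable_indic.
have [_ s1] := s0 1; apply: le_integrable s1 => //.
  apply/measurable_EFinP; apply: measurable_funX.
  by apply: (measurable_funS measurableT) => //; exact: measurable_indic.
move=> x _; rewrite /= lee_fin expr1n normr1 indicE.
by case: (_ \in _); rewrite ?expr1n ?expr0n ?normr1 ?normr0.
Qed.

Lemma rip_chi F (J : set RT) : measurable J -> J `<=` O ->
  rip F (chi J) = rint J (re F) (fun=> 1).
Proof.
move=> mJ JO; rewrite /rip (_ : rint O (im F) _ = 0); last first.
  rewrite /rint /Rintegral integral0_eq// => x _.
  by rewrite /im fn_chi// mulr0.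
rewrite addr0 /rint /Rintegral; congr fine.
rewrite [LHS]integral_mkcond [RHS]integral_mkcond; apply: eq_integral => x _.
rewrite !patchE /re fn_chi//= indicE; case: ifPn => [|] Ox.
  by case: ifPn => // _; rewrite mulr0.
case: ifPn => // xJ; exfalso; move: Ox; rewrite notin_setE; apply.
by apply: JO; move: xJ; rewrite inE.
Qed.

Lemma rip_mul_i_chi F (J : set RT) : measurable J -> J `<=` O ->
  rip F (mul_i (chi J)) = rint J (im F) (fun=> 1).
Proof.
move=> mJ JO.
have jc := mul_i_cstructure O.
have -> : rip F (mul_i (chi J)) = rip (- mul_i F) (chi J).
  by rewrite -(Jiso jc (- _)) -scaleN1r (JZ jc) (JJ jc) scaleN1r opprK.
rewrite rip_chi//; apply: eq_Rintegral => x _.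
by rewrite -scaleN1r reZ re_mul_i mulN1r opprK.
Qed.

Context (n : nat) (alpha beta : 'I_n -> R).
Hypothesis lt_alpha_beta : forall i, alpha i < beta i.
Hypothesis defO : (O : set RT) = \bigcup_(i in [set: 'I_n]) `]alpha i, beta i[%classic.

Context (U : R -> V -> V).
Hypothesis UP : is_ogroup rip U.
Hypothesis Uloc : forall t F, translates t F (U t F).

(** Each interval is cut into [N] equal cells, and the coordinates are the integrals of the real and
    imaginary parts over the cells, suitably normalised. What they miss is bounded cell by cell by
    [cell_poincare]. *)
Lemma compact_energy_l2 : compact_energy rip U.
Proof.
move=> e e0.
pose S := \sum_i (beta i - alpha i) ^+ 2.
have S0 : 0 <= S by apply: sumr_ge0 => i _; exact: sqr_ge0.
(* With [N] cells per interval the Poincare errors sum to [M * S / N] for each of the real and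
   imaginary parts; hence the 2. *)
pose N := (Num.truncn (2 * S / e)).+1.
have Ne : 2 * S / N%:R <= e.
  have := @truncn_itv R (2 * S / e); rewrite divr_ge0 ?mulr_ge0 ?(ltW e0)//.
  move=> /(_ isT)/andP[_]; rewrite -/N ltr_pdivrMr// => h.
  by rewrite ler_pdivrMr ?ltr0n// mulrC; apply: ltW; rewrite mulrC in h *; rewrite (mulrC e).
pose dl i := (beta i - alpha i) / N%:R.
have dl0 i : 0 < dl i by rewrite divr_gt0 ?ltr0n// subr_gt0.
pose lo (k : 'I_n * 'I_N) := alpha k.1 + k.2%:R * dl k.1.
pose hi (k : 'I_n * 'I_N) := lo k + dl k.1.
(* Half-open cells leave no gaps; the intersection removes the left endpoint of the first one, which
   need not lie in [O]. *)
pose J (k : 'I_n * 'I_N) : set RT :=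
  `]alpha k.1, beta k.1[%classic `&` `[lo k, hi k[%classic.
have lohi k : lo k < hi k by rewrite ltrDl.
have mJ k : measurable (J k) by apply: measurableI; exact: measurable_itv.
have JO k : J k `<=` O by rewrite defO => x [h _]; exists k.1.
have Nd i : N%:R * dl i = beta i - alpha i by rewrite /dl; field; rewrite pnatr_eq0.
have sJ k : (`]lo k, hi k[%classic : set RT) `<=` J k.
  move=> x /=; rewrite !in_itv/= => /andP[xl xh]; split; rewrite /= in_itv/=.
    apply/andP; split.
      apply: le_lt_trans xl; rewrite /lo lerDl mulr_ge0// ltW//.
    apply: lt_le_trans xh _; rewrite /hi /lo -addrA.
    rewrite -[X in _ + (_ + X)]mul1r -mulrDl -lerBrDl -Nd.
    by rewrite ler_wpM2r ?(ltW (dl0 _))// natr1 ler_nat.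
  by rewrite (ltW xl) xh.
have Js k : J k `<=` (`[lo k, hi k]%classic : set RT).
  by move=> x [_ /=]; rewrite !in_itv/= => /andP[-> /ltW ->].
have OJ : (fmset_set O : set RT) `<=` \bigcup_k J k.
  rewrite defO => x [i _]; rewrite /= in_itv/= => /andP[xa xb].
  have x0 : 0 <= (x - alpha i) / dl i by rewrite divr_ge0 ?(ltW (dl0 _))// subr_ge0 ltW.
  have /andP[j1 j2] := truncn_itv x0.
  have jN : (Num.truncn ((x - alpha i) / dl i) < N)%N.
    rewrite -(ltr_nat R); apply: le_lt_trans j1 _.
    by rewrite ltr_pdivrMr// Nd ltrD2r.
  exists (i, Ordinal jN) => //; split; rewrite /= in_itv/= ?xa ?xb//.
  rewrite /hi /lo /= -addrA -[X in _ + (_ + X)]mul1r -mulrDl natr1.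
  by rewrite -lerBrDl -ltrBlDl -ler_pdivlMr// -ltr_pdivrMr// j1.
(* Normalised so that the squared coordinate is the mean term of [cell_poincare]; pairing with
   [mul_i (chi (J k))] integrates the imaginary part. *)
pose w (b : bool) k : V := (Num.sqrt (hi k - lo k))^-1 *:
  (if b then chi (J k) else mul_i (chi (J k))).
exists [seq w p.1 p.2 | p <- enum {: bool * ('I_n * 'I_N)}] => F M FM.
have M0 := energy_le_ge0 ipP UP FM.
rewrite big_map big_enum /= -(pair_bigA _ (fun b k => rip F (w b k) ^+ 2)) /=.
have cell b k : rint (J k) (cmp b F) (cmp b F) <=
    rip F (w b k) ^+ 2 + M * (dl k.1) ^+ 2.
  have hd : hi k - lo k = dl k.1 by rewrite /hi addrAC subrr add0r.
  have hM s : (shift_energy (J k) (patched b F) s <= (M * s ^+ 2)%:E)%E.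
    apply: le_trans (shift_energy_le b (mJ k) (JO k) (Uloc s F)) _.
    by rewrite lee_fin (dqE ipP UP); exact: FM.
  have := cell_poincare (mJ k) (lohi k) (sJ k) (Js k) (measurable_patched b F)
    (sqint_patched b F (mJ k) (JO k)) hM.
  rewrite !(rint_patched b F _ (JO k)) [rint _ (cmp b F) (patched b F)]rintC.
  rewrite !(rint_patched b F _ (JO k)) hd => /le_trans; apply; rewrite lerD2r.
  rewrite /w hd; set c := if b then _ else _.
  rewrite (ipZr ipP) exprMn exprVn sqr_sqrtr ?(ltW (dl0 _))// mulrC.
  rewrite le_eqVlt; apply/orP; left; apply/eqP; congr (_ * _ ^+ 2).
  by rewrite /c; case: b {hM c}; rewrite ?rip_chi ?rip_mul_i_chi.
rewrite ripE; apply: (@le_trans _ _ (\sum_b \sum_k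
    (rip F (w b k) ^+ 2 + M * (dl k.1) ^+ 2))).
  apply: ler_sum => b _; apply: le_trans (rint_cover mJ JO OJ (sqint_cmp b F)) _.
  by apply: ler_sum => k _; exact: cell.
have -> : \sum_(b : bool) \sum_k (rip F (w b k) ^+ 2 + M * dl k.1 ^+ 2) =
    \sum_(b : bool) (\sum_k rip F (w b k) ^+ 2 + \sum_(k : 'I_n * 'I_N) M * dl k.1 ^+ 2).
  by apply: eq_bigr => b _; rewrite big_split.
rewrite big_split /= lerD2l big_bool /= -mulr_sumr.
have -> : \sum_(k : 'I_n * 'I_N) dl k.1 ^+ 2 = S / N%:R.
  rewrite -(pair_bigA _ (fun i _ => dl i ^+ 2)) /= /S mulr_suml.
  apply: eq_bigr => i _; rewrite sumr_const card_ord -mulr_natl /dl.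
  by field; rewrite pnatr_eq0.
have := ler_wpM2r M0 Ne; set q := S / N%:R; rewrite -mulrA -/q; lra.
Qed.

End CompactEnergy.

(** * Density of finite energy *)

Section IntervalTest.
Context (R : realType).
Local Notation RT := (measurableTypeR R).
Local Notation mu := (@lebesgue_measure R).

(** The primitive of [p] is locally constant on [A], and by Lebesgue differentiation its derivative
    is [p] almost everywhere. *)
Lemma ae_eq0_of_intervals (p : RT -> R) (A : set R) : open A ->
  mu.-integrable setT (EFin \o p) ->
  (forall a b : R, a < b -> `[a, b]%classic `<=` A ->
    \int[mu]_(x in (`]a, b[%classic : set RT)) p x = 0) ->
  {ae mu, forall x : RT, A x -> p x = 0}.
Proof.
move=> oA ip h.
have ipS (B : set RT) : measurable B -> mu.-integrable B (EFin \o p).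
  by move=> mB; apply: integrableS ip.
have lp : locally_integrable [set: R] p.
  by have := integrable_locally measurableT ip; rewrite patch_setT.
have := FTC1Ny (f := p) (fun y => ipS _ (measurable_itv _)) lp.
apply: ae_imp => x [_ <-] Ax.
set F := fun x : R => _.
have [e /= e0 eA] : nbhs x A by exact: open_nbhs_nbhs.
have Fc y z : x - e < y -> y < z -> z < x + e -> F z = F y.
  move=> xy yz zx; apply/eqP; rewrite -subr_eq0; apply/eqP; rewrite /F.
  rewrite Rintegral_itvB//; last 2 first.
  - exact: ipS.
  - by rewrite bnd_simp ltW.
  rewrite -(h y z yz).
    rewrite /Rintegral integral_itv_bndoo//.
    apply/measurable_EFinP.
    by move/measurable_int : (ipS `]y, z[%classic (measurable_itv _)) => /measurable_EFinP.
  move=> u /=; rewrite in_itv/= => /andP[yu uz]; apply: eA.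
  by rewrite /ball/= ltr_norml; apply/andP; split; lra.
have -> : 0 = (cst (F x))^`()%classic x by rewrite derive1_cst.
rewrite !derive1E; apply: near_eq_derive.
exists e => //= y; rewrite /ball/= ltr_norml => /andP[y1 y2].
have [yx|yx|->//] := ltgtP y x; first by apply/esym/Fc => //; lra.
by apply: Fc => //; lra.
Qed.

(** A Lipschitz substitute, of slope at most [k] and vanishing outside ]a, b[, for the indicator of
    that interval, whose own energy is infinite. *)
Definition trapezoid (a b : R) (k : nat) (x : RT) : R :=
  Num.min 1 (k%:R * Num.max 0 (Num.min (x - a) (b - x))).

Lemma trapezoid_ge0 a b k x : 0 <= trapezoid a b k x.
Proof. by rewrite /trapezoid le_min ler01 mulr_ge0// le_max lexx. Qed.

Lemma trapezoid_le1 a b k x : trapezoid a b k x <= 1.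
Proof. by rewrite /trapezoid ge_min lexx. Qed.

Lemma trapezoid_out a b k x : ~ (a < x < b) -> trapezoid a b k x = 0.
Proof.
move=> h; have m0 : Num.min (x - a) (b - x) <= 0.
  rewrite ge_min !subr_le0; have [//|ax] := leP x a.
  by rewrite /= leNgt; apply/negP => xb; apply: h; rewrite ax.
by rewrite /trapezoid max_l// mulr0 min_r.
Qed.

Lemma min_leD (u v u' v' e : R) : u <= u' + e -> v <= v' + e ->
  Num.min u v <= Num.min u' v' + e.
Proof.
move=> uu vv; rewrite -lerBlDr le_min !lerBlDr; apply/andP; split.
  by apply: le_trans uu; rewrite ge_min lexx.
by apply: le_trans vv; rewrite ge_min lexx orbT.
Qed.

Lemma max_leD (u v u' v' e : R) : u <= u' + e -> v <= v' + e ->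
  Num.max u v <= Num.max u' v' + e.
Proof.
move=> uu vv; rewrite ge_max; apply/andP; split.
  by apply: le_trans uu _; rewrite lerD2r le_max lexx.
by apply: le_trans vv _; rewrite lerD2r le_max lexx orbT.
Qed.

Lemma trapezoid_lipschitz a b k x y :
  `|trapezoid a b k x - trapezoid a b k y| <= k%:R * `|x - y|.
Proof.
have H (u v : RT) : trapezoid a b k u <= trapezoid a b k v + k%:R * `|u - v|.
  have D : 0 <= `|u - v| by [].
  have D1 : u - v <= `|u - v| by exact: ler_norm.
  have D2 : v - u <= `|u - v| by rewrite distrC; exact: ler_norm.
  apply: min_leD; first by rewrite lerDl mulr_ge0.
  rewrite -mulrDr ler_wpM2l//; apply: max_leD; first by rewrite add0r.
  by apply: min_leD; lra.
have := H x y; have := H y x; rewrite (distrC y x) => h1 h2.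
by rewrite ler_norml; apply/andP; split; lra.
Qed.

Lemma trapezoid_cvg a b x :
  (fun k => trapezoid a b k x) @ \oo --> (\1_(`]a, b[%classic : set RT) x : R).
Proof.
have [h|h] := asboolP (a < x < b); last first.
  rewrite indicE memNset; last by rewrite /= in_itv.
  rewrite (_ : (fun k => _) = cst 0); first exact: cvg_cst.
  by apply/funext => k; rewrite trapezoid_out.
rewrite indicE mem_set; last by rewrite /= in_itv.
pose m := Num.min (x - a) (b - x).
have m0 : 0 < m by rewrite lt_min !subr_gt0.
have mE : Num.max 0 m = m by rewrite max_r// ltW.
apply/cvgrPdist_le => e e0; exists (Num.truncn (1 / m)).+1 => // k /= hk.
rewrite /trapezoid -/m mE min_l ?subrr ?normr0 ?(ltW e0)//.
rewrite -ler_pdivrMr//.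
have /andP[_ /ltW H] := truncn_itv (divr_ge0 ler01 (ltW m0)).
by apply: le_trans H _; rewrite ler_nat.
Qed.

Lemma measurable_trapezoid a b k : measurable_fun [set: RT] (trapezoid a b k).
Proof.
apply: measurable_minr; first exact: measurable_cst.
apply: measurable_funM; first exact: measurable_cst.
apply: measurable_maxr; first exact: measurable_cst.
by apply: measurable_minr; apply: measurable_funB => //; exact: measurable_cst.
Qed.

Lemma intervals_of_trapezoids (p : RT -> R) a b :
  mu.-integrable setT (EFin \o p) ->
  (forall k, \int[mu]_x (p x * trapezoid a b k x) = 0) ->
  \int[mu]_(x in (`]a, b[%classic : set RT)) p x = 0.
Proof.
move=> ip h.
have mp : measurable_fun [set: RT] p by move/measurable_int : ip => /measurable_EFinP.
have mT k := measurable_trapezoid a b k.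
have mI : measurable_fun [set: RT] (\1_(`]a, b[%classic : set RT) : RT -> R).
  exact: measurable_indic.
have [] := @dominated_convergence _ _ _ mu setT measurableT
  (fun k x => (p x * trapezoid a b k x)%:E)
  (fun x => (p x * \1_(`]a, b[%classic : set RT) x)%:E) (fun x => `|p x|%:E).
- by move=> k; apply/measurable_EFinP; exact: measurable_funM.
- by apply/measurable_EFinP; exact: measurable_funM.
- apply: ae_all => x _; apply: cvg_EFin; first exact: nearW.
  by apply: cvgM; [exact: cvg_cst|exact: trapezoid_cvg].
- exact: (integrable_norm ip).
- apply: ae_all => x k _; rewrite lee_fin normrM ler_piMr//.
  by rewrite ger0_norm ?trapezoid_ge0 ?trapezoid_le1.
move=> _ _ c.
have z k : (\int[mu]_x (p x * trapezoid a b k x)%:E = 0)%E.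
  have : mu.-integrable setT (fun x => (p x * trapezoid a b k x)%:E).
    apply: le_integrable ip => //.
      by apply/measurable_EFinP; exact: measurable_funM.
    move=> x _; rewrite lee_fin normrM ler_piMr//.
    by rewrite ger0_norm ?trapezoid_ge0 ?trapezoid_le1.
  move=> /(integrable_fin_num measurableT)/fineK <-.
  by rewrite -[fine _]/(\int[mu]_x (p x * trapezoid a b k x)) h.
move: c; rewrite (_ : [sequence _]_n = cst 0%E); last by apply/funext => k; exact: z.
move=> /(cvg_unique (@ereal_hausdorff R) (cvg_cst _)) E.
rewrite /Rintegral (_ : (\int[mu]_(x in _) _)%E = 0%E)// E.
rewrite [LHS]integral_mkcond; apply: eq_integral => x _; rewrite patchE indicE.
by case: ifP => _; rewrite ?mulr1 ?mulr0.
Qed.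

End IntervalTest.

Section FiniteEnergy.
Context (R : realType) (O : fmset R).
Local Notation RT := (measurableTypeR R).
Local Notation mu := (@lebesgue_measure R).
Local Notation V := (l2 O).
Local Notation rip := (@rip R O).
Let ipP := rip_preip O.
Let E := ipE ipP.
Let mO := fmset_measurable O.
Let fO := fmset_finite O.

Lemma sqint_bounded (f : RT -> R) (B : R) : measurable_fun O f ->
  (forall x, `|f x| <= B) -> sqint O f.
Proof.
move=> mf fB; split => //; apply: le_integrable (sqint_cst mO fO B).2 => //.
  by apply/measurable_EFinP; exact: measurable_funX.
move=> x _; rewrite lee_fin !ger0_norm ?sqr_ge0// -[leLHS]real_normK ?num_real//.
have := normr_ge0 (f x); have := fB x => h1 h2.
by rewrite ler_sqr ?nnegrE// (le_trans h2).
Qed.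

Definition realf (T : RT -> R) : V := to_l2 O (fun x => Complex (T x) 0).

Lemma fn_realf T : sqint O T -> fn (realf T) = fun x => Complex (T x) 0.
Proof.
by move=> sT; rewrite fn_to_l2//; apply/(L2P mO); split => //; exact: sqint_cst.
Qed.

Lemma rip_realf F T : sqint O T -> rip F (realf T) = rint O (re F) T.
Proof.
move=> sT; rewrite /rip (_ : rint O (im F) _ = 0) ?addr0.
  by apply: eq_Rintegral => x _; rewrite {2}/re fn_realf.
rewrite /rint /Rintegral integral0_eq// => x _.
by rewrite {2}/im fn_realf// mulr0.
Qed.

Lemma rip_realfB S T : sqint O S -> sqint O T ->
  rip (realf S - realf T) (realf S - realf T) =
  rint O (fun x => S x - T x) (fun x => S x - T x).
Proof.
move=> sS sT; set F := _ - _.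
have -> : (fun x => S x - T x) = re F.
  by apply/funext => x; rewrite reB /re (fn_realf sS) (fn_realf sT).
rewrite /rip [X in _ + X](_ : _ = 0) ?addr0//.
rewrite /rint /Rintegral integral0_eq// => x _.
by rewrite imB /im (fn_realf sS) (fn_realf sT) /= subrr mulr0.
Qed.

Lemma rint_ae (f g h : RT -> R) : sqint O f -> sqint O g -> sqint O h ->
  {ae mu, forall x : RT, fmset_set O x -> f x * h x = g x * h x} ->
  rint O f h = rint O g h.
Proof.
move=> [mf _] [mg _] [mh _] fg; rewrite /rint /Rintegral; congr fine.
apply: ae_eq_integral => //.
- by apply/measurable_EFinP; exact: measurable_funM.
- by apply/measurable_EFinP; exact: measurable_funM.
- by apply: ae_imp fg => x hx Ox; rewrite hx.
Qed.

Lemma rint_extend (f : RT -> R) : measurable_fun setT f -> sqint O f ->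
  (forall x, f x != 0 -> fmset_set O x) ->
  (rint O f f)%:E = (\int[mu]_x (f x ^+ 2)%:E)%E.
Proof.
move=> mf sf f0; rewrite (rintE mO sf) integral_mkcond.
apply: eq_integral => x _; rewrite patchE; case: ifPn => // xO.
have [->|/f0 Ox] := eqVneq (f x) 0; first by rewrite expr0n.
by rewrite notin_setE in xO.
Qed.

Context (U : R -> V -> V).
Hypothesis UP : is_ogroup rip U.
Hypothesis Uloc : forall t F, translates t F (U t F).
Hypothesis UJ : forall t x z, rip (U t (mul_i x)) z = rip (mul_i (U t x)) z.

(** For |h| < d the translate [K] of [G] is still supported in [O], but the translation property
    determines [U h G] only where x + h is in [O]. This covers the support of [K], so [U h G] and
    [K] pair to |K|^2; both have the norm of [G], which forces them to agree. The Lipschitz bound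
    then applies to [K - G]. *)
Lemma lipschitz_energy (T : RT -> R) (L d : R) : measurable_fun setT T ->
  (forall x, `|T x| <= 1) -> 0 <= L ->
  (forall x y, `|T x - T y| <= L * `|x - y|) -> 0 < d ->
  (forall x h : R, `|h| < d -> T (x + h) != 0 -> fmset_set O x) ->
  exists M, energy_le rip U M (realf T).
Proof.
move=> mT T1 L0 TL d0 TO; set G := realf T.
have mTS t : measurable_fun setT (fun x : RT => T (x + t)).
  exact: (measurableT_comp mT (measurable_shift t)).
have sT t : sqint O (fun x : RT => T (x + t)).
  by apply: (sqint_bounded (B := 1)) => //; exact: measurable_funS (mTS t).
have sT0 : sqint O T.
  by apply: eq_sqint (sT 0) => x; rewrite addr0.
set m := fine (mu O); have m0 : 0 <= m by exact: fine_ge0.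
exists (L ^+ 2 * m + 4 * rip G G / d ^+ 2) => h.
have G0 := ip_ge0 ipP G.
(* Beyond the margin it is enough that |U h G - G|^2 <= 4 |G|^2 <= 4 |G|^2 h^2 / d^2. *)
have [hd|hd] := ltP `|h| d; last first.
  have h1 : dq rip U h G G <= 4 * rip G G.
    rewrite -(dqE ipP UP); have := ip_parallelogram ipP (U h G) G.
    by rewrite (Uiso UP); have := ip_ge0 ipP (U h G + G); lra.
  apply: le_trans h1 _; rewrite [leRHS]mulrDl.
  apply: (@le_trans _ _ (4 * rip G G / d ^+ 2 * h ^+ 2)).
    have q : 1 <= (d ^+ 2)^-1 * h ^+ 2.
      rewrite mulrC ler_pdivlMr ?exprn_gt0// mul1r -[leRHS]real_normK ?num_real//.
      by rewrite ler_sqr ?nnegrE// ltW.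
    by rewrite -(mulrA (4 * _)) ler_peMr// mulr_ge0.
  by rewrite lerDr mulr_ge0 ?sqr_ge0// mulr_ge0 ?sqr_ge0.
pose Th (x : RT) := T (x + h).
pose K := realf Th.
have sTh : sqint O Th by exact: sT.
have mTh : measurable_fun setT Th by exact: mTS.
have Ox x : T x != 0 -> fmset_set O x.
  by move=> Tx; apply: (TO x 0); rewrite ?normr0 ?addr0.
have KK : rip K K = rip G G.
  have reK : re K = Th by apply/funext => x; rewrite /re (fn_realf sTh).
  have reG : re G = T by apply/funext => x; rewrite /re (fn_realf sT0).
  rewrite (rip_realf K sTh) (rip_realf G sT0) reK reG; apply: EFin_inj.
  rewrite !rint_extend//; last by move=> x; exact: TO.
  rewrite -(integral_shift h (f := fun x => (T x ^+ 2)%:E))//.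
  - by apply/measurable_EFinP; exact: measurable_funX.
  - by move=> x; rewrite lee_fin sqr_ge0.
have UK : rip (U h G) K = rip K K.
  rewrite (rip_realf (U h G) sTh) (rip_realf K sTh).
  apply: (rint_ae (sqint_re (U h G)) (sqint_re K) sTh).
  apply: ae_imp (Uloc h G) => x hx Oxx.
  have [->|Tx] := eqVneq (Th x) 0; first by rewrite !mulr0.
  by rewrite /re (hx Oxx (Ox _ Tx)) (fn_realf sT0) (fn_realf sTh).
have z0 : rip (U h G - K) (U h G - K) = 0.
  by rewrite !E (Uiso UP) (ipC ipP K) UK KK; ring.
rewrite -(dqE ipP UP) (ip_close ipP _ z0) (rip_realfB sTh sT0).
clear z0 UK KK; clearbody K.
have sB : sqint O (fun x => Th x - T x).
  by apply: eq_sqint (sqintD mO sTh (sqintZ mO (-1) sT0)) => x; rewrite mulN1r.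
have : ((rint O (fun x => Th x - T x) (fun x => Th x - T x))%:E <=
    (L ^+ 2 * h ^+ 2 * m)%:E)%E.
  rewrite (rintE mO sB).
  apply: (@le_trans _ _ (\int[mu]_(x in O) (L ^+ 2 * h ^+ 2)%:E)%E).
    apply: ge0_le_integral => //.
    - by move=> x _; rewrite lee_fin sqr_ge0.
    - by apply/measurable_EFinP; apply: measurable_funX; exact: sB.1.
    - move=> x _; rewrite lee_fin -[leLHS]real_normK ?num_real//.
      have := TL (x + h) x; rewrite addrAC subrr add0r => H.
      rewrite -[h ^+ 2]real_normK ?num_real// -exprMn ler_sqr ?nnegrE//.
      by rewrite mulr_ge0.
  by rewrite integral_cst// (EFinM _ m) /m fineK// ge0_fin_numE.
rewrite lee_fin => /le_trans; apply.
rewrite mulrDl mulrAC lerDl mulr_ge0 ?sqr_ge0// divr_ge0 ?sqr_ge0//.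
by rewrite mulr_ge0.
Qed.

Lemma energy_le_mul_i M G : energy_le rip U M G -> energy_le rip U M (mul_i G).
Proof.
move=> GM h; apply: le_trans (GM h).
have jc := mul_i_cstructure O.
by rewrite /dq !UJ !(Jiso jc).
Qed.

Hypothesis Oopen : open (O : set R).

(** Openness gives a margin around each endpoint, and a point within this margin of ]a, b[ is in
    [a, b] or close to an endpoint. *)
Lemma trapezoid_energy (a b : R) k : a < b -> `[a, b]%classic `<=` (O : set R) ->
  exists M, energy_le rip U M (realf (trapezoid a b k)).
Proof.
move=> ab abO.
have Oab x : a <= x <= b -> exists2 e : R, 0 < e & forall y, `|x - y| < e -> fmset_set O y.
  move=> xab; have : nbhs x (O : set R).
    by apply: open_nbhs_nbhs; split => //; apply: abO; rewrite /= in_itv.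
  by case=> e /= e0 he; exists e.
have [e1 e10 h1] : exists2 e : R, 0 < e & forall y, `|a - y| < e -> fmset_set O y.
  by apply: Oab; rewrite lexx ltW.
have [e2 e20 h2] : exists2 e : R, 0 < e & forall y, `|b - y| < e -> fmset_set O y.
  by apply: Oab; rewrite lexx ltW.
apply: (@lipschitz_energy _ k%:R (Num.min e1 e2)) => //.
- exact: measurable_trapezoid.
- by move=> x; rewrite ger0_norm ?trapezoid_ge0 ?trapezoid_le1.
- by move=> x y; exact: trapezoid_lipschitz.
- by rewrite lt_min e10.
- move=> x h; rewrite lt_min !ltr_norml => /andP[/andP[h3 h4] /andP[h5 h6]] T0.
  have /andP[ax xb] : a < x + h < b.
    by apply: contrapT => /(trapezoid_out k) /eqP; rewrite (negbTE T0).
  have [xa|xa] := ltP x a.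
    by apply: h1; rewrite ltr_norml; apply/andP; split; lra.
  have [bx|bx] := ltP b x.
    by apply: h2; rewrite ltr_norml; apply/andP; split; lra.
  by apply: abO; rewrite /= in_itv/= xa.
Qed.

Lemma finite_energy_total F :
  (forall G, (exists M, energy_le rip U M G) -> rip F G = 0) -> rip F F = 0.
Proof.
move=> h.
have sTr a b k : sqint O (trapezoid a b k).
  apply: (sqint_bounded (B := 1)).
    by apply: measurable_funS (measurable_trapezoid a b k).
  by move=> x; rewrite ger0_norm ?trapezoid_ge0 ?trapezoid_le1.
have cmp0 b : {ae mu, forall x : RT, fmset_set O x -> cmp b F x = 0}.
  have ip : mu.-integrable setT (EFin \o patched b F).
    have := (integrable_mkcond _ mO).1 (sqint_integrable mO fO (sqint_cmp b F)).
    by rewrite -restrict_EFin.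
  have : {ae mu, forall x : RT, fmset_set O x -> patched b F x = 0}.
    apply: ae_eq0_of_intervals => // u v uv uvO.
    apply: intervals_of_trapezoids => // k.
    transitivity (rint O (cmp b F) (trapezoid u v k)).
      rewrite /rint [RHS]Rintegral_mkcond; apply: eq_Rintegral => x _.
      by rewrite /patched !patchE; case: ifP => // _; rewrite mul0r.
    (* The imaginary part of [F] is tested against i times a trapezoid, which has the same
       energy. *)
    have TE := trapezoid_energy k uv uvO; case: b {ip} => /=.
      by rewrite -rip_realf//; exact: h.
    have [M TM] := TE.
    have jc := mul_i_cstructure O.
    transitivity (rip F (mul_i (realf (trapezoid u v k)))); last first.
      by apply: h; exists M; exact: energy_le_mul_i.
    have -> : rip F (mul_i (realf (trapezoid u v k))) =
        rip (- mul_i F) (realf (trapezoid u v k)).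
      by rewrite -(Jiso jc (- _)) -scaleN1r (JZ jc) (JJ jc) scaleN1r opprK.
    rewrite rip_realf//; apply: eq_Rintegral => x _.
    by rewrite -scaleN1r reZ re_mul_i mulN1r opprK.
  by apply: ae_imp => x hx Ox; rewrite -patchedE// hx.
apply/rip_eq0; apply: ae_imp2 (cmp0 true) (cmp0 false) => x hr hi Ox.
by have := hr Ox; have := hi Ox; rewrite /cmp /re /im; case: (fn F x) => u v /= -> ->.
Qed.

End FiniteEnergy.

(** * Local translations and exponentials *)

Section Exponentials.
Context (R : realType) (O : fmset R).
Local Notation RT := (measurableTypeR R).
Local Notation mu := (@lebesgue_measure R).
Local Notation V := (l2 O).
Local Notation rip := (@rip R O).
Local Notation J := (@mul_i R O).
Let ipP := rip_preip O.
Let mO := fmset_measurable O.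
Let fO := fmset_finite O.
Let jc := mul_i_cstructure O.

Lemma measurable_cosM (b : R) : measurable_fun [set: RT] (fun x : RT => cos (b * x)).
Proof.
apply: (measurableT_comp (f := cos)); last exact: measurable_funM.
by apply: continuous_measurable_fun; exact: continuous_cos.
Qed.

Lemma measurable_sinM (b : R) : measurable_fun [set: RT] (fun x : RT => sin (b * x)).
Proof.
apply: (measurableT_comp (f := sin)); last exact: measurable_funM.
by apply: continuous_measurable_fun; exact: continuous_sin.
Qed.

Lemma sqint_cosM b : sqint O (fun x : RT => cos (b * x)).
Proof.
apply: (sqint_bounded (B := 1)); last by move=> x; exact: cos_max.
exact: measurable_funS (measurable_cosM b).
Qed.

Lemma sqint_sinM b : sqint O (fun x : RT => sin (b * x)).
Proof.
apply: (sqint_bounded (B := 1)); last by move=> x; exact: sin_max.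
exact: measurable_funS (measurable_sinM b).
Qed.

Lemma sqint_mulr (f h : RT -> R) : sqint O f -> measurable_fun [set: RT] h ->
  (forall x, `|h x| <= 1) -> sqint O (fun x => f x * h x).
Proof.
move=> [mf f2] mh h1.
have mh' : measurable_fun O h by exact: measurable_funS mh.
split; first exact: measurable_funM.
apply: le_integrable f2 => //.
  by apply/measurable_EFinP; apply: measurable_funX; exact: measurable_funM.
move=> x _; rewrite lee_fin !ger0_norm ?sqr_ge0// exprMn ler_piMr ?sqr_ge0//.
by rewrite -[leLHS]real_normK ?num_real// expr_le1.
Qed.

Definition ex (l : R) : V := to_l2 O (expi l).

Lemma fn_ex l : fn (ex l) = expi l.
Proof.
rewrite fn_to_l2//; apply/(L2P mO).
by split; [exact: sqint_cosM|exact: sqint_sinM].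
Qed.

Lemma re_ex l x : re (ex l) x = cos (2 * pi * l * x).
Proof. by rewrite /re fn_ex. Qed.

Lemma im_ex l x : im (ex l) x = sin (2 * pi * l * x).
Proof. by rewrite /im fn_ex. Qed.

Lemma rip_ex l : rip (ex l) (ex l) = fine (mu O).
Proof.
rewrite -(mul1r (fine _)) -(rint_cst mO fO) rint_int /rip /rint -RintegralD//.
- apply: eq_Rintegral => x _.
  by rewrite re_ex im_ex -!expr2 cos2Dsin2.
- exact: (sqint_mul mO (sqint_re _) (sqint_re _)).
- exact: (sqint_mul mO (sqint_im _) (sqint_im _)).
Qed.

Lemma rip_self_mul_i F : rip F (J F) = 0.
Proof.
have := Jadj ipP jc F F; rewrite (ipC ipP) => h; lra.
Qed.

Section Eigenvectors.
Context (U : R -> V -> V).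
Hypothesis UP : is_ogroup rip U.
Hypothesis Uloc : forall t F, translates t F (U t F).
Hypothesis UJ : forall t x z, rip (U t (J x)) z = rip (J (U t x)) z.

Local Notation eigen := (eigenvector rip U J).

Lemma eigen_ae b F t : eigen b F -> {ae mu, forall x : RT, fmset_set O x ->
  fmset_set O (x + t) ->
  re F (x + t) = cos (b * t) * re F x - sin (b * t) * im F x /\
  im F (x + t) = cos (b * t) * im F x + sin (b * t) * re F x}.
Proof.
move=> h; set G := cos (b * t) *: F + sin (b * t) *: J F.
have h0 : rip (U t F - G) (U t F - G) = 0 by exact: (eigenE ipP t h).
apply: ae_imp2 (Uloc t F) ((ae_eqE _ _).2 h0) => x h1 h2 Ox Oxt.
have {}h1 := h1 Ox Oxt; have {}h2 := h2 Ox.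
rewrite -[re F (x + t)]/(complex.Re (fn F (x + t))) -[im F (x + t)]/(complex.Im (fn F (x + t))).
rewrite -h1 h2 -[complex.Re _]/(re G x) -[complex.Im _]/(im G x) /G.
by rewrite reD imD !reZ !imZ re_mul_i im_mul_i; split; ring.
Qed.

Hypothesis muO : 0 < fine (mu O).

(* By [variance_shift], the variance of [g] on [O] is an integral of the differences
   [g (x + t) - g x] over [x] and [t], so [O] need not be connected. *)
Lemma ae_const_of_shift (g : RT -> R) : sqint O g ->
  (forall t, {ae mu, forall x : RT, fmset_set O x -> fmset_set O (x + t) ->
    g (x + t) = g x}) ->
  exists c, {ae mu, forall x : RT, fmset_set O x -> g x = c}.
Proof.
move=> sg hg; pose p : RT -> R := g \_ O.
have pE x : fmset_set O x -> p x = g x by move=> Ox; rewrite /p patchE mem_set.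
have mp : measurable_fun setT p by apply/(measurable_restrictT _ mO); exact: sg.1.
have sp : sqint O p.
  by apply: eq_in_sqint sg => // x; rewrite inE => Ox; rewrite pE.
have z t : shift_energy O p t = 0%E.
  have z0 : (\int[mu]_(x in [set: RT]) cst 0 x = 0)%E by exact: integral0.
  rewrite /shift_energy -[RHS]z0; apply: ge0_ae_eq_integral => //.
    - apply/measurable_EFinP.
      have mI : measurable_fun [set: RT] (\1_(O : set RT) : RT -> R).
        exact: measurable_indic.
      apply: measurable_funM; first apply: measurable_funM => //.
        exact: (measurableT_comp mI (measurable_shift t)).
      apply: measurable_funX; apply: measurable_funB => //.
      exact: (measurableT_comp mp (measurable_shift t)).
    - by move=> x _; rewrite lee_fin mulr_ge0 ?sqr_ge0// mulr_ge0.
    - apply: ae_imp (hg t) => x h _.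
      have [xO|xO] := boolP (x \in (O : set RT)); last by rewrite indicE (negbTE xO) !mul0r.
      have [yO|yO] := boolP ((x + t)%R \in (O : set RT)); last first.
        by rewrite [\1_O (x + t)%R]indicE (negbTE yO) mulr0 mul0r.
      rewrite !inE in xO yO.
      by rewrite !pE// h// subrr expr0n /= mulr0.
set m := fine (mu O); set I := rint O p (fun=> 1).
have := variance_shift mO fO mp sp.
rewrite (_ : (\int[mu]_s _)%E = 0%E); last first.
  by rewrite integral0_eq// => s _; exact: z.
move=> [] /eqP; rewrite mulf_eq0 pnatr_eq0/= subr_eq0 => /eqP var.
exists (I / m).
have sb : sqint O (fun x => p x - I / m).
  exact: (sqintD mO sp (sqint_cst mO fO _)).
have : rint O (fun x => p x - I / m) (fun x => p x - I / m) = 0.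
  have := rint_sqB mO fO (I / m) sp.
  rewrite /rint; under eq_Rintegral do rewrite expr2.
  move=> ->; rewrite -/(rint O p p) -/(rint O p (fun=> 1)) -/I -/m.
  have -> : rint O p p = I ^+ 2 / m by rewrite -var -/m; field; rewrite gt_eqF.
  by field; rewrite gt_eqF.
move=> /(rint_eq0 sb); apply: ae_imp => x h Ox.
by have := h Ox; rewrite pE// => /eqP; rewrite subr_eq0 => /eqP.
Qed.

Lemma eigen_exponential l F : eigen (2 * pi * l) F ->
  exists c1 c2 : R, let G := c1 *: ex l + c2 *: J (ex l) in rip (F - G) (F - G) = 0.
Proof.
set b := 2 * pi * l => h.
(* [g1] and [g2] are the real and imaginary parts of exp (- i b x) F(x); the eigenvector equation
   makes this product invariant under shifts inside [O]. *)
pose g1 (x : RT) := re F x * cos (b * x) + im F x * sin (b * x).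
pose g2 (x : RT) := im F x * cos (b * x) - re F x * sin (b * x).
have inv t : {ae mu, forall x : RT, fmset_set O x -> fmset_set O (x + t) ->
    g1 (x + t) = g1 x /\ g2 (x + t) = g2 x}.
  apply: ae_imp (eigen_ae t h) => x hx Ox Oxt; have [h1 h2] := hx Ox Oxt.
  rewrite /g1 /g2 h1 h2 mulrDr cosD sinD.
  have := cos2Dsin2 (b * t); set c := cos (b * t); set s := sin (b * t) => cs.
  move: (re F x) (im F x) (cos (b * x)) (sin (b * x)) => u v cx sx; split.
    transitivity ((c ^+ 2 + s ^+ 2) * (u * cx + v * sx)); first ring.
    by rewrite cs mul1r.
  transitivity ((c ^+ 2 + s ^+ 2) * (v * cx - u * sx)); first ring.
  by rewrite cs mul1r.
have mc := measurable_cosM b; have ms := measurable_sinM b.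
have sc f : sqint O f -> sqint O (fun x => f x * cos (b * x)).
  by move=> sf; apply: (sqint_mulr sf mc) => x; exact: cos_max.
have ss f : sqint O f -> sqint O (fun x => f x * sin (b * x)).
  by move=> sf; apply: (sqint_mulr sf ms) => x; exact: sin_max.
have sr := sqint_re F; have si := sqint_im F.
have sg1 : sqint O g1 by exact: (sqintD mO (sc _ sr) (ss _ si)).
have sg2 : sqint O g2.
  apply: eq_sqint (sqintD mO (sc _ si) (sqintZ mO (-1) (ss _ sr))) => x.
  by rewrite mulN1r.
have [|c1 h1] := ae_const_of_shift sg1.
  by move=> t; apply: ae_imp (inv t) => x hx Ox Oxt; have [] := hx Ox Oxt.
have [|c2 h2] := ae_const_of_shift sg2.
  by move=> t; apply: ae_imp (inv t) => x hx Ox Oxt; have [] := hx Ox Oxt.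
exists c1, c2 => G; apply: (ae_eqE _ _).1.
apply: ae_imp2 h1 h2 => x e1 e2 Ox; have {}e1 := e1 Ox; have {}e2 := e2 Ox.
have cd := cos2Dsin2 (b * x).
have reG : re G x = c1 * cos (b * x) - c2 * sin (b * x).
  by rewrite reD !reZ re_mul_i re_ex im_ex; ring.
have imG : im G x = c1 * sin (b * x) + c2 * cos (b * x).
  by rewrite imD !imZ im_mul_i re_ex im_ex; ring.
have reF : re F x = re G x.
  rewrite reG -e1 -e2 /g1 /g2 -[LHS]mulr1 -cd; ring.
have imF : im F x = im G x.
  rewrite imG -e1 -e2 /g1 /g2 -[LHS]mulr1 -cd; ring.
move: reF imF; rewrite /re /im.
by case: (fn F x) => u v; case: (fn G x) => u' v' /= -> ->.
Qed.
End Eigenvectors.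
End Exponentials.

(** * Translated trigonometric polynomials and their limits *)

Section Shift.
Context (R : realType) (O : fmset R).
Local Notation RT := (measurableTypeR R).
Local Notation mu := (@lebesgue_measure R).
Local Notation V := (l2 O).
Local Notation rip := (@rip R O).
Local Notation J := (@mul_i R O).
Let ipP := rip_preip O.
Let mO := fmset_measurable O.
Let jc := mul_i_cstructure O.

Lemma fn_complexZ (F : V) (a b : R) x :
  fn (a *: F + b *: J F) x = Complex a b * fn F x.
Proof.
rewrite fnD !fnZ fn_mul_i /re /im; case: (fn F x) => u v /=.
by congr Complex; ring.
Qed.

Lemma fn_lincomb s x : fn (lincomb J (@ex R O) s) x =
  \sum_(p <- s) Complex p.2.1 p.2.2 * expi p.1 x.
Proof.
elim: s => [|p s IH]; first by rewrite /lincomb !big_nil fn0.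
by rewrite /lincomb !big_cons fnD -/(lincomb _ _ _) IH fn_complexZ fn_ex.
Qed.

(** Meant for trigonometric polynomials, which are given on the whole line; the values of a general
    representative at points x + t outside [O] are arbitrary. Acting on functions makes it
    independent of the choice of coefficients. *)
Definition l2_shift (t : R) (F : V) : V := to_l2 O (fun x => fn F (x + t)).

Lemma shift_lincombE t s x :
  fn (lincomb J (@ex R O) [seq rotate (2 * pi) t p | p <- s]) x =
  fn (lincomb J (@ex R O) s) (x + t).
Proof.
rewrite !fn_lincomb big_map; apply: eq_bigr => -[l [u v]] _ /=.
rewrite /expi (mulrDr (2 * pi * l)) cosD sinD.
move: (cos (2 * pi * l * x)) (sin (2 * pi * l * x)) => a b.
move: (cos (2 * pi * l * t)) (sin (2 * pi * l * t)) => c d.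
rewrite -[LHS]/(Complex _ _) -[RHS]/(Complex _ _); congr Complex; ring.
Qed.

Lemma shift_lincomb t s : l2_shift t (lincomb J (@ex R O) s) =
  lincomb J (@ex R O) [seq rotate (2 * pi) t p | p <- s].
Proof.
rewrite -[RHS]fnK /l2_shift; congr to_l2; apply/funext => x.
by rewrite shift_lincombE.
Qed.

Lemma fn_shift_lincomb t s x : fn (l2_shift t (lincomb J (@ex R O) s)) x =
  fn (lincomb J (@ex R O) s) (x + t).
Proof. by rewrite shift_lincomb shift_lincombE. Qed.

(** Its integral depends on [X] and [Y] in a way controlled by norms, so the translation property,
    expressed by its vanishing, survives limits. *)
Definition local_defect b t (X Y : V) (x : RT) : R :=
  \1_(O : set RT) x * \1_(O : set RT) (x + t) *
    (patched b Y x - patched b X (x + t)) ^+ 2.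

Lemma measurable_local_defect b t X Y :
  measurable_fun [set: RT] (local_defect b t X Y).
Proof.
have mI : measurable_fun [set: RT] (\1_(O : set RT) : RT -> R).
  exact: measurable_indic.
have ms := measurable_shift t.
apply: measurable_funM; first apply: measurable_funM => //.
  exact: (measurableT_comp mI ms).
apply: measurable_funX; apply: measurable_funB; first exact: measurable_patched.
exact: (measurableT_comp (measurable_patched b X) ms).
Qed.

Lemma local_defect_ge0 b t X Y x : 0 <= local_defect b t X Y x.
Proof. by rewrite mulr_ge0 ?sqr_ge0// mulr_ge0. Qed.

(** Insert the common value G(x) = F(x + t), use (u + v)^2 <= 2 u^2 + 2 v^2, and remove the shift
    from the second term by translation invariance. *)
Lemma local_defect_le b t (X Y F G : V) : (forall x, fn G x = fn F (x + t)) ->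
  (\int[mu]_x (local_defect b t X Y x)%:E <=
    (2 * (rip (Y - G) (Y - G) + rip (X - F) (X - F)))%:E)%E.
Proof.
move=> FG; set A := Y - G; set B := X - F.
pose P (C : V) (x : RT) : R := \1_(O : set RT) x * patched b C x ^+ 2.
have mI : measurable_fun [set: RT] (\1_(O : set RT) : RT -> R).
  exact: measurable_indic.
have mP C : measurable_fun [set: RT] (P C).
  by apply: measurable_funM => //; apply: measurable_funX; exact: measurable_patched.
have P0 C x : 0 <= P C x by rewrite mulr_ge0 ?sqr_ge0.
have PE C : (\int[mu]_x (P C x)%:E <= (rip C C)%:E)%E.
  rewrite integral_indicE//; apply: (@le_trans _ _ (rint O (cmp b C) (cmp b C))%:E).
    rewrite (rintE mO (sqint_cmp b C)) le_eqVlt; apply/orP; left; apply/eqP.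
    by apply: eq_integral => x; rewrite inE => Ox; rewrite patchedE.
  by rewrite lee_fin; exact: rint_cmp_le.
have PsE C : (\int[mu]_x (P C (x + t)%R)%:E <= (rip C C)%:E)%E.
  apply: le_trans (PE C); rewrite (integral_shift t (f := fun x => (P C x)%:E))//.
    by apply/measurable_EFinP; exact: mP.
  by move=> x; rewrite lee_fin; exact: P0.
have ms := measurable_shift t.
apply: (@le_trans _ _ (\int[mu]_x ((2 * P A x)%:E + (2 * P B (x + t)%R)%:E))%E).
  apply: (ge0_le_integral mu measurableT).
  - by move=> x _; rewrite lee_fin; exact: local_defect_ge0.
  - by apply/measurable_EFinP; exact: measurable_local_defect.
  - apply: emeasurable_funD; apply/measurable_EFinP; apply: measurable_funM => //.
    exact: (measurableT_comp (mP B) ms).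
  - move=> x _; rewrite -EFinD lee_fin /local_defect.
    have [xO|xO] := boolP (x \in (O : set RT)); last first.
      rewrite indicE (negbTE xO) !mul0r.
      by apply: addr_ge0; apply: mulr_ge0 => //; exact: P0.
    have [yO|yO] := boolP ((x + t)%R \in (O : set RT)); last first.
      rewrite [\1_O (x + t)%R]indicE (negbTE yO) mulr0 mul0r.
      by apply: addr_ge0; apply: mulr_ge0 => //; exact: P0.
    rewrite /P !indicE xO yO !mul1r; rewrite !inE in xO yO.
    rewrite !patchedE// /A /B !cmpB.
    have -> : cmp b G x = cmp b F (x + t) by rewrite /cmp; case: (b); rewrite /re /im FG.
    set u := cmp b Y x; set v := cmp b F (x + t); set w := cmp b X (x + t).
    have := sqr_ge0 ((u - v) + (w - v)); rewrite !expr2; lra.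
rewrite ge0_integralD//; last 4 first.
- by move=> x _; rewrite lee_fin; apply: mulr_ge0 => //; exact: P0.
- by apply/measurable_EFinP; apply: measurable_funM => //; exact: mP.
- by move=> x _; rewrite lee_fin; apply: mulr_ge0 => //; exact: P0.
- apply/measurable_EFinP; apply: measurable_funM => //.
  exact: (measurableT_comp (mP B) ms).
under eq_integral do rewrite EFinM.
under [X in (_ + X <= _)%E]eq_integral do rewrite EFinM.
rewrite ge0_integralZl_EFin//; last 2 first.
- by move=> x _; rewrite lee_fin; exact: P0.
- by apply/measurable_EFinP; exact: mP.
rewrite ge0_integralZl_EFin//; last 2 first.
- by move=> x _; rewrite lee_fin; exact: P0.
- by apply/measurable_EFinP; exact: (measurableT_comp (mP B) ms).
have -> (u v : R) : (2 * (u + v))%:E = (2%:E * u%:E + 2%:E * v%:E)%E.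
  by rewrite -!EFinM -EFinD; congr EFin; ring.
apply: leeD.
  by apply: lee_wpmul2l; [rewrite lee_fin|exact: PE].
by apply: lee_wpmul2l; [rewrite lee_fin|exact: PsE].
Qed.

Lemma translates_limit t (X Y : V) (w : nat -> V) :
  (forall n x, fn (l2_shift t (w n)) x = fn (w n) (x + t)) ->
  ncvg rip w X -> ncvg rip (fun n => l2_shift t (w n)) Y -> translates t X Y.
Proof.
move=> ws wX wY.
have D0 b : (\int[mu]_x (local_defect b t X Y x)%:E = 0)%E.
  apply/eqP; rewrite eq_le integral_ge0 ?andbT; last first.
    by move=> x _; rewrite lee_fin; exact: local_defect_ge0.
  have c : (fun n => 2 * (rip (Y - l2_shift t (w n)) (Y - l2_shift t (w n)) +
      rip (X - w n) (X - w n))) @ \oo --> (0 : R).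
    rewrite -[X in _ --> X](mulr0 2); apply: cvgM; first exact: cvg_cst.
    rewrite -[X in _ --> X]addr0.
    exact: (cvgD (ncvg_dist2 ipP wY) (ncvg_dist2 ipP wX)).
  apply/lee_addgt0Pr => d d0; rewrite add0e.
  move/cvgrPdist_lt : c => /(_ _ d0)[N _ /(_ N (leqnn N))] /=.
  rewrite sub0r normrN => /(le_lt_trans (ler_norm _))/ltW h.
  apply: (@le_trans _ _ (2 * (rip (Y - l2_shift t (w N)) (Y - l2_shift t (w N)) +
    rip (X - w N) (X - w N)))%:E); last by rewrite lee_fin.
  by apply: local_defect_le => x; exact: ws.
have ae0 b : {ae mu, forall x : RT, local_defect b t X Y x = 0}.
  have mD : measurable_fun [set: RT] (fun x => (local_defect b t X Y x)%:E).
    by apply/measurable_EFinP; exact: measurable_local_defect.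
  have := (ae_eq_integral_abs mu measurableT mD).1.
  have -> : (\int[mu]_x `|(local_defect b t X Y x)%:E| = 0)%E.
    rewrite -(D0 b); apply: eq_integral => x _.
    by rewrite gee0_abs// lee_fin; exact: local_defect_ge0.
  move=> /(_ erefl); apply: ae_imp => x /(_ I) /= h.
  exact: EFin_inj h.
apply: ae_imp2 (ae0 true) (ae0 false) => x ht hf Ox Oxt.
have eqc b : local_defect b t X Y x = 0 -> cmp b Y x = cmp b X (x + t).
  rewrite /local_defect !indicE (mem_set Ox) (mem_set Oxt) !mul1r !patchedE//.
  by move=> /eqP; rewrite sqrf_eq0 subr_eq0 => /eqP.
have := eqc _ ht; have := eqc _ hf; rewrite /cmp /re /im.
by case: (fn Y x) => u v; case: (fn X (x + t)) => u' v' /= -> ->.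
Qed.

End Shift.

(** * Both implications for a set of finite positive measure *)

Section Fuglede.
Context (R : realType) (O : fmset R).
Local Notation RT := (measurableTypeR R).
Local Notation mu := (@lebesgue_measure R).
Local Notation V := (l2 O).
Local Notation rip := (@rip R O).
Local Notation J := (@mul_i R O).
Let ipP := rip_preip O.
Let mO := fmset_measurable O.
Let jc := mul_i_cstructure O.

Hypothesis muO : 0 < fine (mu O).

Let c0 : R := (Num.sqrt (fine (mu O)))^-1.

Let c0_gt0 : 0 < c0. Proof. by rewrite invr_gt0 sqrtr_gt0. Qed.

Let c02 : c0 ^+ 2 * fine (mu O) = 1.
Proof. by rewrite exprVn sqr_sqrtr ?(ltW muO)// mulVf ?gt_eqF. Qed.

Definition character l : R -> R[i] :=
  fun x => (real_complex R (Num.sqrt (fine (mu O)))^-1) * expi l x.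

Lemma fn_character l : fn (c0 *: ex O l) = character l.
Proof.
apply/funext => x; rewrite fnZ fn_ex /character /expi /=.
by congr Complex; rewrite /c0; ring.
Qed.

Lemma inner_character l l' : inner O (character l) (character l') =
  Complex (c0 ^+ 2 * rip (ex O l) (ex O l')) (c0 ^+ 2 * rip (ex O l) (J (ex O l'))).
Proof.
rewrite -!fn_character innerE (JZ jc) !(ipZl ipP) !(ipZr ipP).
by congr Complex; ring.
Qed.

(** The two kinds of combination differ only in encoding: complex coefficients indexed by ordinals
    against a list of real pairs, with the norming constant moved into the coefficients. *)
Lemma total_characters (L : set R) : Defs.total_on O L character <->
  forall (F : V) (d : R), 0 < d ->
    exists2 w, cspan J (@ex R O) L w & nrm rip (F - w) < d.
Proof.
split.
  move=> h F d d0; have [m [k [c [Lk hc]]]] := h _ (fnP F) _ d0.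
  pose s := [seq (k j, (complex.Re (c j) * c0, complex.Im (c j) * c0)) | j <- enum 'I_m].
  exists (lincomb J (@ex R O) s).
    by exists s; split => // p /mapP[j _ ->]; exact: Lk.
  move: hc; rewrite -L2normE; congr (is_true (L2norm _ _ < _)).
  apply/funext => x; rewrite fnB fn_lincomb big_map big_enum /=; congr (_ - _).
  apply: eq_bigr => j _; rewrite /character mulrA; congr (_ * _).
  by rewrite -/c0; case: (c j) => u v /=; congr Complex; ring.
move=> h f Lf d d0; have [w [s [Ls ->]] hw] := h (to_l2 O f) d d0.
exists (size s), (fun j => (nth (0, (0, 0)) s j).1),
  (fun j => let q := (nth (0, (0, 0)) s j).2 in Complex (q.1 / c0) (q.2 / c0)).
split; first by move=> j; apply: Ls; exact: mem_nth.
move: hw; rewrite -L2normE; congr (is_true (L2norm _ _ < _)).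
apply/funext => x; rewrite fnB (fn_to_l2 Lf) fn_lincomb; congr (_ - _).
rewrite (big_nth (0, (0, 0))) big_mkord; apply: eq_bigr => j _.
rewrite /character mulrA; congr (_ * _); rewrite -/c0.
case: (nth _ s j) => l [u v] /=; congr Complex; field; rewrite gt_eqF//.
Qed.

Lemma weak_ae_eq (F G : V) : (forall z, rip F z = rip G z) ->
  ae_eq_on O (fn F) (fn G).
Proof. by move=> h; apply/ae_eqE; rewrite (ipBl ipP) h subrr. Qed.

Lemma ae_eq_weak (F G : V) z : ae_eq_on O (fn F) (fn G) -> rip F z = rip G z.
Proof. by move=> /ae_eqE; exact: (ip_congr ipP). Qed.

Section UnitaryGroup.
Context (U : R -> V -> V).
Hypothesis UP : is_ogroup rip U.
Hypothesis UJ : forall t x z, rip (U t (J x)) z = rip (J (U t x)) z.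
Hypothesis Ucont : forall x t0, nrm rip (U t x - U t0 x) @[t --> t0] --> (0 : R).

Definition fun_group t (f : R -> R[i]) : R -> R[i] := fn (U t (to_l2 O f)).

Lemma fun_group_unitary t : unitary_on O (fun_group t).
Proof.
split.
- split=> [f _|f g Lf Lg fg]; first exact: fnP.
  apply: weak_ae_eq => z; rewrite !(Uadj ipP UP); apply: ae_eq_weak.
  by rewrite (fn_to_l2 Lf) (fn_to_l2 Lg).
- move=> [u v] f g Lf Lg.
  set F := to_l2 O f; set G := to_l2 O g.
  have E : fn ((u *: F + v *: J F) + G) = (fun x => Complex u v * f x + g x).
    apply/funext => x; rewrite fnD fn_complexZ.
    by rewrite /F /G (fn_to_l2 Lf) (fn_to_l2 Lg).
  have E' : fn ((u *: U t F + v *: J (U t F)) + U t G) =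
      (fun x => Complex u v * fun_group t f x + fun_group t g x).
    by apply/funext => x; rewrite fnD fn_complexZ.
  rewrite -E' /fun_group -E fnK; apply: weak_ae_eq => z.
  rewrite (UDl UP) (UDl UP) !(UZl UP) UJ.
  by rewrite (ipDl ipP _ (U t G)) (ipDl ipP) !(ipZl ipP).
- move=> f g Lf Lg; rewrite innerE (Uiso UP).
  have -> : rip (U t (to_l2 O f)) (J (U t (to_l2 O g))) =
      rip (to_l2 O f) (J (to_l2 O g)).
    by rewrite (ipC ipP) -UJ (ipC ipP) (Uiso UP).
  by rewrite -innerE (fn_to_l2 Lf) (fn_to_l2 Lg).
- move=> g Lg; exists (fn (U (- t) (to_l2 O g))); first exact: fnP.
  rewrite -[X in ae_eq_on _ _ X](fn_to_l2 Lg) /fun_group fnK.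
  by apply: weak_ae_eq => z; rewrite -(Uadd UP) subrr (Uid UP).
Qed.

Lemma fun_group_unitary_group : unitary_group_on O fun_group.
Proof.
split.
- exact: fun_group_unitary.
- move=> f Lf; rewrite -[X in ae_eq_on _ _ X](fn_to_l2 Lf).
  by apply: weak_ae_eq => z; exact: (Uid UP).
- move=> s t f Lf; rewrite /fun_group fnK; apply: weak_ae_eq => z.
  exact: (Uadd UP).
- move=> f Lf t0; rewrite /fun_group.
  rewrite (_ : (fun t => L2norm _ _) = fun t =>
    nrm rip (U t (to_l2 O f) - U t0 (to_l2 O f))); first exact: Ucont.
  by apply/funext => t; rewrite -L2normE.
Qed.

End UnitaryGroup.

Lemma translations_of_spectral : spectral O ->
  exists U : R -> (R -> R[i]) -> (R -> R[i]),
    unitary_group_on O U /\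
    forall (t : R) (f : R -> R[i]), L2 O f ->
      {ae mu, forall x : RT, fmset_set O x -> fmset_set O (x + t) ->
        U t f x = f (x + t)}.
Proof.
move=> [L [[_ orth] /total_characters tot]].
have e_orth l l' : L l -> L l' -> l != l' ->
    rip (ex O l) (ex O l') = 0 /\ rip (ex O l) (J (ex O l')) = 0.
  move=> Ll Ll' ll'; have := orth l l' Ll Ll'.
  rewrite -/(character l) -/(character l') inner_character (negbTE ll').
  move=> /eqP; rewrite eq_complex /= => /andP[/eqP h1 /eqP h2].
  by split; apply/eqP; [move/eqP: h1|move/eqP: h2];
    rewrite mulf_eq0 expf_eq0 /= gt_eqF.
set T := @l2_shift R O; set e := @ex R O; set W := cspan J e L.
have Tl : forall t s, T t (lincomb J e s) =
    lincomb J e [seq rotate (2 * pi) t p | p <- s] by exact: shift_lincomb.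
have cpl := @rip_complete R O.
pose U := extension rip W T.
have UP : is_ogroup rip U by exact: (extension_ogroup ipP cpl jc e_orth Tl tot).
have UJ : forall t x z, rip (U t (J x)) z = rip (J (U t x)) z.
  exact: (extension_mul_i ipP cpl jc e_orth Tl tot).
have Uc : forall x t0, nrm rip (U t x - U t0 x) @[t --> t0] --> (0 : R).
  exact: (extension_continuous ipP cpl (@cspanD _ _ J e L) (@cspanZ _ _ J e L)
    tot (T_lin Tl) (T_iso ipP jc e_orth Tl) (T_continuous ipP jc e_orth Tl)).
exists (fun_group U); split; first exact: fun_group_unitary_group.
move=> t f Lf.
have [w [Ww wx wy]] := extends_extension ipP cpl jc e_orth Tl tot t (to_l2 O f).
have := translates_limit _ wx wy.
rewrite /translates (fn_to_l2 Lf); apply => n x.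
by have [s [_ ->]] := Ww n; exact: fn_shift_lincomb.
Qed.

Section Spectral.
Context (n : nat) (alpha beta : 'I_n -> R).
Hypothesis lt_alpha_beta : forall i, alpha i < beta i.
Hypothesis defO : (O : set RT) = \bigcup_(i in [set: 'I_n]) `]alpha i, beta i[%classic.
Hypothesis Oopen : open (O : set R).
Context (U0 : R -> (R -> R[i]) -> (R -> R[i])).
Hypothesis U0P : unitary_group_on O U0.
Hypothesis U0loc : forall (t : R) (f : R -> R[i]), L2 O f ->
  {ae mu, forall x : RT, fmset_set O x -> fmset_set O (x + t) ->
    U0 t f x = f (x + t)}.

Definition l2_group t (F : V) : V := to_l2 O (U0 t (fn F)).

Lemma fn_l2_group t F : fn (l2_group t F) = U0 t (fn F).
Proof.
have [UU _ _ _] := U0P; have [[UL _] _ _ _] := UU t.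
by rewrite /l2_group fn_to_l2//; apply: UL; exact: fnP.
Qed.

(** One complex scalar u + i v serves twice: v = 0 gives real linearity, and u = 0, v = 1 gives
    commutation with [J]. *)
Lemma l2_group_linear t u v (F G : V) z :
  rip (l2_group t ((u *: F + v *: J F) + G)) z =
  u * rip (l2_group t F) z + v * rip (J (l2_group t F)) z + rip (l2_group t G) z.
Proof.
have [UU _ _ _] := U0P; have [_ Ul _ _] := UU t.
rewrite -!(ipZl ipP) -!(ipDl ipP); apply: ae_eq_weak.
have := Ul (Complex u v) _ _ (fnP F) (fnP G).
rewrite fn_l2_group; set A := (X in U0 t X).
have -> : A = fn ((u *: F + v *: J F) + G).
  by apply/funext => x; rewrite /A fnD fn_complexZ.
set B := (X in ae_eq_on _ _ X).
have -> // : B = fn ((u *: l2_group t F + v *: J (l2_group t F)) + l2_group t G).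
by apply/funext => x; rewrite /B fnD fn_complexZ !fn_l2_group.
Qed.

Lemma l2_group_ogroup : is_ogroup rip l2_group.
Proof.
have [UU Ui Ua Uc] := U0P; split.
- move=> t F G; have [_ _ Uin _] := UU t.
  have := Uin _ _ (fnP F) (fnP G); rewrite -!fn_l2_group !innerE.
  by move=> /(congr1 (@complex.Re R)).
- move=> t a F G z.
  have := l2_group_linear t a 0 F G z.
  by rewrite scale0r addr0 mul0r addr0.
- move=> F z; apply: ae_eq_weak; rewrite fn_l2_group; apply: Ui; exact: fnP.
- move=> s t F z; apply: ae_eq_weak; rewrite !fn_l2_group; apply: Ua; exact: fnP.
- move=> F z t0; have := Uc _ (fnP F) t0.
  rewrite (_ : (fun t => L2norm _ _) = fun t =>
    nrm rip (l2_group t F - l2_group t0 F)); last first.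
    apply/funext => t; rewrite -L2normE; congr L2norm; apply/funext => x.
    by rewrite fnB !fn_l2_group.
  exact: (weak_continuous ipP).
Qed.

Lemma l2_group_mul_i t F z : rip (l2_group t (J F)) z = rip (J (l2_group t F)) z.
Proof.
have := l2_group_linear t 0 1 F 0 z; rewrite scale0r add0r scale1r addr0 => ->.
rewrite (U0v l2_group_ogroup).
move: (rip (l2_group t F) z) (rip (J (l2_group t F)) z) => p q; ring.
Qed.

Lemma l2_group_translates t F : translates t F (l2_group t F).
Proof. by have := U0loc t (fnP F); rewrite -fn_l2_group. Qed.

Lemma spectral_of_translations : spectral O.
Proof.
have UP := l2_group_ogroup; have UJ := l2_group_mul_i.
have Ul := l2_group_translates.
pose L := spectrum rip l2_group J (@ex R O) (2 * pi).
have pi2 : 0 < 2 * pi :> R by rewrite mulr_gt0// pi_gt0.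
exists L; split; last first.
  apply/total_characters => F d d0.
  have := (spectrum_total ipP (@rip_complete R O) UP jc UJ
    (compact_energy_l2 lt_alpha_beta defO UP Ul)
    (finite_energy_total UP Ul UJ Oopen) pi2
    (eigen_exponential Ul muO) F d0).
  exact.
split=> [l _|l l' Ll Ll'].
  by rewrite -/(character l) -fn_character; exact: fnP.
rewrite -/(character l) -/(character l') inner_character.
have [<-|ll'] := eqVneq l l'.
  by rewrite rip_ex c02 rip_self_mul_i mulr0.
(* [J (ex O l')] is an eigenvector for the same eigenvalue as [ex O l'], so orthogonality of
   eigenvectors kills both the real and the imaginary part of the inner product. *)
have kk : 2 * pi * l != 2 * pi * l'.
  by apply: contra_neq ll'; apply: mulfI; rewrite gt_eqF.
rewrite (eigen_orthogonal ipP UP jc kk Ll Ll').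
rewrite (eigen_orthogonal ipP UP jc kk Ll (eigen_mul_i ipP jc UJ Ll')).
by rewrite mulr0.
Qed.

End Spectral.

End Fuglede.

Theorem theorem4p1 (R : realType) (n : nat) (alpha beta : 'I_n -> R)
    (n_gt0 : (0 < n)%N)
    (lt_alpha_beta : forall i : 'I_n, alpha i < beta i)
    (lt_beta_alpha : forall i j : 'I_n, (i < j)%N -> beta i < alpha j)
    (Omega : set R)
    (defOmega : Omega = \bigcup_(i in [set: 'I_n]) `]alpha i, beta i[%classic) :
  spectral Omega <->
  exists U : R -> (R -> R[i]%C) -> (R -> R[i]%C),
    unitary_group_on Omega U /\
    forall (t : R) (f : R -> R[i]%C), L2 Omega f ->
      {ae @lebesgue_measure R, forall x,
        (Omega `&` [set y - t | y in Omega]) x -> U t f x = f (x + t)}.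
Proof.
pose i0 := Ordinal n_gt0.
pose a := \big[Order.min/alpha i0]_i alpha i.
pose b := \big[Order.max/beta i0]_i beta i.
have Oopen : open Omega.
  by rewrite defOmega; apply: bigcup_open => i _; exact: interval_open.
have mO : measurable (Omega : set (measurableTypeR R)) by exact: open_measurable.
have Oab : Omega `<=` `[a, b]%classic.
  rewrite defOmega => x [i _] /=; rewrite !in_itv /= => /andP[ax xb].
  apply/andP; split.
    by apply: le_trans (ltW ax); exact: bigmin_le_cond.
  by apply: le_trans (ltW xb) _; exact: le_bigmax_cond.
have fO : (@lebesgue_measure R Omega < +oo)%E.
  apply: (@le_lt_trans _ _ (@lebesgue_measure R `[a, b]%classic)).
    by apply: le_measure => //; rewrite inE.
  by rewrite lebesgue_measure_itv; case: ifP => _; rewrite ltry.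
(* The characters are normed by |Omega|^(-1/2), and means over Omega divide by |Omega|. *)
have muO : 0 < fine (@lebesgue_measure R Omega).
  have h : (0 < @lebesgue_measure R Omega)%E.
    apply: (@lt_le_trans _ _ (@lebesgue_measure R `]alpha i0, beta i0[%classic)).
      rewrite lebesgue_measure_itv /= lte_fin lt_alpha_beta.
      by rewrite -EFinD lte_fin subr_gt0.
    apply: le_measure => //; rewrite ?inE// defOmega.
    by move=> x hx; exists i0.
  by rewrite fine_gt0// h fO.
pose O := Fmset mO fO.
have overlap (t x : R) : (Omega `&` [set y - t | y in Omega]) x <->
    Omega x /\ Omega (x + t).
  split=> [[Ox [y Oy yx]]|[Ox Oxt]]; first by rewrite -yx subrK yx.
  by split=> //; exists (x + t) => //; rewrite addrK.
split=> [/(@translations_of_spectral _ O muO)[U [UP Uloc]]|[U [UP Uloc]]].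
  exists U; split => // t f Lf; apply: ae_imp (Uloc t f Lf) => x h /overlap[Ox].
  exact: h.
apply: (@spectral_of_translations _ O muO _ _ _ lt_alpha_beta defOmega Oopen U UP).
move=> t f Lf; apply: ae_imp (Uloc t f Lf) => x h Ox Oxt.
by apply: h; apply/overlap.
Qed.
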